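(* Let $(X,d)$ be a metric space, $\phi:X\to(-\infty,+\infty]$ a proper lower semicontinuous functional, $\lambda\in\mathbb R$, and let $u,u^1,u^2\in C^0([0,+\infty);X)$ be solutions of $\mathrm{EVI}_\lambda(X,d,\phi)$. Then the following claims hold. **$\lambda$-contraction and uniqueness.** $$d(u^1_t,u^2_t)\le e^{-\lambda(t-s)}d(u^1_s,u^2_s)\quad\text{for every }0\le s<t<+\infty.$$ In particular, for every $u_0\in\overline{\mathrm{Dom}(\phi)}$ there is at most one solution $u$ of $\mathrm{EVI}_\lambda(X,d,\phi)$ satisfying $\lim_{t\downarrow0}u_t=u_0$. **Regularizing effects.** $u$ is locally Lipschitz in $(0,+\infty)$ and $u_t\in\mathrm{Dom}(|\partial\phi|)\subset\mathrm{Dom}(\phi)$ for every $t>0$; the map $t\in[0,+\infty)\mapsto\phi(u_t)$ is nonincreasing, and it is convex if $\lambda\ge0$, locally semi-convex in $(0,+\infty)$ if $\lambda<0$; the map $t\in[0,+\infty)\mapsto e^{\lambda t}|\partial\phi|(u_t)$ is nonincreasing and right continuous. **A priori estimates.** For every $v\in\mathrm{Dom}(\phi)$ and $t>0$ $$\frac{e^{\lambda t}}2d^2(u_t,v)+\mathsf E_\lambda(t)\big(\phi(u_t)-\phi(v)\big)+\frac{(\mathsf E_\lambda(t))^2}2|\partial\phi|^2(u_t)\le\frac12d^2(u_0,v),$$ and for every $v\in\mathrm{Dom}(\mathfrak L_\lambda[\phi])$ and $t>0$ $$|\partial\phi|^2(u_t)\le\frac1{2e^{\lambda t}-1}\,\mathfrak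 L_\lambda^2[\phi](v)+\frac1{(\mathsf E_\lambda(t))^2}d^2(u_0,v)\quad\text{provided }-\lambda t<\log2.$$ **Asymptotic expansions as $t\downarrow0$.** If $u_0\in\mathrm{Dom}(|\partial\phi|)$ and $\lambda\le0$, then for every $v\in\mathrm{Dom}(\phi)$, $t\ge0$ $$\frac{e^{2\lambda t}}2d^2(u_t,v)-\frac12d^2(u_0,v)\le\mathsf E_{2\lambda}(t)\big(\phi(v)-\phi(u_0)\big)+\frac{t^2}2|\partial\phi|^2(u_0).$$ The functional $x\mapsto\phi(x)-\frac\lambda2d^2(x,o)$ is linearly bounded from below for all $o\in\mathrm{Dom}(\phi)$, and for every $u_0,v\in\mathrm{Dom}(\phi)$, $t\ge0$ $$\frac{e^{\lambda t}}2d^2(u_t,v)-\frac12d^2(u_0,v)\le\mathsf E_\lambda(t)\big(\phi(v)-\phi(u_0)\big)+2e^{-\lambda t}\int_0^te^{2\lambda s}\big(\phi(u_0)-\phi_{\mathsf E_\lambda(s)}(u_0)\big)\,\mathrm ds.$$ **Right, left limits and energy identity.** For every $t>0$ the right limits $$|\dot u_{t+}|:=\lim_{h\downarrow0}\frac{d(u_{t+h},u_t)}h,\qquad\frac{\mathrm d}{\mathrm dt}\phi(u_{t+}):=\lim_{h\downarrow0}\frac{\phi(u_{t+h})-\phi(u_t)}h$$ exist finite, satisfy $$\frac{\mathrm d}{\mathrm dt}\phi(u_{t+})=-|\dot u_{t+}|^2=-|\partial\phi|^2(u_t)=-|\partial\phi|_\ell^2(u_t)=-\mathfrak L_\lambda^2[\phi](u_t)\quad\text{for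 every }t>0,$$ and define a right-continuous map. If in addition $u_0\in\mathrm{Dom}(|\partial\phi|)$ the same holds at $t=0$; otherwise all the terms in the last chain of identities are $-\infty$ at $t=0$. Moreover, there exists an at most countable set $\mathcal C\subset(0,+\infty)$ such that the analogous identities for the left limits $$|\dot u_{t-}|:=\lim_{h\downarrow0}\frac{d(u_{t-h},u_t)}h,\qquad\frac{\mathrm d}{\mathrm dt}\phi(u_{t-}):=\lim_{h\downarrow0}\frac{\phi(u_t)-\phi(u_{t-h})}h$$ hold for every $t\in(0,+\infty)\setminus\mathcal C$, while for $t\in\mathcal C$ they hold upon replacing $|\partial\phi|(u_t)$, $|\partial\phi|_\ell(u_t)$ and $\mathfrak L_\lambda[\phi](u_t)$ with $\lim_{h\downarrow0}|\partial\phi|(u_{t-h})$, $\lim_{h\downarrow0}|\partial\phi|_\ell(u_{t-h})$ and $\lim_{h\downarrow0}\mathfrak L_\lambda[\phi](u_{t-h})$, respectively. **Asymptotic behaviour as $t\to+\infty$.** If $\lambda>0$ and $\phi$ has complete sublevels, then $\phi$ admits a unique minimum point $\bar u$ and for every $t>t_0\ge0$: $$\frac\lambda2d^2(u_t,\bar u)\le\phi(u_t)-\phi(\bar u)\le\frac1{2\lambda}|\partial\phi|^2(u_t),$$ $$d(u_t,\bar u)\le d(u_{t_0},\bar u)\,e^{-\lambda(t-t_0)},$$ $$\phi(u_t)-\phi(\bar u)\le\big(\phi(u_{t_0})-\phi(\bar u)\big)e^{-2\lambda(t-t_0)},\qquad\phi(u_t)-\phi(\bar u)\le\frac1{2\mathsf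 E_\lambda(t-t_0)}d^2(u_{t_0},\bar u),$$ $$|\partial\phi|(u_t)\le|\partial\phi|(u_{t_0})\,e^{-\lambda(t-t_0)},\qquad|\partial\phi|(u_t)\le\frac1{\mathsf E_\lambda(t-t_0)}d(u_{t_0},\bar u).$$ If $\lambda=0$ and $\bar u$ is a minimum point of $\phi$ (if any), then $$|\partial\phi|(u_t)\le\frac{d(u_0,\bar u)}t,\qquad\phi(u_t)-\phi(\bar u)\le\frac{d^2(u_0,\bar u)}{2t}\quad\text{for every }t>0,$$ and the map $t\mapsto d(u_t,\bar u)$ is nonincreasing. If in addition (still with $\lambda=0$) $\phi$ has compact sublevels, then $u_t$ converges to a minimum point of $\phi$ as $t\to+\infty$. **Stability.** If $\{u^n\}\subset C^0([0,+\infty);X)$ is a sequence of solutions of $\mathrm{EVI}_\lambda(X,d,\phi)$ such that $\lim_{n\to\infty}u^n_0=u_0$, then, with $\mathcal C:=\{t\in(0,+\infty):\lim_{h\downarrow0}|\partial\phi|(u_{t-h})\ne|\partial\phi|(u_t)\}$ (the jump set of $t\mapsto e^{\lambda t}|\partial\phi|(u_t)$, which is at most countable and for which the identities for the left limits of $u$ stated in this theorem hold), $$\lim_{n\to\infty}u^n_t=u_t\quad\text{for every }t\ge0,$$ $$\lim_{n\to\infty}\phi(u^n_t)=\phi(u_t)\quad\text{for every }t>0,$$ $$\lim_{n\to\infty}|\partial\phi|(u^n_t)=|\partial\phi|(u_t)\quad\text{for every }t\in(0,+\infty)\setminus\mathcal C.$$ Moreover these three limits occur locally uniformly in $[0,+\infty)$,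 $(0,+\infty)$, $(0,+\infty)\setminus\mathcal C$, respectively, and $$|\partial\phi|(u_t)\le\liminf_{n\to\infty}|\partial\phi|(u^n_t)\le\limsup_{n\to\infty}|\partial\phi|(u^n_t)\le\lim_{s\uparrow t}|\partial\phi|(u_s)\quad\text{for every }t\in\mathcal C.$$
   Context: $\mathrm{Dom}(\phi):=\{x\in X:\phi(x)<+\infty\}$. $\frac{\mathrm d}{\mathrm dt}^{+}\zeta(t):=\limsup_{h\downarrow0}\frac{\zeta(t+h)-\zeta(t)}h$. A solution of $\mathrm{EVI}_\lambda(X,d,\phi)$ is a continuous curve $u:t\in(0,+\infty)\mapsto u_t\in\mathrm{Dom}(\phi)$ such that $$\frac12\frac{\mathrm d}{\mathrm dt}^{+}d^2(u_t,v)+\frac\lambda2d^2(u_t,v)\le\phi(v)-\phi(u_t)\quad\text{for every }t\in(0,+\infty),\ v\in\mathrm{Dom}(\phi).$$ A curve in $C^0([0,+\infty);X)$ is a solution if its restriction to $(0,+\infty)$ is a solution in this sense (so $u_0=\lim_{t\downarrow0}u_t\in\overline{\mathrm{Dom}(\phi)}$). $\mathsf E_\lambda(t):=\int_0^te^{\lambda r}\,\mathrm dr$. Moreau-Yosida regularization: $\phi_\tau(x):=\inf_{y\in X}\big(\phi(y)+\frac1{2\tau}d^2(y,x)\big)$, $\tau>0$. Metric slope: $|\partial\phi|(x):=+\infty$ if $x\notin\mathrm{Dom}(\phi)$; $:=0$ if $x\in\mathrm{Dom}(\phi)$ is isolated; $:=\limsup_{y\to x}\frac{(\phi(x)-\phi(y))^+}{d(x,y)}$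 otherwise. $\mathrm{Dom}(|\partial\phi|):=\{x:|\partial\phi|(x)<+\infty\}$. Global $\lambda$-slope: $\mathfrak L_\lambda[\phi](x):=\sup_{y\ne x}\frac{(\phi(x)-\phi(y)+\frac\lambda2d^2(x,y))^+}{d(x,y)}$, $+\infty$ if $x\notin\mathrm{Dom}(\phi)$; $\mathrm{Dom}(\mathfrak L_\lambda[\phi])$ is the set where it is finite. Length distance: a curve $\mathsf x:[0,1]\to X$ is absolutely continuous if there is $m\in L^1(0,1)$ with $d(\mathsf x_s,\mathsf x_t)\le\int_s^tm(r)\,\mathrm dr$ for $s\le t$; its metric derivative $|\dot{\mathsf x}|(t)=\lim_{h\to0}d(\mathsf x_{t+h},\mathsf x_t)/|h|$ exists a.e. and its length is $\int_0^1|\dot{\mathsf x}|(t)\,\mathrm dt$. $d_\ell(x_0,x_1)\in[0,+\infty]$ is the infimum of the lengths of absolutely continuous curves in $X$ connecting $x_0$ to $x_1$ ($+\infty$ if there are none). $|\partial\phi|_\ell$ denotes the metric slope of $\phi$ evaluated with respect to $d_\ell$, i.e. in the extended metric space $(X,d_\ell)$. A functional $\psi$ is linearly bounded from below if there exist $o'\in X$ and $c,\ell\in\mathbb R$ with $\psi(x)+\ell\,d(x,o')\ge c$ for every $x\in X$. ''Complete (compact) sublevels'' means that $\{\phi\le c\}$ is complete (compact) for every $c\in\mathbb R$. *)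

(* Defs.v *)
From HB Require Import structures.
From mathcomp Require Import all_boot all_order all_algebra.
From mathcomp Require Import all_classical all_reals all_analysis.

Set Implicit Arguments.
Unset Strict Implicit.
Unset Printing Implicit Defensive.

Import Order.TTheory GRing.Theory Num.Theory.
Import numFieldNormedType.Exports.

Local Open Scope classical_set_scope.
Local Open Scope ring_scope.

Section real_functions.
Context {R : realType}.

Definition upper_right_dini (zeta : R -> R) (t : R) : \bar R :=
  limf_esup (fun h => ((zeta (t + h) - zeta t) / h)%:E) (0 : R)^'+.

Definition Eint (lambda t : R) : R :=
  \int[lebesgue_measure]_(r in `[0, t]) expR (lambda * r).

(** [f] may take the value +oo on [D]. *)
Definition econvex_on (D : set R) (f : R -> \bar R) : Prop :=
  forall s t th : R, D s -> D t -> 0 <= th <= 1 ->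
    (f ((1 - th) * s + th * t)%R <= (1 - th)%:E * f s + th%:E * f t)%E.

Definition locally_semiconvex_on (D : set R) (f : R -> \bar R) : Prop :=
  forall a b : R, a <= b -> `[a, b] `<=` D ->
    exists k : R, econvex_on `[a, b] (fun t => (f t + (k * t ^+ 2)%:E)%E).

End real_functions.

Section metric_space.
Context {R : realType} {X : metricType R}.
Implicit Types (phi psi : X -> \bar R) (u gamma : R -> X) (x y : X).

Definition domain phi : set X := [set x | (phi x < +oo)%E].

Definition proper_functional phi : Prop :=
  (forall x, (-oo < phi x)%E) /\ (exists x, domain phi x).

Definition is_minimum_point phi x : Prop := forall y, (phi x <= phi y)%E.

Definition sublevel phi (c : R) : set X := [set x | (phi x <= c%:E)%E].

Definition complete_set (A : set X) : Prop :=
  forall a : nat -> X, (forall n, A (a n)) -> cauchy (a @ \oo) ->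
    exists2 x, A x & a @ \oo --> x.

Definition locally_lipschitz_on (D : set R) u : Prop :=
  forall a b : R, a <= b -> `[a, b] `<=` D ->
    exists L : R, forall s t : R, s \in `[a, b] -> t \in `[a, b] ->
      mdist (u s) (u t) <= L * `|s - t|.

Definition linearly_bounded_below psi : Prop :=
  exists (o' : X) (c l : R), forall x,
    (c%:E <= psi x + (l * mdist x o')%:E)%E.

(** Slopes are defined for an extended distance [delta], so as to apply both
    to the distance of [X] and to the length distance. *)
Definition mdiste x y : \bar R := (mdist x y)%:E.

Definition punctured_nbhs (delta : X -> X -> \bar R) x : set_system X :=
  filter_from [set r : R | 0 < r]
    (fun r => [set y | y != x /\ (delta x y < r%:E)%E]).

Lemma punctured_nbhs_mdiste x : punctured_nbhs mdiste x = x^'.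
Proof.
apply/seteqP; split => A /=.
- case=> r /= r0 rA; apply/metricType_numDomainType.nbhs_mdistP.
  exists r => //= y xy /eqP/eqP yx.
  by apply: rA; split => //; rewrite /mdiste lte_fin.
- move=> /metricType_numDomainType.nbhs_mdistP[r /= r0 rA].
  exists r => //= y [yx xy].
  by apply: rA => //=; rewrite /mdiste lte_fin in xy.
Qed.

Definition isolated_point (delta : X -> X -> \bar R) x : Prop :=
  exists2 r : R, 0 < r & forall y, (delta x y < r%:E)%E -> y = x.

Definition slope_wrt (delta : X -> X -> \bar R) phi x : \bar R :=
  if phi x == +oo%E then +oo%E
  else if `[< isolated_point delta x >] then 0%E
  else limf_esup (fun y => maxe (phi x - phi y) 0 / delta x y)%E
         (punctured_nbhs delta x).

Definition slope phi : X -> \bar R := slope_wrt mdiste phi.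

(** The outer [maxe _ 0] only matters when [X] is a single point: the supremum
    of the empty set is then 0 (supremum in [0, +oo]) instead of -oo. *)
Definition global_slope (lambda : R) phi x : \bar R :=
  if phi x == +oo%E then +oo%E
  else maxe (ereal_sup
    [set (maxe (phi x - phi y + (lambda / 2 * mdist x y ^+ 2)%:E) 0
            / (mdist x y)%:E)%E | y in [set y | y != x]]) 0%E.

Definition moreau_yosida phi (tau : R) x : \bar R :=
  ereal_inf (range (fun y =>
    phi y + ((2 * tau)^-1 * mdist y x ^+ 2)%:E)%E).

(** Curves on [0, 1] are total functions on [R] whose values outside of [0, 1]
    are irrelevant. *)
Definition absolutely_continuous_curve gamma : Prop :=
  exists2 m : R -> R,
    lebesgue_measure.-integrable `]0, 1[ (EFin \o m) &
    forall s t : R, 0 <= s -> s <= t -> t <= 1 ->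
      ((mdist (gamma s) (gamma t))%:E <=
        \int[lebesgue_measure]_(r in `]s, t[) (m r)%:E)%E.

Definition metric_derivative gamma (t : R) : \bar R :=
  lim ((mdist (gamma (t + h)) (gamma t) / `|h|)%:E @[h --> 0^']).

Definition curve_length gamma : \bar R :=
  (\int[lebesgue_measure]_(t in `]0%R, 1%R[) metric_derivative gamma t)%E.

Definition length_dist x y : \bar R :=
  ereal_inf (curve_length @` [set gamma |
    [/\ absolutely_continuous_curve gamma, gamma 0 = x & gamma 1 = y]]).

Definition length_slope phi : X -> \bar R := slope_wrt length_dist phi.

(** Curves on (0, +oo) or [0, +oo) are total functions on [R]; their other
    values are irrelevant. *)
Definition EVI_solution (lambda : R) phi u : Prop :=
  [/\ {within `]0, +oo[, continuous u},
      forall t : R, 0 < t -> domain phi (u t) &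
      forall (t : R) v, 0 < t -> domain phi v ->
        ((2^-1)%:E * upper_right_dini (fun s => mdist (u s) v ^+ 2)%R t
          + (lambda / 2 * mdist (u t) v ^+ 2)%:E <= phi v - phi (u t))%E].

Definition EVI_solution_C0 (lambda : R) phi u : Prop :=
  {within `[0, +oo[, continuous u} /\ EVI_solution lambda phi u.

Definition speed_right_quot u (t h : R) : \bar R :=
  (mdist (u (t + h)) (u t) / h)%:E.
Definition speed_left_quot u (t h : R) : \bar R :=
  (mdist (u (t - h)) (u t) / h)%:E.
Definition energy_right_quot phi u (t h : R) : \bar R :=
  ((phi (u (t + h)%R) - phi (u t)) / h%:E)%E.
Definition energy_left_quot phi u (t h : R) : \bar R :=
  ((phi (u t) - phi (u (t - h)%R)) / h%:E)%E.

Definition right_limit0 (f : R -> \bar R) : \bar R := lim (f @ (0 : R)^'+).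

Definition right_speed u (t : R) : \bar R :=
  right_limit0 (speed_right_quot u t).
Definition left_speed u (t : R) : \bar R :=
  right_limit0 (speed_left_quot u t).
Definition right_energy_derivative phi u (t : R) : \bar R :=
  right_limit0 (energy_right_quot phi u t).
Definition left_energy_derivative phi u (t : R) : \bar R :=
  right_limit0 (energy_left_quot phi u t).

Definition right_energy_identity (lambda : R) phi u (t : R) : Prop :=
  [/\ cvg (speed_right_quot u t @ (0 : R)^'+) /\
      right_speed u t \is a fin_num,
      cvg (energy_right_quot phi u t @ (0 : R)^'+) /\
      right_energy_derivative phi u t \is a fin_num &
      [/\ right_energy_derivative phi u t = - (right_speed u t ^+ 2),
          - (right_speed u t ^+ 2) = - (slope phi (u t) ^+ 2),
          - (slope phi (u t) ^+ 2) = - (length_slope phi (u t) ^+ 2) &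
          - (length_slope phi (u t) ^+ 2)
            = - (global_slope lambda phi (u t) ^+ 2)]]%E.

Definition left_energy_identity phi u (t : R) (s sl gl : \bar R) : Prop :=
  [/\ cvg (speed_left_quot u t @ (0 : R)^'+) /\
      left_speed u t \is a fin_num,
      cvg (energy_left_quot phi u t @ (0 : R)^'+) /\
      left_energy_derivative phi u t \is a fin_num &
      [/\ left_energy_derivative phi u t = - (left_speed u t ^+ 2),
          - (left_speed u t ^+ 2) = - (s ^+ 2),
          - (s ^+ 2) = - (sl ^+ 2) &
          - (sl ^+ 2) = - (gl ^+ 2)]]%E.

Definition left_energy_identities (lambda : R) phi u (C : set R) : Prop :=
  (forall t : R, 0 < t -> ~ C t ->
     left_energy_identity phi u t
       (slope phi (u t)) (length_slope phi (u t))
       (global_slope lambda phi (u t))) /\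
  (forall t : R, C t ->
     [/\ cvg (slope phi (u (t - h)) @[h --> (0 : R)^'+]),
         cvg (length_slope phi (u (t - h)) @[h --> (0 : R)^'+]),
         cvg (global_slope lambda phi (u (t - h)) @[h --> (0 : R)^'+]) &
         left_energy_identity phi u t
           (lim (slope phi (u (t - h)) @[h --> (0 : R)^'+]))
           (lim (length_slope phi (u (t - h)) @[h --> (0 : R)^'+]))
           (lim (global_slope lambda phi (u (t - h)) @[h --> (0 : R)^'+]))]).

Definition slope_jump_set phi u : set R :=
  [set t | 0 < t /\
    lim (slope phi (u (t - h)) @[h --> (0 : R)^'+]) <> slope phi (u t)].

End metric_space.

(* Main.v *)
(* Everything rests on the integrated inequality
     e^(lam (t - s)) d^2(u_t, v) - d^2(u_s, v) <= 2 E_lam(t - s) (phi v - phi(u_t)),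
   which follows from the EVI because the energy decreases, and on the fact that a left lower
   semicontinuous function with nonpositive upper right Dini derivative is nonincreasing. Applied
   to two flows it gives the contraction; applied to a flow and its translates, the decay of the
   speed. Testing it with v = u_s bounds the speed by the energy drop, while letting t decrease to s
   bounds the global slope by the speed; as the local slope is at most the global one, speed, local
   slope and global slope coincide at every time, and they lie above the slope of the length
   distance, to which they are equal since the flow, reparametrized by its energy, is an almost
   optimal curve. The energy identity, the one-sided limits of the slope and the a priori estimates
   are then one-dimensional Dini arguments for the energy, the distance and the monotone function
   e^(lam t) |dphi|(u_t). For the stability of the slopes, the lower bound is the lower
   semicontinuity of the global slope, and the upper bound comes from the convergence of energies
   and the monotonicity of the slope. *)

Require Import Defs.
From HB Require Import structures.
From mathcomp Require Import all_boot all_order all_algebra.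
From mathcomp Require Import all_classical all_reals all_analysis.
From mathcomp Require Import measurable_realfun ring lra.

Set Implicit Arguments.
Unset Strict Implicit.
Unset Printing Implicit Defensive.

Import Order.TTheory GRing.Theory Num.Theory.
Import numFieldNormedType.Exports.

Local Open Scope classical_set_scope.
Local Open Scope ring_scope.

(** A priori the energy along a flow may jump, and it may be infinite at time 0, so no derivative of
    it is ever assumed: every differential inequality is a bound on right increments, and
    monotonicity asks only that upward jumps be excluded. The integrated inequality [evi_flow] is
    the working notion of solution because it survives time shifts, holds from time 0 on, and gives
    back the Dini inequality wherever the energy is finite. A second obstacle is that no chain rule
    bounds the energy drop from below by the slope. The bound comes by contradiction: too small a
    drop would make the flow slow, and a slow flow has a small global slope. The global slope is the
    one carried through the estimates, since it is defined by inequalities against all points and is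
    lower semicontinuous. Finally, the length of a curve integrates a limit that takes the value 0
    where it does not exist; comparing length with distance therefore requires the almost everywhere
    existence of the metric derivative, which accounts for the measure theory. *)

Section metric_facts.
Context {R : realType} {X : metricType R}.
Implicit Types (x y v : X) (t : R).

Lemma mdist_lip x y v : `|mdist x v - mdist y v| <= mdist x y.
Proof.
rewrite ler_norml; have := metric_triangle x y v; have := metric_triangle y x v.
by rewrite (metric_sym y x) => ? ?; apply/andP; split; lra.
Qed.

Lemma mdist2_le0 x y : mdist x y ^+ 2 <= 0 -> x = y.
Proof.
move=> H; apply: mdist_positivity; apply/eqP.
by rewrite -sqrf_eq0 eq_le H sqr_ge0.
Qed.

Lemma cvg_at_left t : t^'- --> t.
Proof. exact: cvg_within. Qed.

Lemma cvg_at_right t : t^'+ --> t.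
Proof. exact: cvg_within. Qed.

End metric_facts.

(** * Monotonicity from one-sided Dini bounds *)

Section one_sided.
Context {R : realType}.
Implicit Types (z B : R -> R) (a b c t h e : R).

Lemma near_rightP t (P : R -> Prop) :
  (\forall s \near t^'+, P s) <-> exists2 d, 0 < d & forall s, t < s < t + d -> P s.
Proof.
split.
- rewrite near_withinE => /nbhs_ballP[d /= d0 H]; exists d => // s /andP[ts st].
  apply: H => //; rewrite /ball/= ltr_norml; apply/andP; split; lra.
- move=> [d d0 H]; rewrite near_withinE; apply/nbhs_ballP; exists d => //= s.
  rewrite /ball/= ltr_norml => /andP[h1 h2] ts; apply: H; apply/andP; split => //; lra.
Qed.

Lemma near_leftP t (P : R -> Prop) :
  (\forall s \near t^'-, P s) <-> exists2 d, 0 < d & forall s, t - d < s < t -> P s.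
Proof.
split.
- rewrite near_withinE => /nbhs_ballP[d /= d0 H]; exists d => // s /andP[ts st].
  apply: H => //; rewrite /ball/= ltr_norml; apply/andP; split; lra.
- move=> [d d0 H]; rewrite near_withinE; apply/nbhs_ballP; exists d => //= s.
  rewrite /ball/= ltr_norml => /andP[h1 h2] ts; apply: H; apply/andP; split => //; lra.
Qed.

Lemma near0P (P : R -> Prop) :
  (\forall s \near 0^'+, P s) <-> exists2 d, 0 < d & forall s, 0 < s < d -> P s.
Proof.
by rewrite near_rightP; split => -[d d0 H]; exists d => // s; have := H s; rewrite add0r.
Qed.

(** This says that the upper right Dini derivative of [z] at [t] is at most [c], cleared of
    divisions so that it stays within the reals. *)
Definition dini_le z t c := forall e, 0 < e ->
  \forall h \near 0^'+, z (t + h) - z t <= (c + e) * h.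

(** Together with [right_usc] this forbids exactly the upward jumps of [z], on reaching [t] and on
    leaving it; a nonincreasing function always has the first property. *)
Definition left_lsc z t := forall e, 0 < e -> \forall s \near t^'-, z t <= z s + e.
Definition right_usc z t := forall e, 0 < e -> \forall s \near t^'+, z s <= z t + e.

Lemma cvg_left_lsc z t : z @ t^'- --> z t -> left_lsc z t.
Proof.
move=> /cvgrPdist_le H e e0; apply: filterS (H e e0) => s.
by rewrite ler_norml => /andP[? ?]; lra.
Qed.

Lemma cvg_right_usc z t : z @ t^'+ --> z t -> right_usc z t.
Proof.
move=> /cvgrPdist_le H e e0; apply: filterS (H e e0) => s.
by rewrite ler_norml => /andP[? ?]; lra.
Qed.

Lemma left_lscD z1 z2 t : left_lsc z1 t -> left_lsc z2 t -> left_lsc (z1 \+ z2) t.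
Proof.
move=> h1 h2 e e0; have e2 : 0 < e / 2 by rewrite divr_gt0.
by apply: filterS2 (h1 _ e2) (h2 _ e2) => s /= ? ?; lra.
Qed.

Lemma right_uscD z1 z2 t : right_usc z1 t -> right_usc z2 t -> right_usc (z1 \+ z2) t.
Proof.
move=> h1 h2 e e0; have e2 : 0 < e / 2 by rewrite divr_gt0.
by apply: filterS2 (h1 _ e2) (h2 _ e2) => s /= ? ?; lra.
Qed.

(** The set of times [t] with [z t <= z a + e * (t - a)] contains its supremum by left
    semicontinuity, and a step leads beyond any of its points before [b]. A single step length per
    time suffices, so the negation of the hypothesis controls all steps from some time; this is how
    [flow_lipschitz_time] and [energy_drop_ge] use it. *)
Lemma nonincreasing_of_steps z a b : a <= b ->
  (forall t, a < t <= b -> left_lsc z t) ->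
  (forall t e, a <= t < b -> 0 < e ->
     exists2 h, 0 < h <= b - t & z (t + h) <= z t + e * h) ->
  z b <= z a.
Proof.
move=> ab zl zs; apply/ler_addgt0Pr => e' e'0.
(* The [+ 1] in the denominator keeps the witness meaningful when [a = b]. *)
have [e e0 eb] : exists2 e, 0 < e & e * (b - a) <= e'.
  exists (e' / (b - a + 1)); first by rewrite divr_gt0//; lra.
  by rewrite mulrAC ler_pdivrMr; [rewrite ler_pM2l//|]; lra.
apply: le_trans (_ : z a + e * (b - a) <= _); last lra.
pose S := [set t | a <= t <= b /\ z t <= z a + e * (t - a)].
have Sa : S a by split; [rewrite lexx|rewrite subrr mulr0 addr0].
have Sb : has_ubound S by exists b => t [/andP[]].
pose m := sup S.
have am : a <= m by exact: ub_le_sup.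
have mb : m <= b by apply: ge_sup; [exists a|move=> t [/andP[]]].
have Sm : S m.
  split; first by rewrite am.
  move: am; rewrite le_eqVlt => /predU1P[<-|am]; first by rewrite subrr mulr0 addr0.
  apply/ler_addgt0Pr => e1 e10.
  have /zl/(_ _ e10)/near_leftP[d d0 H] : a < m <= b by rewrite am.
  have [s Ss sm] := @sup_adherent _ S d d0 (conj (ex_intro _ a Sa) Sb).
  have [ms|ms] := leP m s.
    suff -> : m = s by case: Ss => _; lra.
    by apply/eqP; rewrite eq_le ms ub_le_sup.
  have := H s; rewrite ms -/m in sm *; rewrite sm => /(_ isT) zm.
  case: Ss => _ zs1; apply: le_trans zm _.
  have : e * (s - a) <= e * (m - a) by rewrite ler_pM2l//; lra.
  lra.
move: mb; rewrite le_eqVlt => /predU1P[mb|mb]; first by case: Sm => _; rewrite mb.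
have amb : a <= m < b by rewrite am.
have [h /andP[h0 hb] zh] := zs m e amb e0.
have : S (m + h).
  split; first by apply/andP; split; lra.
  by case: Sm => _ zm; lra.
by move=> /(ub_le_sup Sb); rewrite -/m; lra.
Qed.

Lemma dini_le_step z t b e : t < b -> 0 < e -> dini_le z t 0 ->
  exists2 h, 0 < h <= b - t & z (t + h) <= z t + e * h.
Proof.
move=> tb e0 /(_ _ e0)/near0P[d d0 H].
exists (Num.min (d / 2) (b - t)).
  by rewrite lt_min ge_min lexx orbT subr_gt0 tb divr_gt0.
have := H (Num.min (d / 2) (b - t)).
by rewrite lt_min subr_gt0 tb divr_gt0//= gt_min => /(_ _)/wrap[|]; lra.
Qed.

(** The left endpoint carries no Dini bound: the comparison starts at some [s > a], and [right_usc]
    pays for the gap. This matters at time 0, where a flow may have infinite energy. *)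
Lemma dini_le_nonincreasing z a b : a <= b ->
  (forall t, a < t <= b -> left_lsc z t) -> right_usc z a ->
  (forall t, a < t < b -> dini_le z t 0) -> z b <= z a.
Proof.
rewrite le_eqVlt => /predU1P[->//|ab] zl zr zd.
apply/ler_addgt0Pr => e e0.
have /near_rightP[d d0 H] := zr e e0.
pose s := Num.min (a + d / 2) b.
have as_ : a < s by rewrite lt_min ab andbT; lra.
have sb : s <= b by rewrite ge_min lexx orbT.
apply: (@le_trans _ _ (z s)); last first.
  have [sab|sb'] := eqVneq s b; last first.
    apply: H; rewrite as_/= gt_min; apply/orP; left; lra.
  apply: H; rewrite as_/= gt_min; apply/orP; left; lra.
apply: nonincreasing_of_steps => //.
- by move=> t /andP[st tb]; apply: zl; rewrite (lt_trans as_ st).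
- move=> t e1 /andP[st tb] e10; apply: dini_le_step => //.
  by apply: zd; rewrite tb (lt_le_trans as_ st).
Qed.

Lemma dini_leW z t c c' : c <= c' -> dini_le z t c -> dini_le z t c'.
Proof.
move=> cc' H e e0; have /near0P[d d0 K] := H e e0; apply/near0P; exists d => // h hd.
by apply: le_trans (K _ hd) _; rewrite ler_pM2r ?lerD2r//; case/andP: hd.
Qed.

Lemma dini_leD z1 z2 t c1 c2 : dini_le z1 t c1 -> dini_le z2 t c2 ->
  dini_le (z1 \+ z2) t (c1 + c2).
Proof.
move=> h1 h2 e e0; have e2 : 0 < e / 2 by rewrite divr_gt0.
apply: filterS2 (h1 _ e2) (h2 _ e2) => s /= k1 k2.
have -> : (c1 + c2 + e) * s = (c1 + e / 2) * s + (c2 + e / 2) * s by field.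
lra.
Qed.

Lemma is_derive_near B t b : is_derive t 1 B b -> forall e, 0 < e ->
  \forall h \near 0^'+, `|B (t + h) - B t - b * h| <= e * h.
Proof.
move=> [dB Bb] e e0.
have := dB; rewrite /derivable => /cvg_ex[l Hl].
have lb : l = b by rewrite -Bb /derive; apply/esym/cvg_lim.
rewrite {}lb in Hl; move/cvgrPdist_le : Hl => /(_ e e0).
rewrite near_withinE => /nbhs_ballP[d /= d0 H]; apply/near0P; exists d => // h /andP[h0 hd].
have := H h; rewrite /ball/= sub0r normrN gtr0_norm// => /(_ hd); rewrite gt_eqF// => /(_ isT).
rewrite /shift/= -[X in `|_ - X|]/(h^-1 * (B (h * 1 + t) - B t)) mulr1 (addrC h t) => K.
rewrite (_ : _ - _ = - (b - h^-1 * (B (t + h) - B t)) * h); last by field; rewrite gt_eqF.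
by rewrite normrM normrN (gtr0_norm h0) ler_pM2r.
Qed.

Lemma is_derive_dini_le B t b : is_derive t 1 B b -> dini_le B t b.
Proof.
move=> Bb e e0; apply: filterS (is_derive_near Bb e0) => h.
by rewrite ler_norml => /andP[_]; lra.
Qed.

(** The increment of the product is split as [B (t + h) * (z (t + h) - z t) + (B (t + h) - B t) * z
    t], which involves [z] only through its increment and its value at [t]; positivity of [B]
    preserves the one-sided bound on the increment. *)
Lemma dini_leM B z t b c : is_derive t 1 B b -> 0 < B t -> dini_le z t c ->
  dini_le (B \* z) t (B t * c + b * z t).
Proof.
move=> Bb B0 zc e e0.
(* The slack [e] is divided in three: a quarter for the Dini bound of [z], a quarter for the
   variation of [B] in front of it, and half for the derivative of [B]. *)
pose e1 := e / (4 * B t).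
have e10 : 0 < e1 by rewrite divr_gt0// mulr_gt0.
pose k := e / (4 * (`|c| + e1 + 1)).
have k0 : 0 < k by rewrite divr_gt0// mulr_gt0// ltr_pwDr// addr_ge0// ltW.
have kk : (`|c| + e1) * k <= e / 4.
  have : (`|c| + e1 + 1) * k = e / 4.
    by rewrite /k; field; rewrite gt_eqF// ltr_pwDr// addr_ge0// ltW.
  lra.
pose e2 := e / (2 * (`|z t| + 1)).
have e20 : 0 < e2 by rewrite divr_gt0// mulr_gt0// ltr_pwDr.
have e2z : e2 * `|z t| <= e / 2.
  have : e2 * (`|z t| + 1) = e / 2 by rewrite /e2; field; rewrite gt_eqF// ltr_pwDr.
  lra.
have B1 : {for t, continuous B}.
  by apply: differentiable_continuous; apply/derivable1_diffP; case: Bb.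
have kB : 0 < Num.min k (B t) by rewrite lt_min k0.
have B2 : \forall h \near 0^'+, `|B t - B (t + h)| < Num.min k (B t).
  move/cvgrPdist_lt : B1 => /(_ _ kB)/nbhs_ballP[d /= d0 H].
  apply/near0P; exists d => // h /andP[h0 hd]; apply: H.
  by rewrite /ball/= opprD addNKr normrN gtr0_norm.
apply: filterS3 (is_derive_near Bb e20) (zc _ e10) (filterI B2 (nbhs_right_gt 0)) => h.
move=> H1 H2 [/=]; rewrite lt_min => /andP[H3 H4] h0.
have Bh : 0 < B (t + h) by move: H4; rewrite ltr_norml => /andP[? ?]; lra.
have -> : B (t + h) * z (t + h) - B t * z t =
  B (t + h) * (z (t + h) - z t) + (B (t + h) - B t) * z t by ring.
have K1 : B (t + h) * (z (t + h) - z t) <= B (t + h) * ((c + e1) * h).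
  by rewrite ler_pM2l.
have K2 : (c + e1) * (B (t + h) - B t) <= e / 4.
  apply: le_trans (ler_norm _) _; rewrite normrM (le_trans _ kk)// ler_pM//.
    by rewrite (le_trans (ler_normD _ _))// (gtr0_norm e10).
  by rewrite distrC ltW.
have K3 : (B (t + h) - B t) * z t <= b * z t * h + e / 2 * h.
  have -> : (B (t + h) - B t) * z t = (B (t + h) - B t - b * h) * z t + b * z t * h by ring.
  rewrite addrC lerD2l; apply: le_trans (ler_norm _) _; rewrite normrM.
  apply: (@le_trans _ _ (e2 * h * `|z t|)); first by rewrite ler_wpM2r.
  by rewrite mulrAC ler_pM2r.
have K4 : B t * e1 = e / 4 by rewrite /e1; field; rewrite gt_eqF.
have K5 : B (t + h) * (c + e1) <= B t * c + e / 2.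
  have -> : B (t + h) * (c + e1) = B t * c + B t * e1 + (c + e1) * (B (t + h) - B t) by ring.
  lra.
have : B (t + h) * (c + e1) * h <= (B t * c + e / 2) * h by rewrite ler_pM2r.
by rewrite !mulrDl; rewrite !mulrDl in K1 K3; lra.
Qed.

Lemma dini_leZ k z t c : 0 <= k -> dini_le z t c -> dini_le (fun s => k * z s) t (k * c).
Proof.
rewrite le_eqVlt => /predU1P[<-|k0] zc.
  move=> e e0; apply: filterS (nbhs_right_gt 0) => h h0.
  by rewrite !mul0r subrr add0r mulr_ge0// ltW.
have := dini_leM (is_derive_cst k t (1 : R)) k0 zc.
by rewrite /cst mul0r addr0.
Qed.

End one_sided.

Section derive_semicontinuity.
Context {R : realType}.
Implicit Types (B : R -> R) (t b k : R).

Lemma is_derive_continuous B t b : is_derive t (1 : R) B b -> B @ t --> B t.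
Proof.
by move=> H; apply: differentiable_continuous; apply/derivable1_diffP; case: H.
Qed.

Lemma is_derive_left_lsc B t b : is_derive t (1 : R) B b -> left_lsc B t.
Proof. by move=> /is_derive_continuous H; apply/cvg_left_lsc/cvg_at_left_filter. Qed.

Lemma is_derive_right_usc B t b : is_derive t (1 : R) B b -> right_usc B t.
Proof. by move=> /is_derive_continuous H; apply/cvg_right_usc/cvg_at_right_filter. Qed.

Lemma is_derive_sqrZ k t : is_derive t (1 : R) (fun x => k * x ^+ 2) (k * (2 * t)).
Proof.
have H := is_deriveZ k (is_deriveX 2 (is_derive_id t (1 : R))).
by apply: is_derive_eq; rewrite /GRing.scale/= expr1 mulr1.
Qed.

Lemma is_derive_linear k t : is_derive t (1 : R) (fun x => k * x) k.
Proof.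
have H := is_deriveZ k (is_derive_id t (1 : R)).
by apply: is_derive_eq; rewrite /GRing.scale/= mulr1.
Qed.

End derive_semicontinuity.

Section dini_on.
Context {R : realType}.
Implicit Types (z B : R -> R) (a b c t : R).

(** The hypotheses of [dini_le_nonincreasing] with the pointwise bound [d] kept visible: these
    records add up, so a differential inequality is proved term by term and only the sign of the
    total bound is left to check. *)
Record dini_on z a b (d : R -> R) : Prop := {
  do_left : forall t, a < t <= b -> left_lsc z t ;
  do_right : right_usc z a ;
  do_dini : forall t, a < t < b -> dini_le z t (d t) }.

Lemma dini_on_nonincreasing z a b d : a <= b -> dini_on z a b d ->
  (forall t, a < t < b -> d t <= 0) -> z b <= z a.
Proof.
move=> ab [zl zr zd] d0; apply: dini_le_nonincreasing => // t tab.
exact: dini_leW (d0 t tab) (zd t tab).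
Qed.

Lemma dini_onD z1 z2 a b d1 d2 : dini_on z1 a b d1 -> dini_on z2 a b d2 ->
  dini_on (fun t => z1 t + z2 t) a b (fun t => d1 t + d2 t).
Proof.
move=> [l1 r1 h1] [l2 r2 h2]; split.
- by move=> t tab; apply: left_lscD; [exact: l1|exact: l2].
- exact: right_uscD.
- by move=> t tab; apply: dini_leD; [exact: h1|exact: h2].
Qed.

Lemma is_derive_dini_on B a b (d : R -> R) : a <= b ->
  (forall t, a <= t <= b -> is_derive t (1 : R) B (d t)) -> dini_on B a b d.
Proof.
move=> ab H; split.
- by move=> t /andP[at_ tb]; apply: is_derive_left_lsc (H t _); rewrite (ltW at_).
- by apply: is_derive_right_usc (H a _); rewrite lexx.
- by move=> t /andP[at_ tb]; apply: is_derive_dini_le; apply: H; rewrite !ltW.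
Qed.

Lemma dini_on_cvg z a b d :
  (forall t, a < t <= b -> z @ t^'- --> z t) -> z @ a^'+ --> z a ->
  (forall t, a < t < b -> dini_le z t (d t)) -> dini_on z a b d.
Proof.
move=> zl zr zd; split => //; last exact: cvg_right_usc.
by move=> t tab; apply: cvg_left_lsc; exact: zl.
Qed.

Lemma dini_on_cvgM B z a b (dB d : R -> R) : a <= b ->
  (forall t, a <= t <= b -> is_derive t (1 : R) B (dB t)) ->
  (forall t, a < t < b -> 0 < B t) ->
  (forall t, a < t <= b -> z @ t^'- --> z t) -> z @ a^'+ --> z a ->
  (forall t, a < t < b -> dini_le z t (d t)) ->
  dini_on (fun t => B t * z t) a b (fun t => B t * d t + dB t * z t).
Proof.
move=> ab HB B0 zl zr zd; apply: dini_on_cvg.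
- move=> t /andP[at_ tb]; apply: cvgM; last by apply: zl; rewrite at_.
  apply: cvg_at_left_filter; apply: is_derive_continuous (HB t _); by rewrite (ltW at_).
- apply: cvgM => //; apply: cvg_at_right_filter.
  by apply: is_derive_continuous (HB a _); rewrite lexx.
- move=> t tab; have tab' : a <= t <= b by case/andP: tab => /ltW -> /ltW.
  by have := dini_leM (HB t tab') (B0 t tab) (zd t tab).
Qed.

End dini_on.

(** * Exponential weights *)

Section efun.
Context {R : realType}.
Implicit Types (l s t : R).

(* Closed form of [Eint], also used for negative times (see [EintE]). *)
Definition Efun l t := if l == 0 then t else (expR (l * t) - 1) / l.

Lemma Efun0 l : Efun l 0 = 0.
Proof. by rewrite /Efun; case: eqP => //; rewrite mulr0 expR0 subrr mul0r. Qed.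

Lemma mulEfun l t : l * Efun l t = expR (l * t) - 1.
Proof.
rewrite /Efun; case: eqP => [->|/eqP l0]; first by rewrite !mul0r expR0 subrr.
by field.
Qed.

Lemma is_derive_expRl l t : is_derive t (1 : R) (fun x => expR (l * x)) (l * expR (l * t)).
Proof.
rewrite mulrC; apply: is_derive1_comp.
have := is_deriveZ l (is_derive_id t (1 : R)).
by rewrite /GRing.scale/= mulr1.
Qed.

Lemma is_derive_Efun l t : is_derive t (1 : R) (Efun l) (expR (l * t)).
Proof.
have [->|l0] := eqVneq l 0.
  rewrite mul0r expR0 (_ : Efun 0 = id); first exact: is_derive_id.
  by apply/funext => x; rewrite /Efun eqxx.
rewrite (_ : Efun l = fun x => (expR (l * x) - 1) * l^-1); last first.
  by apply/funext => x; rewrite /Efun (negbTE l0).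
have H := is_derive_expRl l t.
apply: is_derive_eq; rewrite /= /GRing.scale/=; field => //.
Qed.
End efun.

Section efun_theory.
Context {R : realType}.
Implicit Types (l s t : R).

Lemma EfunD l s t : Efun l (s + t) = Efun l s + expR (l * s) * Efun l t.
Proof.
rewrite /Efun; case: eqP => [->|/eqP l0]; first by rewrite mul0r expR0 mul1r.
by rewrite mulrDr expRD; field.
Qed.

Lemma Efun_gt0 l t : 0 < t -> 0 < Efun l t.
Proof.
move=> t0; rewrite /Efun; case: ifPn => // l0.
have [ln|lp|/eqP] := ltgtP l 0; last by rewrite (negbTE l0).
- by rewrite nmulr_lgt0 ?invr_lt0// subr_lt0 expR_lt1 nmulr_rlt0.
- by rewrite divr_gt0// subr_gt0 expR_gt1 mulr_gt0.
Qed.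

Lemma Efun_ge0 l t : 0 <= t -> 0 <= Efun l t.
Proof. by rewrite le_eqVlt => /predU1P[<-|/(Efun_gt0 l)/ltW//]; rewrite Efun0. Qed.

Lemma continuous_Efun l : continuous (Efun l).
Proof.
move=> t; apply: differentiable_continuous; apply/derivable1_diffP.
by case: (is_derive_Efun l t).
Qed.

Lemma continuous_expRl l : continuous (fun t : R => expR (l * t)).
Proof.
move=> t; apply: differentiable_continuous; apply/derivable1_diffP.
by case: (is_derive_expRl l t).
Qed.

Lemma expRlN l t : expR (l * t) * expR (- l * t) = 1.
Proof. by rewrite -expRD mulNr subrr expR0. Qed.

Lemma EfunN l t : Efun (- l) t = expR (- l * t) * Efun l t.
Proof.
rewrite /Efun oppr_eq0; case: eqP => [->|/eqP l0]; first by rewrite oppr0 mul0r expR0 mul1r.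
by rewrite mulrA mulrBr (mulrC (expR (- l * t))) expRlN mulr1 invrN mulrN -mulNr opprB.
Qed.
End efun_theory.

Section efun_bounds.
Context {R : realType}.
Implicit Types (l h : R).

Lemma Efun_ub l h : 0 <= h -> Efun l h <= expR (`|l| * h) * h.
Proof.
move=> h0; rewrite /Efun; case: eqP => [->|/eqP l0].
  by rewrite normr0 mul0r expR0 mul1r.
have [ln|lp|/eqP] := ltgtP l 0; last by rewrite (negbTE l0).
- rewrite ltr0_norm// ler_ndivrMr//.
  have e1 : 1 <= expR (- l * h) by rewrite leNgt expR_lt1 -leNgt mulr_ge0// oppr_ge0 ltW.
  have e2 := expR_ge1Dx (l * h).
  have : l * h * (expR (- l * h) - 1) <= 0.
    by rewrite mulr_le0_ge0 ?subr_ge0// nmulr_rle0.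
  lra.
- rewrite gtr0_norm// ler_pdivrMr//.
  have e1 := expR_ge1Dx (- l * h).
  have e2 : expR (l * h) * (1 + - l * h) <= 1.
    by rewrite -[leRHS](expRlN l h) ler_pM2l ?expR_gt0.
  lra.
Qed.

Lemma expR_abs_ub l h : 0 <= h -> expR (l * h) <= expR (`|l| * h).
Proof. by move=> h0; rewrite ler_expR ler_wpM2r// ler_norm. Qed.

Lemma expR_abs_lb l h : 0 <= h -> expR (- (`|l| * h)) <= expR (l * h).
Proof.
move=> h0; rewrite ler_expR -mulNr ler_wpM2r// lerNl.
by have := ler_norm (- l); rewrite normrN.
Qed.

Lemma is_derive_EfunZ (k : R) l t :
  is_derive t (1 : R) (fun x => k * Efun l x) (k * expR (l * t)).
Proof. exact: (is_deriveZ k (is_derive_Efun l t)). Qed.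

Lemma cvg_expRl0 l : expR (l * x) @[x --> (0 : R)^'+] --> (1 : R).
Proof.
rewrite -[X in _ --> X]expR0 -[X in _ --> expR X](mulr0 l).
by apply: cvg_at_right_filter; exact: continuous_expRl.
Qed.

Lemma near_expR_lt l (c : R) : 1 < c -> exists2 d : R, 0 < d & expR (l * d) < c.
Proof.
move=> c1.
have /cvgrPdist_lt/(_ (c - 1)) := cvg_expRl0 l.
rewrite subr_gt0 => /(_ c1)/near0P[d d0 H]; exists (d / 2); first by rewrite divr_gt0.
have := H (d / 2); rewrite ltr_norml => /(_ _)/wrap[|/andP[] ? ?]; lra.
Qed.

Lemma sqr_le_of_le (a b : R) : 0 <= a -> a ^+ 2 <= b ^+ 2 -> 0 <= b -> a <= b.
Proof. by move=> a0 ab b0; rewrite -(@ler_pXn2r _ 2)// nnegrE. Qed.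

Lemma exists_lt2 (d d' : R) : 0 < d -> 0 < d' -> exists2 h, 0 < h < d & 0 < h < d'.
Proof.
move=> d0 d'0; have m0 : 0 < Num.min d d' by rewrite lt_min d0.
have m1 : Num.min d d' <= d by rewrite ge_min lexx.
have m2 : Num.min d d' <= d' by rewrite ge_min lexx orbT.
by exists (Num.min d d' / 2); apply/andP; split; lra.
Qed.

End efun_bounds.

(** * Limits superior and convergence in the extended reals *)

Section limf.
Context {R : realType} {T : choiceType} {X : filteredType T}.
Implicit Types (f : X -> \bar R) (F : set_system X).

Lemma limf_esup_lt f F a : (limf_esup f F < a)%E ->
  exists2 V, F V & forall x, V x -> (f x < a)%E.
Proof.
move=> /ereal_inf_lt[_ [V FV <-] Va]; exists V => // x Vx.
by apply: le_lt_trans Va; apply: ereal_sup_ubound; exists x.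
Qed.

Lemma limf_esup_le f F V a : F V -> (forall x, V x -> (f x <= a)%E) ->
  (limf_esup f F <= a)%E.
Proof.
move=> FV H; apply: (@le_trans _ _ (ereal_sup [set f x | x in V])).
  by apply: ereal_inf_lbound; exists V.
by apply: ge_ereal_sup => _ [x Vx <-]; exact: H.
Qed.

Lemma limf_esup_ge f F a : (forall V, F V -> exists2 x, V x & (a <= f x)%E) ->
  (a <= limf_esup f F)%E.
Proof.
move=> H; apply: le_ereal_inf_tmp => _ [V FV <-]; have [x Vx ax] := H V FV.
by apply: le_trans ax _; apply: ereal_sup_ubound; exists x.
Qed.
End limf.

Section ereal_cvg.
Context {R : realType}.

Lemma cvge_of_bounds T (F : set_system T) (FF : Filter F) (f : T -> \bar R) (l : \bar R) :
  (forall c : R, (c%:E < l)%E -> \forall x \near F, (c%:E < f x)%E) ->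
  (forall c : R, (l < c%:E)%E -> \forall x \near F, (f x < c%:E)%E) ->
  f @ F --> l.
Proof.
case: l => [r| |] lo up.
- have near_r e : 0 < e -> \forall x \near F, ((r - e)%:E < f x)%E /\ (f x < (r + e)%:E)%E.
    move=> e0; apply: filterS2 (lo (r - e) _) (up (r + e) _) => //; rewrite lte_fin; lra.
  apply/fine_cvgP; split.
    apply: filterS (near_r 1 ltr01) => x [h1 h2].
    by rewrite fin_numElt (lt_trans _ h1) ?ltNyr// (lt_trans h2) ?ltry.
  apply/cvgrPdist_le => e e0; apply: filterS (near_r e e0) => x [] /=.
  case: (f x) => [s| |]//=; rewrite !lte_fin => h1 h2.
  by rewrite ler_norml; apply/andP; split; lra.
- by apply/cvgeyPgt => A; apply: lo; rewrite ltry.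
- by apply/cvgeNyPlt => A; apply: up; rewrite ltNyr.
Qed.

End ereal_cvg.

(** * Convexity of extended-valued functions *)

Section convexity.
Context {R : realType}.
Implicit Types (s m t th : R) (f : R -> \bar R) (D : set R).

(** If an endpoint has value [+oo], so has the right-hand side; between finite endpoints,
    multiplication by [t - s] turns convexity into a real inequality. This reduction absorbs the
    possibly infinite energy at time 0. *)
Lemma econvex_on_three_points D f : (forall t, (-oo < f t)%E) ->
  (forall s m t, D s -> D t -> s < m < t -> (f s < +oo)%E -> (f t < +oo)%E ->
    (f m < +oo)%E /\
    (t - s) * fine (f m) <= (t - m) * fine (f s) + (m - s) * fine (f t)) ->
  econvex_on D f.
Proof.
move=> fNy H.
(* The case of exchanged endpoints follows with [1 - th] in place of [th], and the degenerate
   weights are treated apart. *)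
have lt_case s t th : D s -> D t -> s < t -> 0 < th < 1 ->
    (f ((1 - th) * s + th * t)%R <= (1 - th)%:E * f s + th%:E * f t)%E.
  move=> Ds Dt st /andP[th0 th1].
  have nNy (k : R) x : 0 < k -> (k%:E * f x != -oo)%E.
    move=> k0; have := fNy x; case: (f x) => [r| |]// _.
    by rewrite gt0_muley ?lte_fin.
  have th1' : 0 < 1 - th by rewrite subr_gt0.
  case: (ltP (f s) +oo%E) => [fs|]; last first.
    by rewrite leye_eq => /eqP ->; rewrite gt0_muley ?lte_fin// addye ?leey// nNy.
  case: (ltP (f t) +oo%E) => [ft|]; last first.
    by rewrite leye_eq => /eqP ->; rewrite (@gt0_muley _ th%:E) ?lte_fin// addey ?leey// nNy.
  set m := (1 - th) * s + th * t.
  have smE : m - s = th * (t - s) by rewrite /m; ring.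
  have mtE : t - m = (1 - th) * (t - s) by rewrite /m; ring.
  have ts : 0 < t - s by rewrite subr_gt0.
  have sm : s < m by rewrite -subr_gt0 smE mulr_gt0.
  have mt : m < t by rewrite -subr_gt0 mtE mulr_gt0.
  have [|fm] := H s m t Ds Dt _ fs ft; first by rewrite sm.
  rewrite smE mtE -(fineK (x := f s)) ?fin_real ?fNy// -(fineK (x := f t)) ?fin_real ?fNy//.
  rewrite -(fineK (x := f m)) ?fin_real ?fNy// => K.
  rewrite -!EFinM -EFinD lee_fin -(ler_pM2l ts).
  by move: K; rewrite /=; lra.
move=> s t th Ds Dt /andP[]; rewrite le_eqVlt => /predU1P[<- _|th0].
  by rewrite subr0 !mul1r mul0r addr0 mul1e mul0e adde0.
rewrite le_eqVlt => /predU1P[->|th1].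
  by rewrite subrr !mul1r mul0r add0r mul1e mul0e add0e.
have [st|ts|->] := ltgtP s t.
- by apply: lt_case => //; rewrite th0.
- have := lt_case t s (1 - th) Dt Ds ts; rewrite subr_gt0 th1/= ltrBlDr ltrDl th0 => /(_ isT).
  by rewrite opprB addrCA subrr addr0 addeC addrC.
- rewrite -mulrDl subrK mul1r.
  have := fNy t; case: (f t) => [r| |]// _.
    by rewrite -!EFinM -EFinD -mulrDl subrK mul1r.
  by rewrite !gt0_muley ?lte_fin// subr_gt0.
Qed.

End convexity.

(** * Locally uniform convergence and limits of sequences *)

Section uniform_limits.
Context {R : realType}.

(** A bound valid jointly for times near [t] and large indices extends to a compact set by covering;
    the stability estimates below are stated jointly in both variables for this purpose. *)
Lemma family_compactly_cvg {Y : pseudoMetricType R} (A : set R) (f : nat -> R -> Y) (g : R -> Y) :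
  (forall t, A t -> forall e : R, 0 < e -> \forall s \near t & n \near \oo, A s -> ball (g s) e (f n s)) ->
  {family @compactly_in R A, f @ \oo --> g}.
Proof.
move=> H; apply/fam_cvgP => B [BA Bc] P /uniform_nbhs[E [entE EP]].
move: entE; rewrite -entourage_ballE => -[e /= e0 eE].
have := (@compact_near_coveringP _ B).1 Bc nat \oo
  (fun n s => A s -> ball (g s) e (f n s)) _ (fun t Bt => H t (BA t Bt) e e0).
move=> /(_ ltac:(typeclasses eauto)); apply: filterS => n Hn; apply: EP => s Bs; apply: eE.
by apply: Hn => //; exact: BA.
Qed.

Lemma limn_esup_le_of_near (f : nat -> \bar R) (l : \bar R) :
  (forall c : R, (l < c%:E)%E -> \forall n \near \oo, (f n < c%:E)%E) ->
  (limn_esup f <= l)%E.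
Proof.
move=> H; rewrite leNgt; apply/negP => ll.
have [c lc cl] : exists2 c : R, (l < c%:E)%E & (c%:E < limn_esup f)%E.
  move: ll; case: l H => [r| |] H; case: (limn_esup f) => [q| |]//=.
  - by rewrite lte_fin => rq; exists ((r + q) / 2); rewrite lte_fin; lra.
  - by move=> _; exists (r + 1); rewrite ?ltry// lte_fin ltrDl.
  - by move=> _; exists (q - 1); rewrite ?ltNyr// lte_fin ltrBlDr ltrDl.
  - by move=> _; exists 0; rewrite ?ltry ?ltNyr.
move: cl; apply/negP; rewrite -leNgt.
by apply: (@limf_esup_le _ _ _ _ _ [set n | (f n < c%:E)%E]); [exact: H|move=> n /ltW].
Qed.

Lemma limn_einf_ge_of_near (f : nat -> \bar R) (l : \bar R) :
  (forall c : R, (c%:E < l)%E -> \forall n \near \oo, (c%:E < f n)%E) ->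
  (l <= limn_einf f)%E.
Proof.
move=> H; rewrite -leeN2 /limn_einf -limf_esupN; apply: limn_esup_le_of_near => c.
rewrite lteNl -EFinN => /H; apply: filterS => n.
by rewrite [in X in _ -> X]lteNl -EFinN.
Qed.

End uniform_limits.

(** * Primitives and the closed form of [Eint] *)

Section integrals.
Context {R : realType}.
Implicit Types (h F : R -> R) (a b c t : R).
Local Notation mu := (@lebesgue_measure R).

Lemma continuous_integrable h a b : continuous h -> mu.-integrable `[a, b] (EFin \o h).
Proof.
move=> hc; apply: continuous_compact_integrable; first exact: segment_compact.
exact: continuous_subspaceT.
Qed.

Lemma exists_primitive h : continuous h ->
  exists W : R -> R, W 0 = 0 /\ forall t, 0 <= t -> is_derive t (1 : R) W (h t).
Proof.
(* Integrating from -1 makes 0 an interior point, so that the derivative at 0 is two-sided. *)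
move=> hc; pose F (x : R) := (\int[mu]_(t in [set` `[(- 1)%R, x]]) h t)%R.
exists (fun t => F t - F 0); split; first by rewrite subrr.
move=> t t0.
have [||dF F'] := @continuous_FTC1_closed R h (- 1) t (t + 1) _ (continuous_integrable _ _ hc) _ (hc t); [lra|lra|].
have H : is_derive t (1 : R) F (h t).
  by rewrite derive1E in F'; exact: (DeriveDef dF F').
have := is_deriveB H (is_derive_cst (F 0) t (1 : R)).
by rewrite subr0.
Qed.

Lemma FTC2_is_derive F h t : 0 <= t ->
  (forall s : R, 0 <= s -> {for s, continuous h}) ->
  (forall s : R, 0 <= s -> is_derive s (1 : R) F (h s)) ->
  (\int[mu]_(x in `[0%R, t]) (h x)%:E = (F t - F 0)%:E)%E.
Proof.
rewrite le_eqVlt => /predU1P[<-|t0] hc dF.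
  by rewrite subrr set_itv1 integral_set1.
rewrite (@continuous_FTC2 _ h F)//.
- by apply: continuous_in_subspaceT => s; rewrite inE/= in_itv/= => /andP[s0 _]; exact: hc.
- split.
  + by move=> x; rewrite in_itv/= => /andP[x0 xt]; have [] := dF x (ltW x0).
  + by apply: cvg_at_right_filter; exact: is_derive_continuous (dF 0 (lexx _)).
  + by apply: cvg_at_left_filter; exact: is_derive_continuous (dF t (ltW t0)).
- move=> x; rewrite in_itv/= => /andP[x0 xt].
  by rewrite derive1E; have H := dF x (ltW x0); rewrite derive_val.
Qed.

Lemma EintE l t : 0 <= t -> Eint l t = Efun l t.
Proof.
move=> t0; rewrite /Eint /Rintegral.
have H (s : R) : 0 <= s -> {for s, continuous (fun r : R => expR (l * r))}.
  by move=> _; exact: continuous_expRl.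
by rewrite (FTC2_is_derive t0 H (fun s _ => is_derive_Efun l s)) Efun0 subr0.
Qed.

End integrals.

(** * Absolutely continuous curves and the length distance *)

Section primitives.
Context {R : realType}.
Local Notation mu := (@lebesgue_measure R).
Implicit Types (m g : R -> R) (s t : R).

Definition primitive m t : R := \int[mu]_(r in `]-oo, t]) m r.

Lemma integrableT_sub m (A : set R) : mu.-integrable setT (EFin \o m) -> measurable A ->
  mu.-integrable A (EFin \o m).
Proof. by move=> mi mA; apply: integrableS mi => //; exact: measurableT. Qed.

Lemma primitiveB m s t : mu.-integrable setT (EFin \o m) -> s <= t ->
  primitive m t - primitive m s = \int[mu]_(r in `]s, t]) m r.
Proof.
move=> mi st; rewrite /primitive Rintegral_itvB//.
exact: integrableT_sub.
Qed.

Lemma primitive_le m s t : (forall x, 0 <= m x) -> mu.-integrable setT (EFin \o m) ->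
  s <= t -> primitive m s <= primitive m t.
Proof.
by move=> m0 mi st; rewrite -subr_ge0 primitiveB// Rintegral_ge0.
Qed.

Lemma continuous_primitive m : mu.-integrable setT (EFin \o m) -> continuous (primitive m).
Proof.
move=> mi x.
have x1 : x - 1 <= x + 1 by lra.
have x1' : x - 1 < x + 1 by lra.
have := parameterized_integral_continuous x1 (integrableT_sub mi (measurable_itv _)).
have xin : x \in `]x - 1, x + 1[ by rewrite in_itv/=; apply/andP; split; lra.
move=> /(within_continuous_continuous x1')/(_ xin) C.
have E : \forall y \near x, primitive m (x - 1) +
    parameterized_integral mu (x - 1) y m = primitive m y.
  apply/nbhs_ballP; exists 1 => //= y; rewrite /ball/= ltr_norml => /andP[h1 h2].
  have h3 : x - 1 <= y by lra.
  rewrite -[RHS](subrKC (primitive m (x - 1))) primitiveB// /parameterized_integral.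
  rewrite Rintegral_itv_obnd_cbnd//; exact: integrableT_sub.
rewrite /continuous_at -(nbhs_singleton E).
by apply: (cvg_trans (near_eq_cvg E)); apply: cvgD; [exact: cvg_cst|exact: C].
Qed.

Lemma lebesgue_stieltjes_itv (F : cumulative R R) s t : s <= t ->
  lebesgue_stieltjes_measure F `]s, t]%classic = (F t - F s)%:E.
Proof.
move=> st; rewrite /lebesgue_stieltjes_measure/= /measure_extension/=.
by rewrite measurable_mu_extE//= ?wlength_itv_bnd//; exact: is_ocitv.
Qed.

(* Both F1 and F2 are Stieltjes functions whose measures are dominated by the one with density
   [m]: Radon-Nikodym gives the density of F1. *)
Lemma cumulative_density m (F1 F2 : R -> R) : (forall x, 0 <= m x) ->
  mu.-integrable setT (EFin \o m) ->
  nondecreasing F1 -> nondecreasing F2 -> continuous F1 -> continuous F2 ->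
  (forall t, F1 t + F2 t = primitive m t) ->
  exists w : R -> R, mu.-integrable setT (EFin \o w) /\
    forall s t, s <= t -> F1 t - F1 s = \int[mu]_(r in `]s, t]) w r.
Proof.
move=> m0 mi nd1 nd2 c1 c2 F12.
pose G1 : cumulative R R := HB.pack F1 (isCumulative.Build R _ _ F1 nd1 (right_continuousW c1)).
pose G2 : cumulative R R := HB.pack F2 (isCumulative.Build R _ _ F2 nd2 (right_continuousW c2)).
have ndM : nondecreasing (primitive m) by move=> s t; exact: primitive_le.
pose GM : cumulative R R := HB.pack (primitive m) (isCumulative.Build R _ _ _ ndM
   (right_continuousW (continuous_primitive mi))).
pose nu1 := lebesgue_stieltjes_measure G1.
pose nu2 := lebesgue_stieltjes_measure G2.
have mf := measurable_int _ mi.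
pose nu0 (A : set (measurableTypeR R)) := (\int[mu]_(x in A) (m x)%:E)%E.
have nu0_0 : nu0 set0 = 0%E by rewrite /nu0 integral_set0.
have nu0_ge0 A : (0 <= nu0 A)%E by apply: integral_ge0 => x _; rewrite lee_fin.
have nu0_sa : semi_sigma_additive nu0.
  by apply: semi_sigma_additive_nng_induced => // x; rewrite lee_fin.
pose nu : {measure set (measurableTypeR R) -> \bar R} :=
  HB.pack nu0 (isMeasure.Build _ _ _ nu0 nu0_0 nu0_ge0 nu0_sa).
(* Half-open intervals determine these measures, so it is enough to compare them there. *)
have E1 A : measurable A -> lebesgue_stieltjes_measure GM A = nu A.
  apply: lebesgue_stieltjes_measure_unique => _ [[a b] _ <-] /=.
  have [ab|ba] := leP a b; last first.
    by rewrite !set_itv_ge ?measure0//= -leNgt bnd_simp// ltW.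
  rewrite lebesgue_stieltjes_itv//= primitiveB// /nu0 /Rintegral fineK//.
  apply: integrable_fin_num => //; exact: integrableT_sub.
have E2 A : measurable A -> lebesgue_stieltjes_measure GM A = (nu1 A + nu2 A)%E.
  move=> mA; rewrite -measure_addE; move: A mA.
  apply: lebesgue_stieltjes_measure_unique => _ [[a b] _ <-] /=.
  have [ab|ba] := leP a b; last first.
    by rewrite !set_itv_ge ?measure0//= -leNgt bnd_simp// ltW.
  rewrite -[RHS]/(measure_add nu1 nu2 `]a, b]%classic) measure_addE /nu1 /nu2.
  have K1 := lebesgue_stieltjes_itv G1 ab; have K2 := lebesgue_stieltjes_itv G2 ab.
  transitivity ((F1 b - F1 a)%:E + (F2 b - F2 a)%:E)%E; last first.
    by congr (_ + _)%E; apply/esym; [exact: K1|exact: K2].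
  rewrite lebesgue_stieltjes_itv// -EFinD /=; congr EFin; rewrite -!F12; ring.
have le1 A : measurable A -> (nu1 A <= nu A)%E.
  by move=> mA; rewrite -E1// E2// leeDl.
have fin1 : fin_num_fun nu1.
  move=> A mA; rewrite ge0_fin_numE//; apply: le_lt_trans (le1 A mA) _.
  rewrite /= /nu0 ltey_eq integrable_fin_num//; exact: integrableT_sub.
pose n1 : {finite_measure set (measurableTypeR R) -> \bar R} :=
  HB.pack nu1 (Measure_isFinite.Build _ _ _ nu1 fin1).
have dom : n1 `<< mu.
  apply/null_content_dominatesP => A mA muA; apply/eqP; rewrite eq_le measure_ge0 andbT.
  apply: le_trans (le1 A mA) _; rewrite /= /nu0 null_set_integral//.
  by move=> _ B mB; apply: measurableI => //; have := mf measurableT B mB; rewrite setTI.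
have [w [w0 wfin wi nuw]] := radon_nikodym_sigma_finite dom.
have wE : EFin \o (fine \o w) = w by apply/funext => x /=; rewrite fineK.
have wi' : mu.-integrable setT (EFin \o (fine \o w)) by rewrite wE.
exists (fine \o w); split => //.
move=> s t st; apply: EFin_inj; rewrite -(lebesgue_stieltjes_itv G1)//.
rewrite -[LHS]/(n1 `]s, t]%classic) nuw// /Rintegral fineK.
  by apply: eq_integral => x _; rewrite /= fineK.
by apply: integrable_fin_num => //; exact: integrableT_sub wi' _.
Qed.

Lemma ae_impl (P Q : R -> Prop) : (forall x, P x -> Q x) ->
  {ae mu, forall x, P x} -> {ae mu, forall x, Q x}.
Proof. by move=> PQ; apply: filterS; first exact: (ae_filter_ringOfSetsType mu). Qed.

Lemma ae_and (P Q : R -> Prop) :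
  {ae mu, forall x, P x} -> {ae mu, forall x, Q x} -> {ae mu, forall x, P x /\ Q x}.
Proof. exact: (@filterI _ _ (ae_filter_ringOfSetsType mu)). Qed.

Lemma primitive_derivable m : mu.-integrable setT (EFin \o m) ->
  {ae mu, forall x, is_derive x (1 : R) (primitive m) (m x)}.
Proof.
move=> mi; have li : locally_integrable setT m.
  by apply: open_integrable_locally => //; exact: openT.
have H : {ae mu, forall x, derivable (primitive m) x 1 /\ (primitive m)^`()%classic x = m x}.
  exact: (@FTC1Ny R m (fun y => integrableT_sub mi (measurable_itv _)) li).
by apply: ae_impl H => x [dx <-]; rewrite derive1E; exact: derivableP.
Qed.

(** The half sum and half difference of [primitive m] and [g] are nondecreasing, continuous and add
    up to [primitive m]. The density [w] of the half sum given by [cumulative_density] makes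
    [2 w - m] the density of [g], and Lebesgue differentiation gives the derivative. *)
Lemma ac_density m g : (forall x, 0 <= m x) -> mu.-integrable setT (EFin \o m) ->
  (forall s t, s <= t -> `|g t - g s| <= primitive m t - primitive m s) ->
  exists w : R -> R, [/\ mu.-integrable setT (EFin \o w),
    forall s t, s <= t -> g t - g s = \int[mu]_(r in `]s, t]) w r &
    {ae mu, forall x, is_derive x (1 : R) g (w x)}].
Proof.
move=> m0 mi gm.
have cM := continuous_primitive mi.
have cg : continuous g.
  move=> x; apply/cvgrPdist_le => e e0.
  have /cvgrPdist_le/(_ e e0) := cM x; apply: filterS => y H; apply: le_trans H.
  have [xy|/ltW yx] := leP x y.
    by rewrite distrC (distrC (primitive m x)) (le_trans (gm _ _ xy))// ler_norm.
  by rewrite (le_trans (gm _ _ yx))// ler_norm.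
pose F1 t := 2^-1 * (primitive m t + g t).
pose F2 t := 2^-1 * (primitive m t - g t).
have nd1 : nondecreasing F1.
  move=> s t st; have := gm s t st; rewrite ler_norml => /andP[? ?]; rewrite /F1; lra.
have nd2 : nondecreasing F2.
  move=> s t st; have := gm s t st; rewrite ler_norml => /andP[? ?]; rewrite /F2; lra.
have c1 : continuous F1.
  by move=> x; apply: cvgM; [exact: cvg_cst|apply: cvgD; [exact: cM|exact: cg]].
have c2 : continuous F2.
  by move=> x; apply: cvgM; [exact: cvg_cst|apply: cvgB; [exact: cM|exact: cg]].
have [|w [wi wF]] := cumulative_density m0 mi nd1 nd2 c1 c2.
  by move=> t; rewrite /F1 /F2; lra.
have gE t : g t = 2 * F1 t - primitive m t by rewrite /F1; lra.
exists (fun r => 2 * w r - m r).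
have w2i : mu.-integrable setT (EFin \o (fun r => 2 * w r)).
  have := integrableZl measurableT 2 wi.
  by apply: eq_integrable => // x _ /=; rewrite EFinM.
split.
- have := integrableB measurableT w2i mi.
  by apply: eq_integrable => // x _ /=; rewrite EFinB.
- move=> s t st; rewrite !gE RintegralB//; [|exact: integrableT_sub..].
  rewrite RintegralZl//; last exact: integrableT_sub.
  by rewrite -wF// -primitiveB//; ring.
- have A1 := primitive_derivable wi; have A2 := primitive_derivable mi.
  apply: ae_impl (ae_and A1 A2) => x [d1 d2].
  have FE : g = (fun t => (2 * primitive w t - primitive m t) + (2 * F1 0 - 2 * primitive w 0)).
    apply/funext => t; rewrite gE.
    have [t0|/ltW t0] := leP 0 t; have := wF _ _ t0; rewrite -primitiveB//; lra.
  rewrite FE.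
  have K := is_deriveD (is_deriveB (is_deriveZ 2 d1) d2) (is_derive_cst (2 * F1 0 - 2 * primitive w 0) x (1 : R)).
  by apply: is_derive_eq; rewrite addr0.
Qed.

End primitives.

Section metric_length.
Context {R : realType} {X : metricType R}.
Local Notation mu := (@lebesgue_measure R).
Implicit Types (s t : R) (gamma : R -> X).

(* No measurability is needed: both sides are suprema of integrals of simple functions. *)
Lemma ge0_le_integral_nomeas (D : set R) (f g : R -> \bar R) :
  (forall t, D t -> (0 <= f t)%E) -> (forall t, D t -> (f t <= g t)%E) ->
  (\int[mu]_(x in D) f x <= \int[mu]_(x in D) g x)%E.
Proof.
move=> f0 fg; have g0 t : D t -> (0 <= g t)%E by move=> Dt; exact: le_trans (f0 t Dt) (fg t Dt).
rewrite !ge0_integralE//; apply: ereal_sup_le => _ [h hf <-].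
exists h => // x; apply: le_trans (hf x) _.
by rewrite !patchE; case: ifPn => // /set_mem; exact: fg.
Qed.

Lemma metric_derivative_ge0 gamma t : (0 <= metric_derivative gamma t)%E.
Proof.
rewrite /metric_derivative.
set q := fun h => _.
(* Where the quotients do not converge, [lim] takes the default value 0. *)
have [cq|ncq] := pselect (cvg (q h @[h --> (0 : R)^'])); last first.
  by rewrite dvgP.
apply: lime_ge => //; apply: nearW => h; rewrite lee_fin.
by rewrite divr_ge0// mdist_ge0.
Qed.

Lemma metric_derivative_le gamma t (L : R) : 0 <= L ->
  (\forall h \near (0 : R)^', mdist (gamma (t + h)) (gamma t) <= L * `|h|) ->
  (metric_derivative gamma t <= L%:E)%E.
Proof.
move=> L0 H; rewrite /metric_derivative.
set q := fun h => _.
have [cq|ncq] := pselect (cvg (q h @[h --> (0 : R)^'])); last first.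
  by rewrite dvgP.
apply: lime_le => //; apply: filterS2 H (nbhs_dnbhs_neq (0 : R)) => h Hh h0.
by rewrite lee_fin ler_pdivrMr// normr_gt0.
Qed.

Lemma lipschitz_absolutely_continuous gamma (L : R) : 0 <= L ->
  (forall s t, 0 <= s -> s <= t -> t <= 1 -> mdist (gamma s) (gamma t) <= L * (t - s)) ->
  absolutely_continuous_curve gamma.
Proof.
move=> L0 HL; exists (cst L).
  apply: (@integrableS _ _ _ mu `[0, 1]%classic) => //.
    by move=> r /=; rewrite !in_itv/= => /andP[/ltW -> /ltW ->].
  apply: continuous_compact_integrable; first exact: segment_compact.
  by apply: continuous_subspaceT => r; exact: cvg_cst.
move=> s t s0 st t1.
rewrite -[leRHS]/(\int[mu]_(r in `]s, t[) cst L%:E r)%E integral_cst//= lebesgue_measure_itv/= lte_fin.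
case: ltP => st'; rewrite -?EFinB -EFinM lee_fin; first exact: HL.
have -> : s = t by apply/eqP; rewrite eq_le st st'.
by rewrite mdistxx mulr0.
Qed.

(** The metric derivative is at most [L] at every interior time, whether it is a true limit or the
    default 0. *)
Lemma lipschitz_length_dist gamma (x y : X) (L : R) : 0 <= L ->
  (forall s t, 0 <= s -> s <= t -> t <= 1 -> mdist (gamma s) (gamma t) <= L * (t - s)) ->
  gamma 0 = x -> gamma 1 = y -> (length_dist x y <= L%:E)%E.
Proof.
move=> L0 HL g0 g1.
apply: (@le_trans _ _ (curve_length gamma)).
  apply: ereal_inf_lbound; exists gamma => //; split => //.
  exact: lipschitz_absolutely_continuous HL.
rewrite /curve_length.
apply: (@le_trans _ _ (\int[mu]_(t in `]0%R, 1%R[) (cst L%:E t))%E).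
  apply: ge0_le_integral_nomeas => t; first by move=> _; exact: metric_derivative_ge0.
  rewrite /= in_itv/= => /andP[t0 t1]; apply: metric_derivative_le => //.
  have m0 : 0 < Num.min t (1 - t) by rewrite lt_min t0 subr_gt0.
  apply: filterS (dnbhs0_lt m0) => h; rewrite lt_min => /andP[h1 h2].
  have := ler_norm h; have := ler_norm (- h); rewrite normrN => h3 h4.
  have [h0|h0] := leP 0 h.
    rewrite metric_sym; apply: le_trans (HL _ _ _ _ _) _; [lra|lra|lra|].
    by rewrite ler_wpM2l//; lra.
  apply: le_trans (HL _ _ _ _ _) _; [lra|lra|lra|].
  by rewrite ler_wpM2l//; lra.
rewrite integral_cst// /= lebesgue_measure_itv/= lte_fin ltr01 -EFinB subr0 mule1.
exact: lexx.
Qed.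

(** The given density is replaced by its absolute value and extended by 0 outside the unit interval,
    so that [primitive] applies on the whole line. *)
Lemma ac_curve_majorant gamma : absolutely_continuous_curve gamma ->
  exists m : R -> R, [/\ forall r, 0 <= m r, mu.-integrable setT (EFin \o m) &
    forall s t, 0 <= s -> s <= t -> t <= 1 ->
      mdist (gamma s) (gamma t) <= primitive m t - primitive m s].
Proof.
move=> [m0 m0i m0d].
pose m r := if r \in `]0, 1[%classic then `|m0 r| else 0.
have mi : mu.-integrable setT (EFin \o m).
  have H : mu.-integrable setT ((abse \o (EFin \o m0)) \_ `]0, 1[%classic).
    have := (@integrable_mkcond _ _ R mu `]0, 1[%classic (abse \o (EFin \o m0)) _).1.
    by apply => //; exact: integrable_abse.
  apply: eq_integrable H => // r _ /=; rewrite /m patchE /=.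
  by case: ifP.
exists m; split => //.
  by move=> r; rewrite /m; case: ifP.
move=> s t s0 st t1; rewrite primitiveB// -lee_fin.
have sub : (`]s, t[%classic : set R) `<=` `]0%R, 1%R[%classic.
  by move=> r /=; rewrite !in_itv/= => /andP[r1 r2]; apply/andP; split; lra.
apply: le_trans (m0d s t s0 st t1) _.
rewrite /Rintegral fineK; last first.
  by apply: integrable_fin_num => //; exact: integrableT_sub.
rewrite -integral_itv_bndo_bndc; last first.
  by have /(measurable_int mu) := integrableT_sub mi (measurable_itv `]s, t[).
apply: le_trans (lee_abs _) _.
apply: le_trans (le_abse_integral _ _ _) _ => //.
  have : mu.-integrable `]s, t[%classic (EFin \o m0) by exact: integrableS m0i.
  by move=> /(measurable_int mu).
rewrite le_eqVlt; apply/orP; left; apply/eqP; apply: eq_integral => r rst.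
by rewrite /m /= mem_set//; apply: sub; rewrite inE in rst.
Qed.

Lemma is_derive_quot_cvg (g : R -> R) (t w : R) : is_derive t (1 : R) g w ->
  (g (t + h) - g t) / h @[h --> (0 : R)^'] --> w.
Proof.
move=> [dg gw].
have : h^-1 *: ((g \o shift t) (h *: (1 : R)) - g t) @[h --> (0 : R)^'] --> w.
  by rewrite -gw; exact: dg.
apply: cvg_trans; apply: near_eq_cvg; apply: nearW => h.
by rewrite /= /GRing.scale/= mulr1 mulrC (addrC h).
Qed.

(** This is the theorem on the metric derivative. For the distances to the points of the curve at
    rational times, let [nn] be the supremum of the absolute values of their derivatives. The
    distance between two points of the curve is at most the integral of [nn], which bounds the
    quotients from above; each single distance function bounds them from below. Hence the metric
    derivative exists almost everywhere and equals [nn]. *)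
Lemma le_mdist_length gamma : absolutely_continuous_curve gamma ->
  ((mdist (gamma 0%R) (gamma 1%R))%:E <= curve_length gamma)%E.
Proof.
move=> /ac_curve_majorant[m [m0 mi mg]].
(* The curve is prolonged by constants, so that the estimates on the whole line apply to it. *)
pose clamp t : R := Num.max 0 (Num.min t 1).
have cl0 t : 0 <= clamp t by rewrite le_max lexx.
have cl1 t : clamp t <= 1 by rewrite ge_max ler01 ge_min lexx orbT.
have clmono s t : s <= t -> clamp s <= clamp t.
  move=> st; rewrite /clamp ge_max !le_max lexx/=; apply/orP; right.
  by rewrite le_min !ge_min st lexx orbT.
have clid t : 0 <= t -> t <= 1 -> clamp t = t.
  by move=> t0 t1; rewrite /clamp min_l// max_r.
pose g t := gamma (clamp t).
have M_le s t : s <= t -> primitive m s <= primitive m t by exact: primitive_le.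
have clM s t : s <= t -> primitive m (clamp t) - primitive m (clamp s) <= primitive m t - primitive m s.
  move=> st; have h1 := M_le s t st.
  have [s1|s1] := leP 1 s.
    by rewrite /clamp !min_r// ?(le_trans s1)// subrr subr_ge0.
  have [t0|t0] := leP t 0.
    have s0 : s <= 0 by exact: le_trans t0.
    rewrite /clamp !min_l ?(le_trans t0)// ?(le_trans s0)// !max_l// subrr subr_ge0//.
  rewrite lerB//.
    by apply: M_le; rewrite /clamp ge_max ge_min lexx (ltW t0).
  by apply: M_le; rewrite /clamp le_max le_min lexx (ltW s1) orbT.
have gM s t : s <= t -> mdist (g s) (g t) <= primitive m t - primitive m s.
  by move=> st; apply: le_trans (mg _ _ (cl0 s) (clmono _ _ st) (cl1 t)) (clM _ _ st).
(* An enumeration of the rationals; codes of no rational are sent to 0. *)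
pose q (n : nat) : R := ratr (odflt 0 (unpickle n) : rat).
pose gq n t := mdist (g t) (g (q n)).
have gqM n s t : s <= t -> `|gq n t - gq n s| <= primitive m t - primitive m s.
  move=> st; apply: le_trans (gM s t st).
  rewrite metric_sym; exact: mdist_lip.
have /choice[w Hw] : forall n, exists w : R -> R, [/\ mu.-integrable setT (EFin \o w),
    forall s t, s <= t -> gq n t - gq n s = \int[mu]_(r in `]s, t]) w r &
    {ae mu, forall x, is_derive x (1 : R) (gq n) (w x)}].
  by move=> n; exact: (ac_density m0 mi (gqM n)).
have aew : {ae mu, forall x, (forall n, is_derive x (1 : R) (gq n) (w n x)) /\
    is_derive x (1 : R) (primitive m) (m x)}.
  apply: ae_and; last exact: primitive_derivable.
  by apply: ae_foralln => n; case: (Hw n).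
have wm x : (forall n, is_derive x (1 : R) (gq n) (w n x)) ->
    is_derive x (1 : R) (primitive m) (m x) -> forall n, `|w n x| <= m x.
  move=> dw dm n.
  have H1 : `|(gq n (x + h) - gq n x) / h| @[h --> (0 : R)^'] --> `|w n x|.
    by apply: cvg_norm; exact: is_derive_quot_cvg (dw n).
  have H2 := is_derive_quot_cvg dm.
  apply: ler_cvg_to H1 H2 _.
  apply: filterS (nbhs_dnbhs_neq (0 : R)) => h h0 /=.
  have [hp|hn] := ltP 0 h.
    rewrite normrM normfV (gtr0_norm hp) ler_pM2r ?invr_gt0//.
    by apply: gqM; rewrite lerDl ltW.
  have {}hn : h < 0 by rewrite lt_neqAle h0.
  rewrite normrM normfV (ltr0_norm hn) -[leRHS]mulrNN -invrN ler_pM2r ?invr_gt0 ?oppr_gt0//.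
  by rewrite distrC opprB; apply: gqM; rewrite gerDl ltW.
(* The bound of [w n] by [m] holds almost everywhere; capping makes the supremum finite
   everywhere. *)
pose a n x := Num.min `|w n x| (m x).
have a0 n x : 0 <= a n x by rewrite le_min normr_ge0 m0.
have aub x : has_ubound (range (a ^~ x)).
  by exists (m x) => _ [n _ <-]; rewrite ge_min lexx orbT.
pose nn x := sups (a ^~ x) 0.
have a_le n x : a n x <= nn x by apply: ub_le_sup; [apply: has_ubound_sdrop|exists n].
have nn_le x : nn x <= m x.
  apply: ge_sup; first by exists (a 0%N x); exists 0%N.
  by move=> _ [n _ <-]; rewrite ge_min lexx orbT.
have nn0 x : 0 <= nn x by apply: le_trans (a_le 0%N x).
have mm : measurable_fun setT m by apply/measurable_EFinP; exact: (measurable_int mu).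
have mnn : measurable_fun setT nn.
  apply: measurable_fun_sups => // n; apply: measurable_minr => //.
  apply: measurableT_comp => //; apply/measurable_EFinP.
  by case: (Hw n) => /(measurable_int mu).
have nni : mu.-integrable setT (EFin \o nn).
  apply: le_integrable mi => //; first exact/measurable_EFinP.
  by move=> x _; rewrite /= lee_fin !ger0_norm.
have gq_nn n s t : s <= t -> `|gq n t - gq n s| <= primitive nn t - primitive nn s.
  move=> st; have [wi wE _] := Hw n; rewrite wE// primitiveB//.
  apply: le_trans (le_normr_Rintegral _ _) _ => //; first exact: integrableT_sub.
  rewrite -lee_fin /Rintegral !fineK; last 2 first.
  - by apply: integrable_fin_num => //; exact: integrableT_sub.
  - apply: integrable_fin_num => //; have := integrable_abse (integrableT_sub wi (measurable_itv `]s, t])).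
    by apply: eq_integrable.
  apply: ae_ge0_le_integral => //.
  - apply: measurable_funTS; apply/measurable_EFinP; apply: measurableT_comp => //.
    by apply/measurable_EFinP; exact: (measurable_int mu).
  - by move=> x _; rewrite lee_fin.
  - by apply: measurable_funTS; exact/measurable_EFinP.
  - apply: ae_impl aew => x [dw dm] _; rewrite lee_fin.
    by apply: le_trans (a_le n x); rewrite le_min lexx wm.
have cM := continuous_primitive mi.
(* The distance to [g s] is replaced by the distance to [g] at a rational time just after [s], where
   density estimates hold; continuity of [primitive m] controls the error. *)
have g_nn s t : s <= t -> mdist (g s) (g t) <= primitive nn t - primitive nn s.
  move=> st; apply/ler_addgt0Pr => e e0.
  have e2 : 0 < e / 2 by rewrite divr_gt0.
  have /cvgrPdist_lt/(_ _ e2)/nbhs_ballP[d /= d0 H] := cM s.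
  have [r] := rat_in_itvoo (ltac:(by rewrite ltrDl) : s < s + d).
  rewrite in_itv/= => /andP[r1 r2].
  have qr : q (pickle r) = ratr r by rewrite /q pickleK.
  have D1 : gq (pickle r) s <= e / 2.
    rewrite /gq qr; apply: le_trans (gM _ _ (ltW r1)) _.
    have := H (ratr r); rewrite /ball/= => /(_ _)/wrap[|].
      by rewrite ltr_norml; apply/andP; split; lra.
    by rewrite distrC => /ltW/(le_trans (ler_norm _)).
  have D2 := gq_nn (pickle r) s t st.
  have := ler_norm (gq (pickle r) t - gq (pickle r) s).
  have := metric_triangle (g s) (g (q (pickle r))) (g t).
  rewrite (metric_sym (g (q _)) (g t)) -/(gq _ _) -/(gq _ _); lra.
have md : {ae mu, forall x, x \in `]0, 1[ -> metric_derivative gamma x = (nn x)%:E}.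
  apply: ae_impl (ae_and aew (primitive_derivable nni)) => x [[dw dm] dn].
  rewrite in_itv/= => /andP[x0 x1].
  apply/cvg_lim => //; apply/cvg_EFin; first exact: nearW.
  have gh : \forall h \near (0 : R)^', gamma (x + h) = g (x + h).
    have m1 : 0 < Num.min x (1 - x) by rewrite lt_min x0 subr_gt0.
    apply: filterS (dnbhs0_lt m1) => h; rewrite lt_min => /andP[h1 h2].
    have := ler_norm h; have := ler_norm (- h); rewrite normrN => h3 h4.
    by rewrite /g clid//; lra.
  have gx : gamma x = g x by rewrite /g clid// ltW.
  have up : \forall h \near (0 : R)^',
     mdist (gamma (x + h)) (gamma x) / `|h| <= (primitive nn (x + h) - primitive nn x) / h.
    apply: filterS2 gh (nbhs_dnbhs_neq (0 : R)) => h -> h0; rewrite gx.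
    have [hp|hn] := ltP 0 h.
      rewrite (gtr0_norm hp) ler_pM2r ?invr_gt0// metric_sym.
      by apply: g_nn; rewrite lerDl ltW.
    have {}hn : h < 0 by rewrite lt_neqAle h0.
    rewrite (ltr0_norm hn) -[leRHS]mulrNN -invrN ler_pM2r ?invr_gt0 ?oppr_gt0//.
    by rewrite opprB; apply: g_nn; rewrite gerDl ltW.
  have lo n : \forall h \near (0 : R)^',
     `|(gq n (x + h) - gq n x) / h| <= mdist (gamma (x + h)) (gamma x) / `|h|.
    apply: filterS2 gh (nbhs_dnbhs_neq (0 : R)) => h -> h0; rewrite gx.
    rewrite normrM normfV ler_pM2r ?invr_gt0 ?normr_gt0//.
    exact: mdist_lip.
  have /cvgrPdist_lt U := is_derive_quot_cvg dn.
  apply/cvgrPdist_lt => e e0.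
  have e2 : 0 < e / 2 by rewrite divr_gt0.
  have hs : has_sup (sdrop (a ^~ x) 0).
    by split; [exists (a 0%N x); exists 0%N|exact: has_ubound_sdrop].
  have [_ [n _ <-] an] := sup_adherent e2 hs.
  have {}an : nn x - e / 2 < a n x by exact: an.
  have /cvgrPdist_lt L : `|(gq n (x + h) - gq n x) / h| @[h --> (0 : R)^'] --> `|w n x|.
    by apply: cvg_norm; exact: is_derive_quot_cvg (dw n).
  have UL : \forall h \near (0 : R)^', `|(gq n (x + h) - gq n x) / h| <=
      mdist (gamma (x + h)) (gamma x) / `|h| <= (primitive nn (x + h) - primitive nn x) / h.
    by apply: filterS2 up (lo n) => h h1 h2; rewrite h2.
  apply: filterS3 UL (U e e0) (L _ e2) => h /andP[h1 h2].
  have : a n x <= `|w n x| by rewrite ge_min lexx.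
  rewrite !ltr_norml /=; move: an h1 h2; move: (nn x) (a n x) `|w n x| (_ / `|h|) (_ / h) `|_ / h|.
  move=> v1 v2 v3 v4 v5 v6 h0 h1 h2 h3 /andP[h4 h5] /andP[h6 h7].
  by apply/andP; split; lra.
have g0 : g 0 = gamma 0 by rewrite /g clid.
have g1 : g 1 = gamma 1 by rewrite /g clid.
rewrite -g0 -g1 /curve_length.
have [N [mN N0 Nsub]] := md.
apply: (@le_trans _ _ (\int[mu]_(t in `]0%R, 1%R[) (nn t)%:E)%E).
  rewrite integral_itv_bndo_bndc; last by apply: measurable_funTS; exact/measurable_EFinP.
  rewrite -[leRHS]fineK; last by apply: integrable_fin_num => //; exact: integrableT_sub.
  by rewrite lee_fin -/(Rintegral _ _ _) -primitiveB// g_nn.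
(* Cutting off the null set [N] makes the comparison with the metric derivative hold at every point:
   off [N] the two agree, and on [N] the integrand is 0. *)
apply: (@le_trans _ _ (\int[mu]_(t in `]0%R, 1%R[) (nn t * \1_(~` N) t)%:E)%E).
  rewrite le_eqVlt; apply/orP; left; apply/eqP; apply: ae_eq_integral => //.
  - by apply: measurable_funTS; exact/measurable_EFinP.
  - apply: measurable_funTS; apply/measurable_EFinP; apply: measurable_funM => //.
    by apply: measurable_indic; exact: measurableC.
  - exists N; split => // x /= /not_implyP[xI H]; apply: contrapT => xN; apply: H.
    by rewrite indicE mem_set// mulr1.
apply: ge0_le_integral_nomeas => x /= xI.
  by rewrite lee_fin mulr_ge0.
rewrite indicE; case: (boolP (x \in ~` N)) => [/set_mem xN|_] /=; last first.
  by rewrite mulr0 metric_derivative_ge0.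
rewrite mulr1; suff -> : metric_derivative gamma x = (nn x)%:E by [].
by apply: contrapT => H; apply: xN; apply: Nsub => /= K; apply: H; exact: K.
Qed.

Lemma le_mdist_length_dist (x y : X) : ((mdist x y)%:E <= length_dist x y)%E.
Proof.
apply: le_ereal_inf_tmp => _ [gamma [gac <- <-] <-]; exact: le_mdist_length.
Qed.

End metric_length.

(** * EVI flows *)

Section flows.
Context {R : realType} {X : metricType R} (phi : X -> \bar R) (lam : R).
Hypothesis phi_gtNy : forall x, (-oo < phi x)%E.
Hypothesis phi_lsc : lower_semicontinuous phi.
Implicit Types (u : R -> X) (v x y : X) (a b c d s t h e g m : R).
Implicit Types (delta : X -> X -> \bar R).

Local Notation fr x := (fine (phi x)).
Local Notation gs := (global_slope lam phi).
Local Notation mu := (@lebesgue_measure R).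

(** Off the domain [fr] is 0 instead of infinite; hence the domain hypotheses that accompany the
    real inequalities. *)
Lemma domK x : domain phi x -> phi x = (fr x)%:E.
Proof. by move=> dx; rewrite fineK// fin_real// phi_gtNy. Qed.

Definition curve0_continuous u := forall t, 0 <= t -> forall e, 0 < e ->
  exists2 d, 0 < d & forall s, 0 <= s -> `|s - t| < d -> mdist (u s) (u t) < e.

Lemma curve0_cvg u v t (F : set_system R) {FF : Filter F} : curve0_continuous u ->
  0 <= t -> F --> t -> F [set s | 0 <= s] ->
  mdist (u s) v @[s --> F] --> mdist (u t) v.
Proof.
move=> uc t0 Ft F0; apply/cvgrPdist_lt => e e0.
have [d d0 H] := uc t t0 e e0.
have Fd : F [set s | `|s - t| < d].
  by apply: Ft; apply/nbhs_ballP; exists d => //= s; rewrite /ball/= distrC.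
apply: filterS2 F0 Fd => s /= s0 sd.
by apply: le_lt_trans (mdist_lip _ _ _) _; rewrite metric_sym; exact: H.
Qed.

Lemma curve0_weighted_left u v l t : curve0_continuous u -> 0 < t ->
  left_lsc (fun s => expR (l * s) * mdist (u s) v ^+ 2) t.
Proof.
move=> uc t0; apply: cvg_left_lsc.
apply: cvgM.
  by apply: cvg_at_left_filter; exact: continuous_expRl.
rewrite expr2; under eq_fun do rewrite expr2.
have H : mdist (u s) v @[s --> t^'-] --> mdist (u t) v.
  apply: curve0_cvg => //; first exact: ltW.
    exact: cvg_at_left.
  by apply: filterS (nbhs_left_gt t0) => s /ltW.
exact: cvgM.
Qed.

Lemma curve0_weighted_right u v l t : curve0_continuous u -> 0 <= t ->
  right_usc (fun s => expR (l * s) * mdist (u s) v ^+ 2) t.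
Proof.
move=> uc t0; apply: cvg_right_usc.
apply: cvgM.
  by apply: cvg_at_right_filter; exact: continuous_expRl.
rewrite expr2; under eq_fun do rewrite expr2.
have H : mdist (u s) v @[s --> t^'+] --> mdist (u t) v.
  apply: curve0_cvg => //; first exact: cvg_at_right.
  by apply: filterS (nbhs_right_gt t) => s /(le_lt_trans t0)/ltW.
exact: cvgM.
Qed.

Record dini_flow u : Prop := {
  df_cont : curve0_continuous u ;
  df_dom : forall t, 0 < t -> domain phi (u t) ;
  df_dini : forall t v, 0 < t -> domain phi v ->
    dini_le (fun s => mdist (u s) v ^+ 2) t
      (2 * (fr v - fr (u t)) - lam * mdist (u t) v ^+ 2) }.

(** The exponential weight absorbs the quadratic term of the EVI. *)
Lemma dini_flow_weighted u t v : dini_flow u -> 0 < t -> domain phi v ->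
  dini_le (fun s => expR (lam * s) * mdist (u s) v ^+ 2) t
    (2 * expR (lam * t) * (fr v - fr (u t))).
Proof.
move=> uf t0 dv.
have := dini_leM (is_derive_expRl lam t) (expR_gt0 _) (df_dini uf t0 dv).
by apply: dini_leW; rewrite le_eqVlt; apply/orP; left; apply/eqP; ring.
Qed.

Lemma lsc_fine x a : domain phi x -> a < fr x ->
  exists2 d, 0 < d & forall y, mdist y x < d -> domain phi y -> a < fr y.
Proof.
move=> dx ax.
have [|V /metricType_numDomainType.nbhs_mdistP[d /= d0 H] K] := phi_lsc (x := x) (a := a).
  by rewrite domK// lte_fin.
exists d => // y yx dy.
have /K : V y by apply: H; rewrite /= metric_sym.
by rewrite domK// lte_fin.
Qed.

(* If the energy exceeded its value at [s], let [a] be the last time where it does not: after [a]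
   the inequality with [v = u a] keeps the curve at [u a]. *)
Lemma dini_flow_nonincreasing u s t : dini_flow u -> 0 <= s -> domain phi (u s) ->
  s <= t -> fr (u t) <= fr (u s).
Proof.
move=> uf s0 ds st; rewrite leNgt; apply/negP => fst.
pose S := [set r | s <= r <= t /\ fr (u r) <= fr (u s)].
have Ss : S s by rewrite /S/= lexx st.
have Sb : has_ubound S by exists t => r [/andP[]].
pose a := sup S.
have sa : s <= a by exact: ub_le_sup.
have at_ : a <= t by apply: ge_sup; [exists s|move=> r [/andP[]]].
have a0 : 0 <= a by exact: le_trans sa.
have da : domain phi (u a).
  move: sa; rewrite le_eqVlt => /predU1P[<-//|sa].
  by apply: (df_dom uf); exact: le_lt_trans sa.
(* Points of [S] accumulate at its supremum, so lower semicontinuity of the energy passes the bound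
   on to [a]. *)
have Sa : fr (u a) <= fr (u s).
  rewrite leNgt; apply/negP => fsa.
  have [d d0 H] := lsc_fine da fsa.
  have [d' d'0 H'] := df_cont uf a0 d0.
  have [r Sr ra] := @sup_adherent _ S d' d'0 (conj (ex_intro _ s Ss) Sb).
  have ra' : r <= a by exact: ub_le_sup.
  case: Sr => /andP[sr rt] fr_.
  have r0 : 0 <= r by exact: le_trans sr.
  have dr : domain phi (u r).
    move: sr; rewrite le_eqVlt => /predU1P[<-//|sr].
    by apply: (df_dom uf); exact: le_lt_trans sr.
  have : fr (u s) < fr (u r).
    apply: H => //; apply: H' => //.
    by rewrite ltr_norml; move: ra; rewrite -/a => ra; apply/andP; split; lra.
  lra.
have {}at_ : a < t.
  by rewrite lt_neqAle at_ andbT; apply/eqP => at'; move: fst; rewrite -at'; lra.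
have : expR (lam * t) * mdist (u t) (u a) ^+ 2 <= expR (lam * a) * mdist (u a) (u a) ^+ 2.
  apply: (@dini_le_nonincreasing _ (fun r => expR (lam * r) * mdist (u r) (u a) ^+ 2)).
  - exact: ltW.
  - move=> r /andP[ar rt]; apply: curve0_weighted_left; first exact: df_cont.
    exact: le_lt_trans ar.
  - by apply: curve0_weighted_right => //; exact: df_cont.
  - move=> r /andP[ar rt].
    have r0 : 0 < r by exact: le_lt_trans ar.
    apply: dini_leW (dini_flow_weighted uf r0 da).
    rewrite pmulr_rle0 ?mulr_gt0 ?expR_gt0// subr_le0 (le_trans Sa)// leNgt.
    apply/negP => frs.
    have : S r by split; [rewrite (le_trans sa (ltW ar)) (ltW rt)|exact: ltW].
    by move=> /(ub_le_sup Sb); rewrite -/a; lra.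
rewrite mdistxx expr0n/= mulr0 pmulr_rle0 ?expR_gt0// => /mdist2_le0 uta.
by move: fst; rewrite uta; lra.
Qed.

(* Integrated form of the EVI; unlike the differential form it makes sense from time 0 on. *)
Record evi_flow u : Prop := {
  ef_cont : curve0_continuous u ;
  ef_dom : forall t, 0 < t -> domain phi (u t) ;
  ef_evi : forall s t v, 0 <= s -> s <= t -> domain phi v ->
    expR (lam * (t - s)) * mdist (u t) v ^+ 2 - mdist (u s) v ^+ 2
      <= 2 * Efun lam (t - s) * (fr v - fr (u t)) }.

(** The energy at an intermediate time is at least the one at the final time [t]; with the latter in
    its place the right-hand side has the explicit primitive [Efun]. *)
Lemma dini_flow_evi u : dini_flow u -> evi_flow u.
Proof.
move=> uf; split; [exact: df_cont|exact: df_dom|] => s t v s0.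
rewrite le_eqVlt => /predU1P[->|st] dv.
  by rewrite subrr mulr0 expR0 mul1r subrr Efun0 mulr0 mul0r.
have t0 : 0 < t by exact: le_lt_trans st.
pose k := 2 * (fr v - fr (u t)).
pose z r := expR (lam * r) * mdist (u r) v ^+ 2.
pose w r := - k * Efun lam r.
have Dw r : is_derive r (1 : R) w (- k * expR (lam * r)).
  exact: (is_deriveZ (- k) (is_derive_Efun lam r)).
have wc : continuous w.
  move=> r; apply: differentiable_continuous; apply/derivable1_diffP.
  by case: (Dw r).
have : (z \+ w) t <= (z \+ w) s.
  apply: dini_le_nonincreasing; first exact: ltW.
  - move=> r /andP[sr rt]; apply: left_lscD.
      by apply: curve0_weighted_left; [exact: df_cont|exact: le_lt_trans sr].
    by apply: cvg_left_lsc; apply: cvg_at_left_filter; exact: wc.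
  - apply: right_uscD.
      by apply: curve0_weighted_right; [exact: df_cont|].
    by apply: cvg_right_usc; apply: cvg_at_right_filter; exact: wc.
  - move=> r /andP[sr rt].
    have r0 : 0 < r by exact: le_lt_trans sr.
    have := dini_leD (dini_flow_weighted uf r0 dv) (is_derive_dini_le (Dw r)).
    apply: dini_leW; rewrite /k.
    have -> : 2 * expR (lam * r) * (fr v - fr (u r)) +
       - (2 * (fr v - fr (u t))) * expR (lam * r) =
       2 * expR (lam * r) * (fr (u t) - fr (u r)) by ring.
    rewrite pmulr_rle0 ?mulr_gt0 ?expR_gt0// subr_le0.
    by apply: dini_flow_nonincreasing => //; [exact: ltW|exact: df_dom|exact: ltW].
rewrite /= /z /w => H.
have E1 : Efun lam t = Efun lam s + expR (lam * s) * Efun lam (t - s).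
  by rewrite -EfunD subrKC.
have E2 : expR (lam * t) = expR (lam * s) * expR (lam * (t - s)).
  by rewrite -expRD -mulrDr subrKC.
rewrite E1 E2 in H.
rewrite -(ler_pM2l (expR_gt0 (lam * s))) -/k.
have -> : 2 * Efun lam (t - s) * (fr v - fr (u t)) = k * Efun lam (t - s).
  by rewrite /k; ring.
lra.
Qed.

Lemma evi_flow_shift u s : 0 <= s -> evi_flow u -> evi_flow (fun t => u (s + t)).
Proof.
move=> s0 uf; split.
- move=> t t0 e e0; have [d d0 H] := ef_cont uf (addr_ge0 s0 t0) e0.
  exists d => // r r0 rt; apply: H; first by rewrite addr_ge0.
  by rewrite opprD addrACA subrr add0r.
- by move=> t t0; apply: ef_dom => //; rewrite ltr_wpDl.
- move=> r t v r0 rt dv.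
  have := @ef_evi _ uf (s + r) (s + t) v; rewrite opprD addrACA subrr add0r.
  by apply => //; [rewrite addr_ge0|rewrite lerD2l].
Qed.

Lemma EVI_dini u t v : EVI_solution lam phi u -> 0 < t -> domain phi v ->
  dini_le (fun s => mdist (u s) v ^+ 2) t
      (2 * (fr v - fr (u t)) - lam * mdist (u t) v ^+ 2).
Proof.
case=> _ dom_u evi t0 dv e e0.
have := evi t v t0 dv; rewrite {1}(domK dv) {1}(domK (dom_u t t0)).
rewrite /upper_right_dini.
set L := limf_esup _ _ => H.
have /limf_esup_lt[V FV HV] : (L < (2 * (fr v - fr (u t)) - lam * mdist (u t) v ^+ 2 + e)%:E)%E.
  move: H; case: L => [r| |]; last by rewrite ltNyr.
    rewrite -EFinM -EFinD -EFinB lee_fin lte_fin; set d2 := _ ^+ 2; lra.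
  by rewrite gt0_muley ?lte_fin ?invr_gt0// addye// -EFinB.
apply: filterS2 FV (nbhs_right_gt 0) => h Vh h0.
by have := HV h Vh; rewrite lte_fin ltr_pdivrMr// => /ltW.
Qed.

Lemma within_curve u (I : set R) t : {within I, continuous u} -> I t ->
  forall e, 0 < e -> exists2 d, 0 < d & forall s, I s -> `|s - t| < d -> mdist (u s) (u t) < e.
Proof.
move=> /subspace_continuousP uc It e e0.
have /metricType_numDomainType.cvgr_dist_lt/(_ e e0) := uc t It.
rewrite near_withinE => /nbhs_ballP[d /= d0 H]; exists d => // s Is sd.
by rewrite metric_sym; apply: H => //; rewrite /ball/= distrC.
Qed.

Lemma EVI_C0_flow u : EVI_solution_C0 lam phi u -> evi_flow u.
Proof.
move=> [uc us]; apply: dini_flow_evi; split.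
- move=> t t0 e e0; have [|d d0 H] := within_curve uc _ e0 (t := t).
    by rewrite /= in_itv/= t0.
  by exists d => // s s0; apply: H; rewrite /= in_itv/= s0.
- by case: us.
- by move=> t v; exact: EVI_dini.
Qed.

(** For solutions known on positive times only: a positive shift provides the value at 0 that a flow
    requires. *)
Lemma EVI_flow_shift u s : 0 < s -> EVI_solution lam phi u ->
  evi_flow (fun t => u (s + t)).
Proof.
move=> s0 us; apply: dini_flow_evi; split.
- move=> t t0 e e0; have [uc _ _] := us.
  have st : 0 < s + t by rewrite ltr_pwDl.
  have [|d d0 H] := within_curve uc _ e0 (t := s + t).
    by rewrite /= in_itv/= st.
  exists d => // r r0 rt; apply: H; first by rewrite /= in_itv/= ltr_pwDl.
  by rewrite opprD addrACA subrr add0r.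
- by case: us => _ + _ t t0; apply; rewrite ltr_wpDr// ltW.
- move=> t v t0 dv e e0.
  have st : 0 < s + t by rewrite addr_gt0.
  by apply: filterS (EVI_dini us st dv e0) => h; rewrite addrA.
Qed.

(** * Slopes *)

Lemma not_dom x : ~ domain phi x -> phi x = +oo%E.
Proof. by rewrite /domain/= => /negP; rewrite -leNgt leye_eq => /eqP. Qed.

Lemma inve_fin r : 0 < r -> (r%:E^-1)%E = (r^-1)%:E :> \bar R.
Proof. by move=> r0; rewrite inver gt_eqF. Qed.

Lemma slope_quot x y (d : R) : domain phi x -> domain phi y -> 0 < d ->
  (maxe (phi x - phi y) 0 / d%:E)%E = (Num.max (fr x - fr y) 0 / d)%:E.
Proof.
by move=> dx dy d0; rewrite (domK dx) (domK dy) -EFinB -EFin_max inve_fin// -EFinM.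
Qed.

Lemma slope_quot0 x y (d : \bar R) : domain phi x -> ~ domain phi y ->
  (maxe (phi x - phi y) 0 / d)%E = 0%E.
Proof.
by move=> dx /not_dom ->; rewrite (domK dx)/= maxEle /= leNye mul0e.
Qed.

(** This bound and its converses are stated for an arbitrary extended distance, to serve both
    [mdiste] and [length_dist]; an infinite distance never falls below the radius [r]. *)
Lemma slope_wrt_le delta x c : (forall y, y != x -> (0 < delta x y)%E) ->
  domain phi x -> 0 <= c ->
  (exists2 r, 0 < r & forall y, (delta x y < r%:E)%E -> domain phi y ->
     ((fr x - fr y)%:E <= c%:E * delta x y)%E) ->
  (slope_wrt delta phi x <= c%:E)%E.
Proof.
move=> delta0 dx c0 [r r0 H]; rewrite /slope_wrt {1}(domK dx)/=.
case: ifPn => _; first by rewrite lee_fin.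
apply: (@limf_esup_le _ _ _ _ _ [set y | y != x /\ (delta x y < r%:E)%E]).
  by exists r.
move=> y [yx yr]; have := delta0 y yx; have := H y yr.
case: (pselect (domain phi y)) => [dy /(_ dy)|dy _ _]; last first.
  by rewrite slope_quot0// lee_fin.
move: yr; case: (delta x y) => [d| |]//; rewrite lte_fin => yr; rewrite -EFinM !lee_fin lte_fin => K d0.
by rewrite slope_quot// lee_fin ler_pdivrMr// ge_max K mulr_ge0// ltW.
Qed.

Lemma slope_wrt_lt delta x c : (forall y, y != x -> (0 < delta x y)%E) ->
  (slope_wrt delta phi x < c%:E)%E -> 0 < c ->
  exists2 r, 0 < r & forall y, y != x -> (delta x y < r%:E)%E -> domain phi y ->
     ((fr x - fr y)%:E <= c%:E * delta x y)%E.
Proof.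
move=> delta0; rewrite /slope_wrt; case: ifPn => [//|px].
have dx : domain phi x by rewrite /domain/= lt_neqAle px leey.
case: ifPn => [/asboolP[r r0 H] _ c0|_ /limf_esup_lt[V [r /= r0 rV] HV] c0].
  by exists r => // y yx yr; move: yx; rewrite (H _ yr) eqxx.
exists r => // y yx yr dy; have := HV y (rV y (conj yx yr)).
have := delta0 y yx; move: yr; case: (delta x y) => [d| |]//.
rewrite !lte_fin => yr d0; rewrite slope_quot// lte_fin ltr_pdivrMr// => /ltW.
by rewrite ge_max => /andP[K _]; rewrite -EFinM lee_fin.
Qed.

Lemma slope_wrt_dom delta x : (slope_wrt delta phi x < +oo)%E -> domain phi x.
Proof. by rewrite /slope_wrt; case: ifPn => // px _; rewrite /domain/= lt_neqAle px leey. Qed.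

Lemma slope_wrt_ge delta x c : domain phi x ->
  (forall r, 0 < r -> exists y, [/\ y != x, domain phi y, (0 < delta x y)%E,
     (delta x y < r%:E)%E & (c%:E * delta x y <= (fr x - fr y)%:E)%E]) ->
  (c%:E <= slope_wrt delta phi x)%E.
Proof.
move=> dx H; rewrite /slope_wrt; case: ifPn => [_|px]; first exact: leey.
case: ifPn => [/asboolP[r r0 K]|_].
  by have [y [yx _ _ yr _]] := H r r0; move: yx; rewrite (K _ yr) eqxx.
apply: limf_esup_ge => V [r /= r0 rV]; have [y [yx dy d0 yr K]] := H r r0.
exists y; first exact: rV.
move: yr d0 K; case: (delta x y) => [d| |]//; rewrite !lte_fin => yr d0; rewrite -EFinM lee_fin => K.
by rewrite slope_quot// lee_fin ler_pdivlMr// le_max K.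
Qed.

Lemma slope_wrt_ge0 delta x : (forall y, y != x -> (0 < delta x y)%E) ->
  (0 <= slope_wrt delta phi x)%E.
Proof.
move=> delta0; rewrite /slope_wrt; case: ifPn => // px; case: ifPn => // /asboolP ni.
have dx : domain phi x by rewrite /domain/= lt_neqAle px leey.
apply: limf_esup_ge => V [r /= r0 rV].
apply: contrapT => K; apply: ni; exists r => // y yr; apply/eqP/negPn/negP => yx.
apply: K; exists y; first exact: rV.
have := delta0 y yx; move: yr; case: (delta x y) => [d| |]// _; rewrite lte_fin => d0.
rewrite inve_fin// mule_ge0// ?lee_fin ?invr_ge0 ?(ltW d0)//.
by rewrite le_max lexx orbT.
Qed.

Lemma mdiste_gt0 x y : y != x -> (0 < mdiste x y)%E.
Proof. by rewrite eq_sym -mdist_gt0 /mdiste lte_fin. Qed.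

Lemma slope_ge0 x : (0 <= slope phi x)%E.
Proof. exact/slope_wrt_ge0/mdiste_gt0. Qed.

Lemma slope_near x c : (slope phi x < c%:E)%E ->
  exists2 r, 0 < r & forall y, mdist y x < r -> domain phi y -> fr x - fr y <= c * mdist y x.
Proof.
move=> sc; have c0 : 0 < c by have := le_lt_trans (slope_ge0 x) sc; rewrite lte_fin.
have [r r0 H] := slope_wrt_lt (@mdiste_gt0 x) sc c0; exists r => // y yr dy.
have [->|yx] := eqVneq y x; first by rewrite mdistxx mulr0 subrr.
have := H y yx; rewrite /mdiste lte_fin metric_sym -EFinM lee_fin; exact.
Qed.

Lemma global_slope_ge0 x : (0 <= gs x)%E.
Proof. by rewrite /global_slope; case: ifPn => //; rewrite le_max lexx orbT. Qed.

Lemma global_slope_dom x : (gs x < +oo)%E -> domain phi x.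
Proof. by rewrite /global_slope; case: ifPn => // px _; rewrite /domain/= lt_neqAle px leey. Qed.

(** The form in which the global slope is used: divisions are cleared, and the case [y = x] becomes
    the trivial inequality. *)
Lemma global_slope_leP x c : domain phi x -> 0 <= c ->
  (gs x <= c%:E)%E <->
  (forall y, domain phi y -> fr x - fr y + lam / 2 * mdist x y ^+ 2 <= c * mdist x y).
Proof.
move=> dx c0; rewrite /global_slope {1}(domK dx)/= ge_max lee_fin c0 andbT.
have quot y : domain phi y -> y != x ->
  (maxe (phi x - phi y + (lam / 2 * mdist x y ^+ 2)%:E) 0 / (mdist x y)%:E)%E =
  (Num.max (fr x - fr y + lam / 2 * mdist x y ^+ 2) 0 / mdist x y)%:E.
  move=> dy; rewrite eq_sym -mdist_gt0 => d0.
  by rewrite (domK dx) (domK dy) -EFinB -EFinD -EFin_max inve_fin// -EFinM.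
split.
- move=> H y dy; have [->|yx] := eqVneq y x.
    by rewrite mdistxx expr0n/= !mulr0 subrr addr0.
  have : ((Num.max (fr x - fr y + lam / 2 * mdist x y ^+ 2) 0 / mdist x y)%:E <= c%:E)%E.
    by rewrite -quot//; apply: le_trans H; apply: ereal_sup_ubound; exists y.
  by rewrite lee_fin ler_pdivrMr ?mdist_gt0 1?eq_sym// ge_max => /andP[].
- move=> H; apply: ge_ereal_sup => _ [y /= yx <-].
  case: (pselect (domain phi y)) => [dy|/not_dom ->].
    by rewrite quot// lee_fin ler_pdivrMr ?mdist_gt0 1?eq_sym// ge_max H// mulr_ge0// mdist_ge0.
  by rewrite (domK dx)/= maxEle /= leNye mul0e lee_fin.
Qed.

Lemma slope_le_global x : (slope phi x <= gs x)%E.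
Proof.
case: (pselect (domain phi x)) => [dx|/not_dom px]; last first.
  by rewrite /global_slope px eqxx leey.
have := global_slope_ge0 x; case E : (gs x) => [c| |]; [|by move=> _; rewrite leey|by []].
rewrite lee_fin => c0; apply/lee_addgt0Pr => e e0.
have /(global_slope_leP dx c0) H : (gs x <= c%:E)%E by rewrite E.
apply: slope_wrt_le => //; first exact: mdiste_gt0.
  by rewrite addr_ge0// ltW.
(* Within this radius the quadratic term is at most [e] times the distance. *)
exists (2 * e / (`|lam| + 1)); first by rewrite divr_gt0 ?mulr_gt0// ltr_wpDl.
move=> y; rewrite /mdiste lte_fin => yr dy; rewrite -EFinM lee_fin.
have := H y dy; have d0 := mdist_ge0 x y; set d := mdist x y in yr d0 *.
have : `|lam| * d <= 2 * e.
  by move: yr; rewrite ltr_pdivlMr ?ltr_wpDl// => ?; lra.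
have := ler_norm (- lam); rewrite normrN => l1 l2.
have : - lam * d * d <= 2 * e * d by apply: ler_wpM2r => //; apply: le_trans l2; exact: ler_wpM2r.
lra.
Qed.

(** A point witnessing that the global slope at [x] exceeds [c] remains a witness near [x], because
    the defining expression is lower semicontinuous in [x]. *)
Lemma global_slope_lsc x c : (exists x0, domain phi x0) ->
  (c%:E < gs x)%E ->
  exists2 r, 0 < r & forall y, mdist y x < r -> (c%:E < gs y)%E.
Proof.
move=> [x0 dx0] cx; have [c0|c0] := ltP c 0.
  by exists 1 => // y _; apply: lt_le_trans (global_slope_ge0 y); rewrite lte_fin.
pose k v y := lam / 2 * mdist y v ^+ 2 - c * mdist y v.
have kc v e : 0 < e -> exists2 r, 0 < r & forall y, mdist y x < r -> k v x - e < k v y.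
  move=> e0.
  have H : k v y @[y --> x] --> k v x.
    have dc : mdist y v @[y --> x] --> mdist x v.
      apply/cvgrPdist_lt => e1 e10; apply/metricType_numDomainType.nbhs_mdistP.
      exists e1 => // y /= xy; apply: le_lt_trans xy; exact: mdist_lip.
    by apply: cvgB; apply: cvgM => //; [exact: cvg_cst|rewrite expr2;
      under eq_fun do rewrite expr2; exact: cvgM|exact: cvg_cst].
  move/cvgrPdist_lt : H => /(_ e e0)/metricType_numDomainType.nbhs_mdistP[r /= r0 H].
  exists r => // y yr; have := H y; rewrite /= metric_sym => /(_ yr).
  by rewrite ltr_norml => /andP[? ?]; lra.
case: (pselect (domain phi x)) => [dx|/not_dom px].
- have /existsNP[y /not_implyP[dy /negP]] : ~ (forall y, domain phi y ->
      fr x - fr y + lam / 2 * mdist x y ^+ 2 <= c * mdist x y).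
    by move=> /(global_slope_leP dx c0); rewrite leNgt cx.
  rewrite -ltNge => cy.
  pose e := (fr x - fr y + k y x) / 2.
  have e0 : 0 < e by rewrite divr_gt0// /k; lra.
  have [r1 r10 H1] := kc y e e0.
  have [|r2 r20 H2] := lsc_fine dx (a := fr x - e); first lra.
  exists (Num.min r1 r2); first by rewrite lt_min r10.
  move=> z; rewrite lt_min => /andP[z1 z2]; rewrite ltNge; apply/negP.
  case: (pselect (domain phi z)) => [dz|/not_dom pz]; last by rewrite /global_slope pz eqxx.
  move=> /(global_slope_leP dz c0)/(_ y dy).
  by have := H1 z z1; have := H2 z z2 dz; rewrite /e /k in e0 *; lra.
(* When [x] has infinite energy, the energies near [x] are so large that any [x0] of the domain is a
   witness; 1 is an arbitrary margin. *)
- have [r1 r10 H1] := kc x0 1 ltr01.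
  have [|V /metricType_numDomainType.nbhs_mdistP[r2 /= r20 H2] HV] :=
      phi_lsc (x := x) (a := fr x0 - k x0 x + 1); first by rewrite px ltry.
  exists (Num.min r1 r2); first by rewrite lt_min r10.
  move=> z; rewrite lt_min => /andP[z1 z2]; rewrite ltNge; apply/negP.
  case: (pselect (domain phi z)) => [dz|/not_dom pz]; last by rewrite /global_slope pz eqxx.
  move=> /(global_slope_leP dz c0)/(_ x0 dx0).
  have : V z by apply: H2; rewrite /= metric_sym.
  move=> /HV; rewrite (domK dz) lte_fin.
  by have := H1 z z1; rewrite /k; lra.
Qed.

(** * Contraction and slopes along a flow *)

Lemma flow_proper u : evi_flow u -> exists x0, domain phi x0.
Proof. by move=> uf; exists (u 1); apply: (ef_dom uf). Qed.

(** Testing the integrated inequality with [v = u s] makes its left-hand side nonnegative. *)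
Lemma flow_nonincreasing u s t : evi_flow u -> 0 <= s -> domain phi (u s) -> s <= t ->
  fr (u t) <= fr (u s).
Proof.
move=> uf s0 ds; rewrite le_eqVlt => /predU1P[->//|st].
have := ef_evi uf s0 (ltW st) ds; rewrite mdistxx expr0n/= subr0 => H.
rewrite -subr_ge0 -(@pmulr_rge0 _ (2 * Efun lam (t - s))); last first.
  by rewrite mulr_gt0// Efun_gt0// subr_gt0.
by apply: le_trans H; rewrite mulr_ge0 ?sqr_ge0// expR_ge0.
Qed.

Lemma flow_domS u s t : evi_flow u -> 0 <= s -> domain phi (u s) -> s <= t -> domain phi (u t).
Proof.
move=> uf s0 ds; rewrite le_eqVlt => /predU1P[<-//|st].
by apply: (ef_dom uf); exact: le_lt_trans st.
Qed.

Lemma flow_energy_right u t e : evi_flow u -> 0 <= t -> domain phi (u t) -> 0 < e ->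
  \forall h \near 0^'+, fr (u t) - e < fr (u (t + h)).
Proof.
move=> uf t0 dt e0.
have [|d d0 H] := lsc_fine dt (a := fr (u t) - e); first lra.
have [d' d'0 H'] := ef_cont uf t0 d0.
apply/near0P; exists d' => // h /andP[h0 hd].
apply: H; last by apply: (ef_dom uf); rewrite ltr_wpDl.
apply: H'; first by rewrite addr_ge0// ltW.
by rewrite addrAC subrr add0r gtr0_norm.
Qed.

Lemma dini_le_of_majorant (z : R -> R) t c :
  (forall e, 0 < e -> exists (B : R -> R) b, [/\ is_derive (0 : R) (1 : R) B b, B 0 = 0, b <= c + e &
     \forall h \near 0^'+, z (t + h) - z t <= B h]) -> dini_le z t c.
Proof.
move=> H e e0; have e2 : 0 < e / 2 by rewrite divr_gt0.
have [B [b [dB B0 bc zB]]] := H _ e2.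
apply: filterS3 (nbhs_right_gt 0) zB (is_derive_dini_le dB e2) => h h0 h1.
rewrite add0r B0 subr0 => h2; apply: le_trans h1 _; apply: le_trans h2 _.
by rewrite ler_pM2r//; lra.
Qed.

(** The way back from the integrated to the differential inequality, now also at time 0 if the
    energy is finite there; lower semicontinuity replaces the energy at [t + h] by the one at [t],
    up to [e1]. *)
Lemma flow_dini_weighted u t v : evi_flow u -> 0 <= t -> domain phi (u t) -> domain phi v ->
  dini_le (fun s => expR (lam * s) * mdist (u s) v ^+ 2) t
    (2 * expR (lam * t) * (fr v - fr (u t))).
Proof.
move=> uf t0 dt dv; apply: dini_le_of_majorant => e e0.
pose e1 := e / (2 * expR (lam * t)).
have e10 : 0 < e1 by rewrite divr_gt0// mulr_gt0// expR_gt0.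
pose k := 2 * expR (lam * t) * (fr v - fr (u t) + e1).
exists (fun r => k * Efun lam r), (k * expR (lam * 0)); split.
- exact: is_derive_EfunZ.
- by rewrite Efun0 mulr0.
- rewrite mulr0 expR0 mulr1 /k mulrDr /e1 le_eqVlt; apply/orP; left; apply/eqP.
  by field; rewrite gt_eqF// expR_gt0.
- apply: filterS2 (nbhs_right_gt 0) (flow_energy_right uf t0 dt e10) => h h0 fh.
  have th : t <= t + h by rewrite lerDl ltW.
  have := ef_evi uf t0 th dv; rewrite addrAC subrr add0r => H.
  rewrite mulrDr expRD -mulrA -mulrBr /k.
  rewrite -[2 * _]mulrC -!mulrA ler_pM2l ?expR_gt0//; apply: le_trans H _.
  have : Efun lam h * (fr v - fr (u (t + h))) <= Efun lam h * (fr v - fr (u t) + e1).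
    by rewrite ler_pM2l ?Efun_gt0//; lra.
  lra.
Qed.

Lemma dini_le_unweight (z : R -> R) l t c :
  dini_le (fun s => expR (l * s) * z s) t c -> dini_le z t (expR (- l * t) * c - l * z t).
Proof.
move=> H; have := dini_leM (is_derive_expRl (- l) t) (expR_gt0 _) H.
rewrite (_ : _ \* _ = z); last first.
  by apply/funext => s /=; rewrite mulrA (mulrC (expR (- l * s))) expRlN mul1r.
have -> : - l * expR (- l * t) * (expR (l * t) * z t) =
  - (expR (l * t) * expR (- l * t)) * (l * z t) by ring.
by rewrite expRlN mulN1r.
Qed.

Lemma flow_dini u t v : evi_flow u -> 0 <= t -> domain phi (u t) -> domain phi v ->
  dini_le (fun s => mdist (u s) v ^+ 2) t
    (2 * (fr v - fr (u t)) - lam * mdist (u t) v ^+ 2).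
Proof.
move=> uf t0 dt dv.
have := dini_le_unweight (flow_dini_weighted uf t0 dt dv).
set k := fr v - _; have -> : expR (- lam * t) * (2 * expR (lam * t) * k) =
  (expR (lam * t) * expR (- lam * t)) * (2 * k) by ring.
by rewrite expRlN mul1r.
Qed.

Lemma curve0_cvg2 u1 u2 t (F : set_system R) {FF : Filter F} :
  curve0_continuous u1 -> curve0_continuous u2 ->
  0 <= t -> F --> t -> F [set s | 0 <= s] ->
  mdist (u1 s) (u2 s) @[s --> F] --> mdist (u1 t) (u2 t).
Proof.
move=> uc1 uc2 t0 Ft F0; apply/cvgrPdist_lt => e e0.
have e2 : 0 < e / 2 by rewrite divr_gt0.
have [d1 d10 H1] := uc1 t t0 _ e2.
have [d2 d20 H2] := uc2 t t0 _ e2.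
have Fd : F [set s | `|s - t| < Num.min d1 d2].
  apply: Ft; apply/nbhs_ballP; exists (Num.min d1 d2) => /=; first by rewrite lt_min d10.
  by move=> s; rewrite /ball/= distrC.
apply: filterS2 F0 Fd => s /= s0; rewrite lt_min => /andP[sd1 sd2].
have := H1 s s0 sd1; have := H2 s s0 sd2.
have := mdist_lip (u1 s) (u1 t) (u2 s).
have := mdist_lip (u2 s) (u2 t) (u1 t).
rewrite !(metric_sym _ (u1 t)) ltr_norml !ler_norml => /andP[? ?] /andP[? ?] ? ?.
by apply/andP; split; lra.
Qed.

(** The squared distance between two moving points is advanced in two moves: first [u1] goes from
    [r] to [r + h] while [u2] waits, then [u2] follows while [u1] waits at its new position. In the
    sum the energies of [u1] cancel up to the factor [expR (lam * h) - 1], and those of [u2] leave a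
    drop that vanishes with [h]. *)
Lemma flow_contraction u1 u2 s t : evi_flow u1 -> evi_flow u2 -> 0 <= s -> s <= t ->
  mdist (u1 t) (u2 t) <= expR (- lam * (t - s)) * mdist (u1 s) (u2 s).
Proof.
move=> f1 f2 s0 st; have t0 : 0 <= t by exact: le_trans st.
pose z r := expR (2 * lam * r) * mdist (u1 r) (u2 r) ^+ 2.
have zc (r : R) (F : set_system R) : Filter F -> 0 <= r -> F --> r -> F [set s | 0 <= s] ->
    z @ F --> z r.
  move=> FF r0 Fr F0; apply: cvgM; first exact: (cvg_trans (cvg_app _ Fr) (@continuous_expRl _ (2 * lam) r)).
  have /(_ FF) H := curve0_cvg2 (ef_cont f1) (ef_cont f2) r0 Fr F0.
  by rewrite expr2; under eq_fun do rewrite expr2; exact: cvgM.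
have : z t <= z s.
  apply: dini_le_nonincreasing => //.
  - move=> r /andP[sr rt]; have r0 := le_lt_trans s0 sr.
    apply: cvg_left_lsc; apply: zc; [exact: ltW|exact: cvg_at_left|].
    by apply: filterS (nbhs_left_gt r0) => ? /ltW.
  - apply: cvg_right_usc; apply: zc; [by []|exact: cvg_at_right|].
    by apply: filterS (nbhs_right_gt s) => r /(le_lt_trans s0)/ltW.
  move=> r /andP[sr rt]; have r0 := le_lt_trans s0 sr.
  have d1 := ef_dom f1 r0; have d2 := ef_dom f2 r0.
  suff : dini_le (fun r => expR (2 * lam * r) * mdist (u1 r) (u2 r) ^+ 2) r 0 by [].
  apply: dini_le_of_majorant => e e0.
  pose c := expR (2 * lam * r); have c0 : 0 < c by exact: expR_gt0.
  pose e1 := e / (4 * c); have e10 : 0 < e1 by rewrite divr_gt0// mulr_gt0.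
  pose k := 4 * c * e1.
  exists (fun r => k * Efun lam r), (k * expR (lam * 0)); split.
  - exact: is_derive_EfunZ.
  - by rewrite Efun0 mulr0.
  - rewrite mulr0 expR0 mulr1 /k /e1 add0r le_eqVlt; apply/orP; left; apply/eqP.
    by field; rewrite gt_eqF.
  (* For small [h] both energies drop by at most 1, so [M] bounds their difference at time
     [r + h]. *)
  pose M := `|fr (u1 r)| + `|fr (u2 r)| + 2.
  have M0 : 0 < M by rewrite ltr_wpDl// addr_ge0.
  have E : \forall h \near (0 : R)^'+, `|1 - expR (lam * h)| < e1 / M.
    by have /cvgrPdist_lt/(_ (e1 / M)) := cvg_expRl0 lam; apply; rewrite divr_gt0.
  have E1 := filterI (flow_energy_right f1 (ltW r0) d1 ltr01) (flow_energy_right f2 (ltW r0) d2 ltr01).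
  have E2 := filterI (nbhs_right_gt 0) (flow_energy_right f2 (ltW r0) d2 e10).
  apply: filterS3 E (E1 _) (E2 _) => h Eh [/= a1 a2] [/= h0 a3].
  have rh : r <= r + h by rewrite lerDl ltW.
  have rh0 : 0 < r + h by rewrite addr_gt0.
  have I1 := ef_evi f1 (ltW r0) rh d2; have I2 := ef_evi f2 (ltW r0) rh (ef_dom f1 rh0).
  rewrite addrAC subrr add0r !(metric_sym (u2 _)) in I1 I2.
  have b1 := flow_nonincreasing f1 (ltW r0) d1 rh.
  have b2 := flow_nonincreasing f2 (ltW r0) d2 rh.
  set F1 := fr (u1 (r + h)) in I1 I2 b1 a1 *.
  set F2 := fr (u2 (r + h)) in I1 I2 b2 a2 a3 *.
  have E3 : expR (2 * lam * (r + h)) = c * (expR (lam * h) * expR (lam * h)).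
    by rewrite -!expRD; congr expR; ring.
  suff L : expR (lam * h) * (expR (lam * h) * mdist (u1 (r + h)) (u2 (r + h)) ^+ 2) -
      mdist (u1 r) (u2 r) ^+ 2 <= 4 * e1 * Efun lam h.
    by move: L; rewrite -(ler_pM2l c0) E3 -/c /k; lra.
  have B : (expR (lam * h) - 1) * (F1 - F2) <= e1.
    apply: le_trans (ler_norm _) _; rewrite normrM distrC.
    have : `|F1 - F2| <= M.
      have := ler_norm (fr (u1 r)); have := ler_norm (fr (u2 r)).
      have := ler_norm (- fr (u1 r)); have := ler_norm (- fr (u2 r)).
      by clear -a1 a2 b1 b2 M; rewrite !normrN ler_norml /M => ? ? ? ?; apply/andP; split; lra.
    move=> FM; apply: (@le_trans _ _ (e1 / M * M)); last by rewrite divfK// gt_eqF.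
    by apply: ler_pM => //; exact: ltW.
  have E0 : 0 < Efun lam h by exact: Efun_gt0.
  have I3 : expR (lam * h) * (expR (lam * h) * mdist (u1 (r + h)) (u2 (r + h)) ^+ 2 -
     mdist (u1 (r + h)) (u2 r) ^+ 2) <= expR (lam * h) * (2 * Efun lam h * (F1 - F2)).
    by rewrite ler_pM2l// expR_gt0.
  have I4 : Efun lam h * (fr (u2 r) - F2 + (expR (lam * h) - 1) * (F1 - F2)) <= Efun lam h * (2 * e1).
    by rewrite ler_pM2l//; lra.
  lra.
rewrite /z.
have -> : 2 * lam * t = 2 * lam * s + 2 * lam * (t - s) by ring.
rewrite expRD -mulrA ler_pM2l ?expR_gt0// => H.
apply: sqr_le_of_le; first exact: mdist_ge0.
  rewrite exprMn -expRM_natl -(ler_pM2l (expR_gt0 (2 * lam * (t - s)))).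
  have -> : 2 * (- lam * (t - s)) = - (2 * lam) * (t - s) by ring.
  by rewrite [leRHS]mulrA expRlN mul1r.
by rewrite mulr_ge0 ?mdist_ge0// expR_ge0.
Qed.

(** The Dini inequality with [v = u s] bounds the growth at [s + r] by a multiple of [2 c r], whose
    primitive is the same multiple of [c r^2]. One application of the integrated inequality would
    give [2 c] in place of [c], too weak to identify speed and slope. *)
Lemma speed_le_energy u s c d : evi_flow u -> 0 <= s -> domain phi (u s) -> 0 <= c ->
  (forall h, 0 < h <= d -> fr (u s) - fr (u (s + h)) <= c * h) ->
  forall h, 0 < h <= d -> mdist (u (s + h)) (u s) ^+ 2 <= c * expR (2 * `|lam| * h) * h ^+ 2.
Proof.
move=> uf s0 ds c0 H h /andP[h0 hd].
have wf := evi_flow_shift s0 uf.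
pose k := - (c * expR (`|lam| * h)).
have : ((fun r => expR (lam * r) * mdist (u (s + r)) (u s) ^+ 2) \+ (fun r => k * r ^+ 2)) h <=
       ((fun r => expR (lam * r) * mdist (u (s + r)) (u s) ^+ 2) \+ (fun r => k * r ^+ 2)) 0.
  apply: dini_le_nonincreasing; first exact: ltW.
  - move=> t /andP[t0 th]; apply: left_lscD.
      by apply: curve0_weighted_left; [exact: (ef_cont wf)|].
    exact: is_derive_left_lsc (is_derive_sqrZ k t).
  - apply: right_uscD.
      by apply: curve0_weighted_right; [exact: (ef_cont wf)|].
    exact: is_derive_right_usc (is_derive_sqrZ k 0).
  - move=> t /andP[t0 th].
    have := dini_leD (flow_dini_weighted wf (ltW t0) (ef_dom wf t0) ds)
      (is_derive_dini_le (is_derive_sqrZ k t)).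
    apply: dini_leW; rewrite /k.
    have K1 : fr (u s) - fr (u (s + t)) <= c * t by apply: H; rewrite t0 (le_trans (ltW th)).
    have K2 : expR (lam * t) * (fr (u s) - fr (u (s + t))) <= expR (lam * t) * (c * t).
      by rewrite ler_pM2l ?expR_gt0.
    have K3 : expR (lam * t) * (c * t) <= expR (`|lam| * h) * (c * t).
      rewrite ler_wpM2r ?mulr_ge0 ?(ltW t0)// (le_trans (expR_abs_ub _ (ltW t0)))//.
      by rewrite ler_expR ler_wpM2l// ltW.
    lra.
rewrite /= addr0 mdistxx !expr0n/= !mulr0 addr0 /k => K.
have K1 : expR (lam * h) * mdist (u (s + h)) (u s) ^+ 2 <= c * expR (`|lam| * h) * h ^+ 2 by lra.
have K2 : 1 <= expR (`|lam| * h) * expR (lam * h).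
  rewrite -(expRlN (`|lam|) h) ler_pM2l ?expR_gt0// ler_expR ler_wpM2r ?(ltW h0)//.
  by rewrite lerNl; have := ler_norm (- lam); rewrite normrN.
have -> : 2 * `|lam| * h = `|lam| * h + `|lam| * h by ring.
rewrite expRD.
apply: (@le_trans _ _ (expR (`|lam| * h) * (expR (lam * h) * mdist (u (s + h)) (u s) ^+ 2))).
  by rewrite mulrA -[leLHS]mul1r ler_wpM2r ?sqr_ge0.
have : expR (`|lam| * h) * (expR (lam * h) * mdist (u (s + h)) (u s) ^+ 2) <=
  expR (`|lam| * h) * (c * expR (`|lam| * h) * h ^+ 2) by rewrite ler_pM2l ?expR_gt0.
lra.
Qed.

Lemma flow_left_lsc u t : evi_flow u -> 0 < t -> left_lsc (fun s => fr (u s)) t.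
Proof.
move=> uf t0 e e0; apply/near_leftP; exists t => // s /andP[s0 st].
have {}s0 : 0 < s by lra.
apply: (@le_trans _ _ (fr (u s))); last by rewrite lerDl ltW.
apply: (flow_nonincreasing uf) => //; [exact: ltW|exact: ef_dom uf _ s0|exact: ltW].
Qed.

(** If from every time in the second half of the interval before [a] some step dropped the energy at
    a rate above [k], the steps would add up to more than the actual drop. So some time has all its
    energy quotients bounded, hence a bounded speed by [speed_le_energy]. *)
Lemma flow_lipschitz_time u a : evi_flow u -> 0 < a -> exists s K d,
  [/\ 0 < s < a, 0 <= K, 0 < d &
      forall h, 0 < h < d -> mdist (u (s + h)) (u s) <= K * h].
Proof.
move=> uf a0; pose a2 := a / 2; have a20 : 0 < a2 by rewrite divr_gt0.
have a2a : a2 < a by rewrite /a2; lra.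
have da2 : domain phi (u a2) by exact: ef_dom uf _ a20.
have faa2 : fr (u a) <= fr (u a2).
  by apply: (flow_nonincreasing uf) => //; exact: ltW.
(* One more than the mean rate of decrease of the energy on the interval. *)
pose k := (fr (u a2) - fr (u a)) / (a - a2) + 1.
have k0 : 0 < k by rewrite ltr_wpDl// divr_ge0; lra.
have [t [t1 t2 H]] : exists t, [/\ a2 <= t, t < a & forall h, 0 < h <= a - t ->
    fr (u t) - fr (u (t + h)) <= k * h].
  apply: contrapT => N.
  have : ((fun r => fr (u r)) \+ (fun r => k * r)) a <= ((fun r => fr (u r)) \+ (fun r => k * r)) a2.
    apply: nonincreasing_of_steps; first exact: ltW.
    - move=> t /andP[t1 t2]; apply: left_lscD.
        by apply: flow_left_lsc => //; exact: lt_trans t1.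
      exact: is_derive_left_lsc (is_derive_linear k t).
    - move=> t e /andP[t1 t2] e0; apply: contrapT => M; apply: N; exists t; split => // h hh.
      rewrite leNgt; apply/negP => L; apply: M; exists h => //=.
      by have : 0 <= e * h; [case/andP: hh => h0 _; rewrite mulr_ge0// ltW|lra].
  rewrite /= => K; have : k * (a - a2) = fr (u a2) - fr (u a) + (a - a2).
    by rewrite /k; field; rewrite subr_eq0 gt_eqF.
  lra.
have t0 : 0 < t by exact: lt_le_trans t1.
exists t, (expR (`|lam| * a) * (1 + 2 * k)), (a - t); split.
- by rewrite t0.
- by rewrite mulr_ge0 ?expR_ge0// addr_ge0// mulr_ge0// ltW.
- by rewrite subr_gt0.
move=> h /andP[h0 ha].
have := @speed_le_energy u t k (a - t) uf (ltW t0) (ef_dom uf t0) (ltW k0) H h.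
rewrite h0 (ltW ha) => /(_ isT) L.
apply: sqr_le_of_le; [exact: mdist_ge0| |]; last first.
  by rewrite mulr_ge0 ?(ltW h0)// mulr_ge0 ?expR_ge0//; lra.
apply: le_trans L _; rewrite exprMn ler_wpM2r ?sqr_ge0//.
rewrite exprMn -expRM_natl mulrC ler_pM ?expR_ge0 ?(ltW k0)//.
  rewrite ler_expR -mulrA ler_wpM2l// ler_wpM2l//; lra.
have : 0 <= k * k by apply: mulr_ge0; exact: ltW.
by rewrite expr2; lra.
Qed.

(** By the triangle inequality the distance to [y] falls by at most [c * h], while the Dini
    inequality forces a fall governed by the energy gap. Speed bounds along a sequence of times
    suffice, which is what the arguments by contradiction below provide. *)
Lemma global_slope_le_speed u s c : evi_flow u -> 0 <= s -> domain phi (u s) -> 0 <= c ->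
  (forall d, 0 < d -> exists2 h, 0 < h < d & mdist (u (s + h)) (u s) <= c * h) ->
  (gs (u s) <= c%:E)%E.
Proof.
move=> uf s0 ds c0 H; apply/(global_slope_leP ds c0) => y dy.
rewrite leNgt; apply/negP => N.
set x := u s in N *; set D := mdist x y in N *.
pose e := fr x - fr y + lam / 2 * D ^+ 2 - c * D.
have e0 : 0 < e by rewrite /e; lra.
have /near0P[d d0 K] := flow_dini uf s0 ds dy e0.
have [h hd Hh] := H d d0.
have := K h hd; have h0 : 0 < h by case/andP: hd.
rewrite -/x -/D => K1.
have D0 : 0 <= D by exact: mdist_ge0.
have tr : D <= mdist (u (s + h)) y + c * h.
  by have := metric_triangle x (u (s + h)) y; rewrite (metric_sym x (u _)) -/D; lra.
set D' := mdist (u (s + h)) y in K1 tr.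
have D'0 : 0 <= D' by exact: mdist_ge0.
have ch0 : 0 <= c * h by rewrite mulr_ge0// ltW.
have K2 : D ^+ 2 - 2 * D * (c * h) <= D' ^+ 2.
  have [Dc|Dc] := leP D (c * h).
    apply: (@le_trans _ _ 0); last exact: sqr_ge0.
    have : D * D <= D * (c * h) by rewrite ler_wpM2l.
    have : 0 <= D * (c * h) by rewrite mulr_ge0.
    by rewrite expr2; lra.
  have : (D - c * h) ^+ 2 <= D' ^+ 2 by rewrite lerXn2r ?nnegrE//; lra.
  have := sqr_ge0 (c * h); rewrite sqrrB; lra.
have : (- (2 * D * c)) * h <= (2 * (fr y - fr x) - lam * D ^+ 2 + e) * h by lra.
by rewrite ler_pM2r// /e; lra.
Qed.

(* With m the supremum of the quotients d(u_{s+h}, u_s) / h, the energy drop is at most c' m h, so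
   that [speed_le_energy] gives m^2 <= c' m up to a factor close to 1. *)
Lemma slope_speed u s c : evi_flow u -> 0 <= s -> (slope phi (u s) < c%:E)%E ->
  \forall h \near 0^'+, mdist (u (s + h)) (u s) <= c * h /\
                       fr (u s) - fr (u (s + h)) <= c ^+ 2 * h.
Proof.
move=> uf s0 sc.
have ds : domain phi (u s) by apply: (@slope_wrt_dom mdiste); exact: lt_trans sc (ltry _).
have [c' sc' c'c] : exists2 c', (slope phi (u s) < c'%:E)%E & c' < c.
  move: sc (slope_ge0 (u s)); case: (slope phi (u s)) => [r| |]//.
  by rewrite lte_fin => rc _; exists ((r + c) / 2); rewrite ?lte_fin; lra.
have c'0 : 0 < c' by have := le_lt_trans (slope_ge0 (u s)) sc'; rewrite lte_fin.
have c0 : 0 < c by exact: lt_trans c'c.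
have [r r0 Hr] := slope_near sc'.
have [d1 d10 Hd1] := ef_cont uf s0 r0.
(* The exponential loss of [speed_le_energy] has to fit between [c'] and [c]. *)
have [d2 d20 Kd2] := @near_expR_lt R (2 * `|lam|) (c / c') (ltac:(by rewrite ltr_pdivlMr// mul1r)).
pose d := Num.min (d1 / 2) d2.
have d0 : 0 < d by rewrite lt_min divr_gt0.
pose K := expR (2 * `|lam| * d).
have K0 : 0 < K by exact: expR_gt0.
have Kc : c' * K <= c.
  rewrite mulrC -ler_pdivlMr// (le_trans _ (ltW Kd2))// ler_expR ler_wpM2l ?mulr_ge0//.
  by rewrite ge_min lexx orbT.
pose D h := mdist (u (s + h)) (u s).
have En h : 0 < h <= d -> fr (u s) - fr (u (s + h)) <= c' * D h.
  move=> /andP[h0 hd]; apply: Hr; last by apply: (ef_dom uf); exact: ltr_wpDl.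
  apply: Hd1; first by rewrite addr_ge0// ltW.
  rewrite addrAC subrr add0r gtr0_norm// (le_lt_trans hd)//.
  by apply: (@le_lt_trans _ _ (d1 / 2)); [rewrite ge_min lexx|lra].
have KK h : 0 < h <= d -> expR (2 * `|lam| * h) <= K.
  by move=> /andP[h0 hd]; rewrite ler_expR ler_wpM2l ?mulr_ge0.
have Dq m : 0 <= m -> (forall h, 0 < h <= d -> D h <= m * h) ->
    forall h, 0 < h <= d -> (D h / h) ^+ 2 <= c' * m * K.
  move=> m0 Dm h hd; have h0 : 0 < h by case/andP: hd.
  rewrite expr_div_n ler_pdivrMr ?exprn_gt0//.
  have cm0 : 0 <= c' * m by rewrite mulr_ge0// ltW.
  have := @speed_le_energy u s (c' * m) d uf s0 ds cm0 _ h hd.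
  move=> /(_ _)/le_trans; apply.
    by move=> h' hd'; apply: le_trans (En h' hd') _; rewrite -mulrA ler_pM2l// Dm.
  by rewrite ler_wpM2r ?sqr_ge0// ler_wpM2l// KK.
pose A := [set D h / h | h in [set h | 0 < h <= d]].
have A0 : A !=set0 by exists (D d / d); exists d; rewrite //= d0 lexx.
(* The integrated inequality gives a first bound, off by a factor 2, which makes the supremum
   finite. *)
have Aub : has_ubound A.
  exists (2 * c' * K) => _ [h hd <-]; have h0 : 0 < h by case/andP: hd.
  rewrite ler_pdivrMr//.
  have [D0|D0] := eqVneq (D h) 0; first by rewrite D0 !mulr_ge0// ltW.
  have {}D0 : 0 < D h by rewrite lt_neqAle eq_sym D0 mdist_ge0.
  have sh : s <= s + h by rewrite lerDl ltW.
  have := ef_evi uf s0 sh ds; rewrite mdistxx expr0n/= subr0 addrAC subrr add0r -/(D h) => I.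
  have I1 : Efun lam h * (fr (u s) - fr (u (s + h))) <= expR (`|lam| * h) * h * (c' * D h).
    apply: (@le_trans _ _ (Efun lam h * (c' * D h))).
      by rewrite ler_pM2l ?Efun_gt0// En.
    by rewrite ler_wpM2r ?mulr_ge0 ?(ltW D0) ?(ltW c'0)// Efun_ub// ltW.
  have I2 : expR (- (`|lam| * h)) * D h ^+ 2 <= 2 * (expR (`|lam| * h) * h * (c' * D h)).
    apply: (@le_trans _ _ (expR (lam * h) * D h ^+ 2)).
      by rewrite ler_wpM2r ?sqr_ge0// expR_abs_lb// ltW.
    lra.
  have I3 : expR (`|lam| * h) * (expR (- (`|lam| * h)) * D h ^+ 2) <=
      expR (`|lam| * h) * (2 * (expR (`|lam| * h) * h * (c' * D h))).
    by rewrite ler_pM2l ?expR_gt0.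
  rewrite mulrA -expRD subrr expR0 mul1r expr2 in I3.
  have I4 : D h * D h <= (2 * c' * (expR (`|lam| * h) * expR (`|lam| * h)) * h) * D h by lra.
  rewrite ler_pM2r// in I4; apply: le_trans I4 _; rewrite ler_pM2r// ler_pM2l ?mulr_gt0//.
  by rewrite -expRD (_ : _ + _ = 2 * `|lam| * h) ?KK//; ring.
pose m := sup A.
have Dm h : 0 < h <= d -> D h <= m * h.
  move=> hd; have h0 : 0 < h by case/andP: hd.
  by rewrite -ler_pdivrMr//; apply: ub_le_sup => //; exists h.
have m0 : 0 <= m.
  have := Dm d; rewrite d0 lexx => /(_ isT) /(le_trans (mdist_ge0 _ _)).
  by rewrite pmulr_lge0.
have mK : m <= c' * K.
  have [//|N] := leP m (c' * K).
  have : m <= Num.sqrt (c' * m * K).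
    apply: ge_sup => // _ [h hd <-].
    rewrite -(@ger0_norm _ (D h / h)); last first.
      by rewrite divr_ge0 ?mdist_ge0//; case/andP: hd => /ltW.
    by rewrite -sqrtr_sqr ler_wsqrtr//; exact: Dq.
  move=> M; have : m ^+ 2 <= c' * m * K.
    rewrite -[leRHS]sqr_sqrtr; last by rewrite !mulr_ge0// ltW.
    by rewrite lerXn2r ?nnegrE// sqrtr_ge0.
  have mp : 0 < m by apply: lt_trans N; rewrite mulr_gt0.
  by rewrite expr2 mulrAC ler_pM2r// leNgt N.
apply/near0P; exists d => // h /andP[h0 /ltW hd].
have hh : 0 < h <= d by rewrite h0.
have D1 : D h <= c * h.
  by apply: le_trans (Dm h hh) _; rewrite ler_pM2r// (le_trans mK).
split => //; apply: le_trans (En h hh) _.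
by rewrite expr2 -mulrA; apply: ler_pM => //; [exact: ltW|exact: mdist_ge0|exact: ltW].
Qed.

Lemma global_slope_eq_slope u s : evi_flow u -> 0 <= s -> gs (u s) = slope phi (u s).
Proof.
move=> uf s0; apply/eqP; rewrite eq_le slope_le_global// andbT.
have := slope_ge0 (u s); case E : (slope phi (u s)) => [r| |]; [|by move=> _; rewrite leey|by []].
rewrite lee_fin => r0; apply/lee_addgt0Pr => e e0.
have ds : domain phi (u s) by apply: (@slope_wrt_dom mdiste); rewrite -/(slope _ _) E ltry.
apply: global_slope_le_speed => //; first by rewrite addr_ge0// ltW.
move=> d d0; have /near0P[d' d'0 H] : \forall h \near 0^'+, mdist (u (s + h)) (u s) <= (r + e) * h.
  have : (slope phi (u s) < (r + e)%:E)%E by rewrite E lte_fin ltrDl.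
  by move=> /(slope_speed uf s0); apply: filterS => h [].
have [h hd hd'] := exists_lt2 d0 d'0.
by exists h => //; exact: H.
Qed.

Lemma global_slope_decay u s t c : evi_flow u -> 0 <= s -> s <= t -> (gs (u s) <= c%:E)%E ->
  (gs (u t) <= (expR (- lam * (t - s)) * c)%:E)%E.
Proof.
move=> uf s0 st gc; have ds : domain phi (u s).
  by apply: global_slope_dom; exact: le_lt_trans gc (ltry _).
have dt := flow_domS uf s0 ds st.
have c0 : 0 <= c by rewrite -lee_fin; exact: le_trans (global_slope_ge0 (u s)) gc.
apply/lee_addgt0Pr => e e0.
pose k := expR (- lam * (t - s)); have k0 : 0 < k by exact: expR_gt0.
have -> : ((k * c)%:E + e%:E)%E = (k * (c + e / k))%:E.
  by rewrite -EFinD; congr EFin; field; rewrite gt_eqF.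
have ck0 : 0 <= c + e / k by rewrite addr_ge0// divr_ge0// ltW.
apply: global_slope_le_speed => //; [exact: le_trans st|by rewrite mulr_ge0// ltW|].
have : (slope phi (u s) < (c + e / k)%:E)%E.
  by rewrite -global_slope_eq_slope//; apply: le_lt_trans gc _; rewrite lte_fin ltrDl divr_gt0.
move=> /(slope_speed uf s0)/near0P[d d0 H] d' d'0.
have [h hd hd'] := exists_lt2 d0 d'0.
have h0 : 0 < h by case/andP: hd.
exists h => //.
have [H1 _] := H h hd.
rewrite -mulrA; apply: (@le_trans _ _ (k * mdist (u (s + h)) (u s))); last by rewrite ler_pM2l.
have := flow_contraction (evi_flow_shift (ltW h0) uf) uf s0 st.
by rewrite (addrC h t) (addrC h s).
Qed.

(** Some earlier time has finite speed, hence finite global slope, and the decay carries this on to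
    [t]. *)
Lemma global_slope_fin u t : evi_flow u -> 0 < t -> (gs (u t) < +oo)%E.
Proof.
move=> uf t0; have [s [K [d [/andP[s0 st] K0 d0 H]]]] := flow_lipschitz_time uf t0.
have : (gs (u s) <= K%:E)%E.
  apply: global_slope_le_speed => //; [exact: ltW|exact: ef_dom uf _ s0|].
  move=> d' d'0; have [h hd hd'] := exists_lt2 d0 d'0.
  by exists h => //; exact: H.
by move=> /(global_slope_decay uf (ltW s0) (ltW st))/le_lt_trans; apply; exact: ltry.
Qed.

Lemma flow_slope_lsc u t c : evi_flow u -> 0 <= t -> (c%:E < gs (u t))%E ->
  exists2 d, 0 < d & forall s, 0 <= s -> `|s - t| < d -> (c%:E < gs (u s))%E.
Proof.
move=> uf t0 cg.
have [r r0 H] := global_slope_lsc (flow_proper uf) cg.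
have [d d0 K] := ef_cont uf t0 r0.
by exists d => // s s0 sd; apply: H; exact: K.
Qed.

(** Otherwise, from some time [t], every step would drop the energy at a rate below some [c1 ^+ 2]
    with [c1 < c]; [speed_le_energy] would bound the speed by [c1] in the limit, and
    [global_slope_le_speed] the global slope at [t]. *)
Lemma energy_drop_ge u a b c : evi_flow u -> 0 <= a -> a <= b -> domain phi (u a) -> 0 <= c ->
  (forall t, a < t < b -> (c%:E <= gs (u t))%E) -> c ^+ 2 * (b - a) <= fr (u a) - fr (u b).
Proof.
move=> uf a0 ab da c0 H.
have fab : fr (u b) <= fr (u a) by exact: flow_nonincreasing uf _ _ _.
have [->|/eqP cn0] := eqVneq c 0; first by rewrite expr0n/= mul0r subr_ge0.
have {cn0}c0 : 0 < c by rewrite lt_neqAle c0 andbT eq_sym; exact/eqP.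
have c20 : 0 < c ^+ 2 by rewrite exprn_gt0.
move: ab; rewrite le_eqVlt => /predU1P[<-|ab]; first by rewrite !subrr mulr0.
apply/ler_addgt0Pr => e e0.
(* The slope is bounded below on the open interval, so the argument starts after [a]; the part cut
   off costs at most [e]. *)
have [s [as_ sb se]] : exists s, [/\ a < s, s < b & c ^+ 2 * (s - a) <= e].
  have ec : 0 < e / c ^+ 2 by rewrite divr_gt0.
  have ba : 0 < b - a by rewrite subr_gt0.
  have [h /andP[h0 h1] /andP[_ h2]] := exists_lt2 ec ba.
  exists (a + h); split; [lra|lra|].
  by rewrite addrAC subrr add0r mulrC -ler_pdivlMr// ltW.
have s0 : 0 < s by exact: le_lt_trans as_.
have : ((fun r => fr (u r)) \+ (fun r => c ^+ 2 * r)) b <= ((fun r => fr (u r)) \+ (fun r => c ^+ 2 * r)) s.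
  apply: nonincreasing_of_steps; first exact: ltW.
  - move=> t /andP[st tb]; apply: left_lscD.
      by apply: flow_left_lsc uf _; exact: lt_trans st.
    exact: is_derive_left_lsc (is_derive_linear _ t).
  - move=> t e1 /andP[st tb] e10.
    have t0 : 0 < t by exact: lt_le_trans st.
    have dt := ef_dom uf t0.
    have /H ct : a < t < b by rewrite tb (lt_le_trans as_).
    (* Chosen with [c1 < c] and [c1 ^+ 2 >= c ^+ 2 - e1]. *)
    pose c1 := Num.max 0 (c - e1 / (2 * c)).
    have c1c : c1 < c by rewrite gt_max c0/= ltrBlDr ltrDl divr_gt0// mulr_gt0.
    have c10 : 0 <= c1 by rewrite le_max lexx.
    have c1e : c ^+ 2 - e1 <= c1 ^+ 2.
      have c1' : c - e1 / (2 * c) <= c1 by rewrite le_max lexx orbT.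
      have : c * (c - e1 / (2 * c)) <= c * c1 by rewrite ler_pM2l.
      have -> : c * (c - e1 / (2 * c)) = c ^+ 2 - e1 / 2 by field; rewrite gt_eqF.
      have := sqr_ge0 (c - c1); rewrite sqrrB; lra.
    have ct1 : (c1%:E < gs (u t))%E by apply: lt_le_trans ct; rewrite lte_fin.
    apply: contrapT => N; move: ct1; apply/negP; rewrite -leNgt.
    apply/lee_addgt0Pr => e2 e20.
    pose k := c1 ^+ 2.
    have K h : 0 < h <= b - t -> fr (u t) - fr (u (t + h)) <= k * h.
      move=> hh; rewrite leNgt; apply/negP => L; apply: N; exists h => //=.
      have h0 : 0 < h by case/andP: hh.
      have : (c ^+ 2 - e1) * h <= k * h by rewrite ler_pM2r.
      lra.
    apply: (global_slope_le_speed uf) => //; [exact: ltW|by rewrite addr_ge0// ltW|].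
    (* If [c1 = 0] the curve stands still; otherwise the exponential loss is compared with the ratio
       [(c1 + e2) / c1]. *)
    have [c1z|c1p] := eqVneq c1 0.
      move=> d d0; have bt : 0 < b - t by rewrite subr_gt0.
      have [h /andP[h0 h1] hd] := exists_lt2 bt d0; exists h => //.
      have := speed_le_energy uf (ltW t0) dt (sqr_ge0 c1) K (h := h).
      rewrite h0 (ltW h1) => /(_ isT).
      rewrite c1z expr0n/= !mul0r => M.
      rewrite add0r (@le_trans _ _ 0)//; last by rewrite mulr_ge0// ltW.
      by apply: sqr_le_of_le => //; [exact: mdist_ge0|rewrite expr0n].
    have {}c1p : 0 < c1 by rewrite lt_neqAle eq_sym c1p.
    have r1 : 1 < (c1 + e2) / c1 by rewrite ltr_pdivlMr// mul1r ltrDl.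
    have [d2 d20 Hd2] := near_expR_lt (`|lam|) r1.
    move=> d d0; have bt : 0 < Num.min (b - t) d2 by rewrite lt_min subr_gt0 tb.
    have [h /andP[h0 h1] hd] := exists_lt2 bt d0; exists h => //.
    move: h1; rewrite lt_min => /andP[h1 h2].
    have := speed_le_energy uf (ltW t0) dt (sqr_ge0 c1) K (h := h).
    rewrite h0 (ltW h1) => /(_ isT) M.
    apply: sqr_le_of_le; [exact: mdist_ge0| |]; last first.
      by rewrite mulr_ge0 ?(ltW h0)// addr_ge0// ltW.
    apply: le_trans M _; rewrite exprMn ler_wpM2r ?sqr_ge0//.
    rewrite -mulrA expRM_natl -exprMn lerXn2r ?nnegrE ?mulr_ge0 ?expR_ge0 ?addr_ge0 ?(ltW e20)//.
    rewrite mulrC -ler_pdivlMr// (le_trans _ (ltW Hd2))// ler_expR.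
    by apply: ler_wpM2l => //; exact: ltW.
rewrite /= => K; have : fr (u s) <= fr (u a) by apply: (flow_nonincreasing uf) => //; exact: ltW.
have -> : c ^+ 2 * (b - a) = c ^+ 2 * b - c ^+ 2 * s + c ^+ 2 * (s - a) by ring.
lra.
Qed.

Lemma flow_dist_cvg_left u t y : evi_flow u -> 0 < t -> mdist (u s) y @[s --> t^'-] --> mdist (u t) y.
Proof.
move=> uf t0; apply: curve0_cvg; [exact: ef_cont uf|exact: ltW|exact: cvg_at_left|].
by apply: filterS (nbhs_left_gt t0) => ? /ltW.
Qed.

Lemma flow_dist_cvg_right u t y : evi_flow u -> 0 <= t -> mdist (u s) y @[s --> t^'+] --> mdist (u t) y.
Proof.
move=> uf t0; apply: curve0_cvg; [exact: ef_cont uf|by []|exact: cvg_at_right|].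
by apply: filterS (nbhs_right_gt t) => ? /(le_lt_trans t0)/ltW.
Qed.

Lemma flow_dist_dini u t y g : evi_flow u -> 0 <= t -> (gs (u t) <= g%:E)%E ->
  dini_le (fun s => mdist (u s) y) t g.
Proof.
move=> uf t0 gE e e0.
have : (slope phi (u t) < (g + e)%:E)%E.
  by rewrite -(global_slope_eq_slope uf t0); apply: le_lt_trans gE _; rewrite lte_fin ltrDl.
move=> /(slope_speed uf t0); apply: filterS => h [h1 _].
by have := metric_triangle (u (t + h)) (u t) y; lra.
Qed.

Lemma flow_dist_le u a b c : evi_flow u -> 0 <= a -> a <= b ->
  (forall t, a < t < b -> (gs (u t) <= c%:E)%E) -> mdist (u b) (u a) <= c * (b - a).
Proof.
move=> uf a0 ab H.
have I1 : dini_on (fun s => mdist (u s) (u a)) a b (fun=> c).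
  apply: dini_on_cvg.
  - by move=> t /andP[at_ _]; exact: (flow_dist_cvg_left uf (le_lt_trans a0 at_)).
  - exact: (flow_dist_cvg_right uf a0).
  - move=> t tab; apply: (flow_dist_dini _ uf _ (H t tab)).
    by case/andP: tab => /ltW at_ _; exact: le_trans at_.
have I2 := is_derive_dini_on ab (fun s (_ : a <= s <= b) => is_derive_linear (- c) s).
have := dini_on_nonincreasing ab (dini_onD I1 I2).
rewrite metric_sym mdistxx => H1.
suff : forall s, a < s < b -> c + - c <= 0 by move=> /H1; rewrite metric_sym; lra.
by move=> s _; rewrite subrr.
Qed.

Lemma energy_le_slope x y c : (gs x <= c%:E)%E -> domain phi y ->
  fr x - fr y <= c * mdist x y + `|lam| / 2 * mdist x y ^+ 2.
Proof.
move=> gc dy.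
have dx : domain phi x by apply: global_slope_dom; exact: le_lt_trans gc (ltry _).
have c0 : 0 <= c by rewrite -lee_fin; exact: le_trans (global_slope_ge0 x) gc.
have := (global_slope_leP dx c0).1 gc y dy.
have : - lam / 2 * mdist x y ^+ 2 <= `|lam| / 2 * mdist x y ^+ 2.
  by rewrite ler_wpM2r ?sqr_ge0// ler_pM2r ?invr_gt0// -normrN ler_norm.
lra.
Qed.

Lemma flow_slope_bound u a : evi_flow u -> 0 < a -> exists2 c, 0 < c &
  (gs (u a) <= c%:E)%E.
Proof.
move=> uf a0; have := global_slope_fin uf a0.
have := global_slope_ge0 (u a); case: (gs (u a)) => [r| |]// r0 _.
by exists (r + 1); rewrite ?lee_fin; rewrite lee_fin in r0; lra.
Qed.

Lemma flow_slope_bound_itv u a b : evi_flow u -> 0 < a -> exists2 c, 0 < c &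
  forall t, a <= t <= b -> (gs (u t) <= c%:E)%E.
Proof.
move=> uf a0; have [c c0 H] := flow_slope_bound uf a0.
exists (expR (`|lam| * (b - a)) * c) => [|t /andP[at_ tb]]; first by rewrite mulr_gt0 ?expR_gt0.
apply: le_trans (global_slope_decay uf (ltW a0) at_ H) _.
rewrite lee_fin ler_pM2r// (@le_trans _ _ (expR (`|lam| * (t - a))))//.
  by rewrite -normrN expR_abs_ub// subr_ge0.
by rewrite ler_expR ler_wpM2l//; lra.
Qed.

(** Lower semicontinuity does not exclude a downward jump on reaching [t]. Here the global slope,
    bounded on the second half of the interval up to [t], controls the energy excess at [s] by the
    distance from [u s] to [u t]. *)
Lemma flow_energy_left u t e : evi_flow u -> 0 < t -> 0 < e ->
  \forall s \near t^'-, fr (u s) <= fr (u t) + e.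
Proof.
move=> uf t0 e0; have t20 : 0 < t / 2 by rewrite divr_gt0.
have [c c0 H] := flow_slope_bound_itv t uf t20.
pose k := c + `|lam| / 2; have k0 : 0 < k by rewrite ltr_pwDl// divr_ge0.
(* A distance below 1 dominates its square, so [k] controls the linear and the quadratic term
   together. *)
have m0 : 0 < Num.min 1 (e / k) by rewrite lt_min divr_gt0// ltr01.
have [d d0 K] := ef_cont uf (ltW t0) m0.
apply/near_leftP; exists (Num.min d (t / 2)); first by rewrite lt_min d0.
have m1 : Num.min d (t / 2) <= d by rewrite ge_min lexx.
have m2 : Num.min d (t / 2) <= t / 2 by rewrite ge_min lexx orbT.
move=> s /andP[s1 s2].
have s0 : 0 < s by lra.
have gsc : (gs (u s) <= c%:E)%E by apply: H; apply/andP; split; lra.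
have := energy_le_slope gsc (ef_dom uf t0).
have := K s (ltW s0) _; rewrite lt_min => /(_ _)/wrap[|/andP[D1 D2]].
  by rewrite ltr_norml; apply/andP; split; lra.
have D0 := mdist_ge0 (u s) (u t); set D := mdist (u s) (u t) in D0 D1 D2 *.
have : `|lam| / 2 * D ^+ 2 <= `|lam| / 2 * D.
  by rewrite ler_wpM2l ?divr_ge0// expr2 -[leRHS]mulr1 ler_wpM2l// ltW.
have : k * D <= e by rewrite mulrC -ler_pdivlMr// ltW.
rewrite /k; lra.
Qed.

Lemma flow_energy_cvg_right u t : evi_flow u -> 0 <= t -> domain phi (u t) ->
  fr (u s) @[s --> t^'+] --> fr (u t).
Proof.
move=> uf t0 dt; apply/cvgrPdist_le => e e0.
have /near0P[d d0 H] := flow_energy_right uf t0 dt e0.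
apply/near_rightP; exists d => // s /andP[s1 s2].
have := H (s - t); rewrite subrKC => /(_ _)/wrap[|]; first by apply/andP; split; lra.
have := flow_nonincreasing uf t0 dt (ltW s1).
by rewrite ler_norml => ? ?; apply/andP; split; lra.
Qed.

Lemma flow_energy_cvg_left u t : evi_flow u -> 0 < t -> fr (u s) @[s --> t^'-] --> fr (u t).
Proof.
move=> uf t0; apply/cvgrPdist_le => e e0.
apply: filterS2 (nbhs_left_gt t0) (filterI (flow_energy_left uf t0 e0) (nbhs_left_lt t)) => s s0 [/= H st].
have := flow_nonincreasing uf (ltW s0) (ef_dom uf s0) (ltW st).
by rewrite ler_norml => ?; apply/andP; split; lra.
Qed.

Lemma flow_slope_fine u t : evi_flow u -> 0 < t -> exists2 g, 0 <= g & gs (u t) = g%:E.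
Proof.
move=> uf t0; have := global_slope_fin uf t0.
by have := global_slope_ge0 (u t); case: (gs (u t)) => [g| |]// g0 _; exists g.
Qed.

Lemma energy_drop_le u a b c : evi_flow u -> 0 <= a -> a <= b -> domain phi (u a) ->
  (forall t, a < t < b -> (gs (u t) <= c%:E)%E) -> fr (u a) - fr (u b) <= c ^+ 2 * (b - a).
Proof.
move=> uf a0 ab da H.
have : ((fun r => - fr (u r)) \+ (fun r => - c ^+ 2 * r)) b <=
       ((fun r => - fr (u r)) \+ (fun r => - c ^+ 2 * r)) a.
  apply: dini_le_nonincreasing => //.
  - move=> t /andP[at_ tb]; have t0 : 0 < t by exact: le_lt_trans at_.
    apply: left_lscD; last exact: is_derive_left_lsc (is_derive_linear _ t).
    by move=> e e0; apply: filterS (flow_energy_left uf t0 e0) => s; lra.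
  - apply: right_uscD; last exact: is_derive_right_usc (is_derive_linear _ a).
    move=> e e0; have /near0P[d d0 K] := flow_energy_right uf a0 da e0.
    apply/near_rightP; exists d => // s /andP[s1 s2].
    have := K (s - a); rewrite subrKC => /(_ _)/wrap[|]; first by apply/andP; split; lra.
    lra.
  - move=> t /andP[at_ tb]; have t0 : 0 < t by exact: le_lt_trans at_.
    rewrite -(subrr (c ^+ 2)); apply: dini_leD; last exact: is_derive_dini_le (is_derive_linear _ t).
    have gc : (gs (u t) <= c%:E)%E by apply: H; rewrite at_.
    have c0 : 0 <= c by rewrite -lee_fin; exact: le_trans (global_slope_ge0 (u t)) gc.
    (* Chosen so that [(c + e1) ^+ 2 <= c ^+ 2 + e]. *)
    move=> e e0; pose e1 := Num.min 1 (e / (2 * c + 1)).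
    have c1 : 0 < 2 * c + 1 by lra.
    have e10 : 0 < e1 by rewrite lt_min ltr01 divr_gt0.
    have e1e : (2 * c + 1) * e1 <= e.
      by rewrite mulrC -ler_pdivlMr// ge_min lexx orbT.
    have e11 : e1 <= 1 by rewrite ge_min lexx.
    have : (slope phi (u t) < (c + e1)%:E)%E.
      rewrite -(global_slope_eq_slope uf (ltW t0)).
      by apply: le_lt_trans gc _; rewrite lte_fin ltrDl.
    move=> /(slope_speed uf (ltW t0)) K.
    apply: filterS2 (nbhs_right_gt 0) K => h h0 [_ h1].
    have : (c + e1) ^+ 2 * h <= (c ^+ 2 + e) * h.
      rewrite ler_pM2r// sqrrD.
      have : e1 * e1 <= e1 * 1 by rewrite ler_pM2l.
      by rewrite expr2; lra.
    lra.
rewrite /=; lra.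
Qed.

Lemma energy_right_gt u t c : evi_flow u -> 0 <= t -> domain phi (u t) -> 0 <= c ->
  (c%:E < gs (u t))%E -> \forall h \near 0^'+, c ^+ 2 * h <= fr (u t) - fr (u (t + h)).
Proof.
move=> uf t0 dt c0 cg; have [d d0 H] := flow_slope_lsc uf t0 cg.
apply/near0P; exists d => // h /andP[h0 hd].
have := @energy_drop_ge u t (t + h) c uf t0 _ dt c0; rewrite addrAC subrr add0r; apply.
  by rewrite lerDl ltW.
move=> s /andP[s1 s2]; apply/ltW/H; first by apply: le_trans t0 _; exact: ltW.
by rewrite ltr_norml; apply/andP; split; lra.
Qed.

(** Below, the slope is lower semicontinuous; above, its decay bounds it by its value at [t] times a
    factor tending to 1. An infinite value at [t] is allowed. *)
Lemma flow_slope_right_cvg u t : evi_flow u -> 0 <= t -> gs (u s) @[s --> t^'+] --> gs (u t).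
Proof.
move=> uf t0; apply: cvge_of_bounds.
- move=> c cg; have [d d0 H] := flow_slope_lsc uf t0 cg.
  apply/near_rightP; exists d => // s /andP[s1 s2]; apply: H.
    by apply: le_trans t0 _; exact: ltW.
  by rewrite ltr_norml; apply/andP; split; lra.
- move=> c; have := global_slope_ge0 (u t).
  case E : (gs (u t)) => [r| |]//; rewrite lee_fin lte_fin => r0 rc.
  have [c' [r'c c'c c'0]] : exists c', [/\ r < c', c' < c & 0 < c'].
    by exists ((r + c) / 2); split; lra.
  have c1 : 1 < c / c' by rewrite ltr_pdivlMr// mul1r.
  have [d d0 H] := near_expR_lt (`|lam|) c1.
  apply/near_rightP; exists d => // s /andP[s1 s2].
  have gr : (gs (u t) <= c'%:E)%E by rewrite E lee_fin ltW.
  apply: le_lt_trans (global_slope_decay uf t0 (ltW s1) gr) _.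
  rewrite lte_fin -ltr_pdivlMr//; apply: le_lt_trans H.
  have st : 0 <= s - t by rewrite subr_ge0 ltW.
  apply: le_trans (expR_abs_ub _ st) _.
  by rewrite normrN ler_expR ler_wpM2l//; lra.
Qed.

(** The weighted slope [P] is nonincreasing, so its left limit is its infimum over the earlier
    positive times. *)
Lemma flow_slope_left_cvg u t : evi_flow u -> 0 < t -> exists L, [/\ 0 <= L,
  (gs (u t) <= L%:E)%E & gs (u s) @[s --> t^'-] --> L%:E].
Proof.
move=> uf t0; pose g s := fine (gs (u s)).
have gE s : 0 < s -> gs (u s) = (g s)%:E.
  move=> s0; rewrite fineK// fin_real// (global_slope_fin uf s0) andbT.
  by apply: lt_le_trans (global_slope_ge0 (u s)); rewrite ltNyr.
have g0 s : 0 <= g s by apply: fine_ge0; exact: global_slope_ge0.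
pose P s := expR (lam * s) * g s.
have Pdec r s : 0 < r -> r <= s -> P s <= P r.
  move=> r0 rs; have s0 : 0 < s by exact: lt_le_trans rs.
  have : (gs (u r) <= (g r)%:E)%E by rewrite gE.
  move=> /(global_slope_decay uf (ltW r0) rs).
  rewrite gE// lee_fin => K; rewrite /P.
  have -> : expR (lam * r) = expR (lam * s) * expR (- lam * (s - r)).
    by rewrite -expRD; congr expR; ring.
  by rewrite -mulrA ler_pM2l ?expR_gt0.
pose A := [set P s | s in [set s | 0 < s < t]].
have At : lbound A (P t) by move=> _ [s /andP[s0 st] <-]; apply: Pdec => //; exact: ltW.
have A0 : A !=set0 by exists (P (t / 2)); exists (t / 2) => //=; apply/andP; split; lra.
have Alb : has_lbound A by exists (P t).
pose m := inf A.
have Pm : P t <= m by exact: lb_le_inf.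
have m0 : 0 <= m by apply: le_trans Pm; rewrite mulr_ge0 ?expR_ge0.
have Pl : P s @[s --> t^'-] --> m.
  apply/cvgrPdist_le => e e0.
  have [_ [s /andP[s0 st] <-] Ps] := inf_adherent e0 (conj A0 Alb).
  apply/near_leftP; exists (t - s); first by rewrite subr_gt0.
  move=> r /andP[r1 r2]; have sr : s <= r by lra.
  have := Pdec s r s0 sr.
  have : m <= P r by apply: ge_inf => //; exists r => //=; rewrite r2 andbT (lt_le_trans s0).
  by rewrite ler_norml => ? ?; apply/andP; split; lra.
exists (expR (- lam * t) * m); split.
- by rewrite mulr_ge0 ?expR_ge0.
- rewrite gE// lee_fin -(ler_pM2l (expR_gt0 (lam * t))) -/(P t).
  by rewrite mulrA expRlN mul1r.
- have : expR (- lam * s) * P s @[s --> t^'-] --> expR (- lam * t) * m.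
    apply: cvgM => //; apply: cvg_at_left_filter; exact: continuous_expRl.
  move=> H; apply: (@cvg_trans _ ((expR (- lam * s) * P s)%:E @[s --> t^'-])).
    apply: near_eq_cvg; apply: filterS (nbhs_left_gt t0) => s s0.
    by rewrite /P mulrA (mulrC (expR (- lam * s))) expRlN mul1r gE.
  by apply: cvg_EFin; [exact: nearW|].
Qed.

(** * The slope with respect to the length distance *)

Lemma length_dist_gt0 x y : y != x -> (0 < length_dist x y)%E.
Proof.
move=> yx; apply: lt_le_trans (le_mdist_length_dist x y).
by rewrite lte_fin mdist_gt0 eq_sym.
Qed.

(** The length distance is the larger one: its balls are smaller and its quotients are smaller. *)
Lemma length_slope_le_slope x : (length_slope phi x <= slope phi x)%E.
Proof.
have := slope_ge0 x; case E : (slope phi x) => [r| |]; [|by move=> _; rewrite leey|by []].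
rewrite lee_fin => r0; apply/lee_addgt0Pr => e e0.
have dx : domain phi x by apply: (@slope_wrt_dom mdiste); rewrite -/(slope _ _) E ltry.
have : (slope phi x < (r + e)%:E)%E by rewrite E lte_fin ltrDl.
move=> /(slope_near)[d d0 H].
apply: slope_wrt_le => //; [exact: length_dist_gt0|by rewrite addr_ge0// ltW|].
exists d => // y yd dy; have le_d := le_mdist_length_dist x y.
apply: (@le_trans _ _ ((r + e) * mdist x y)%:E).
  rewrite lee_fin metric_sym; apply: H => //.
  by rewrite metric_sym -lte_fin; exact: le_lt_trans yd.
by rewrite EFinM lee_wpmul2l// lee_fin addr_ge0// ltW.
Qed.

Lemma flow_energy_dini u t g : evi_flow u -> 0 <= t -> domain phi (u t) -> gs (u t) = g%:E ->
  dini_le (fun s => fr (u s)) t (- g ^+ 2).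
Proof.
move=> uf t0 dt gE e e0.
have g0 : 0 <= g by rewrite -lee_fin -gE global_slope_ge0.
have le_h h : 0 < h -> fr (u (t + h)) - fr (u t) <= 0.
  by move=> h0; rewrite subr_le0; apply: (flow_nonincreasing uf) => //; rewrite lerDl ltW.
(* If [g ^+ 2 <= e], monotonicity is enough; otherwise the square root below is positive and less
   than [g]. *)
have [ge|ge] := leP (g ^+ 2) e.
  apply: filterS (nbhs_right_gt 0) => h h0; apply: le_trans (le_h h h0) _.
  by rewrite mulr_ge0//; [lra|exact: ltW].
pose c := Num.sqrt (g ^+ 2 - e).
have c2 : c ^+ 2 = g ^+ 2 - e by rewrite sqr_sqrtr// subr_ge0 ltW.
have c0 : 0 <= c by exact: sqrtr_ge0.
have cg : c < g.
  by rewrite -(@ltr_pXn2r _ 2)// ?nnegrE// c2; lra.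
have : (c%:E < gs (u t))%E by rewrite gE lte_fin.
move=> /(energy_right_gt uf t0 dt c0); apply: filterS => h.
by rewrite c2; lra.
Qed.

(** With slope [g] the distance grows at rate at most [g] and the energy falls at rate at least
    [g ^+ 2], which is at least [c * g]. *)
Lemma flow_dist_le_energy u a b c : evi_flow u -> 0 <= a -> a <= b -> domain phi (u a) -> 0 < c ->
  (forall t, a < t < b -> (c%:E <= gs (u t))%E) ->
  c * mdist (u b) (u a) <= fr (u a) - fr (u b).
Proof.
move=> uf a0 ab da c0 H; pose g s := fine (gs (u s)).
have gE s : 0 < s -> gs (u s) = (g s)%:E.
  by move=> /(flow_slope_fine uf)[q _ qE]; rewrite /g qE.
have pos t : a < t -> 0 < t by exact: le_lt_trans.
have I1 : dini_on (fun s => c * mdist (u s) (u a)) a b (fun s => c * g s).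
  apply: dini_on_cvg.
  - by move=> t /andP[/pos t0 _]; apply: cvgM; [exact: cvg_cst|exact: (flow_dist_cvg_left uf t0)].
  - by apply: cvgM; [exact: cvg_cst|exact: (flow_dist_cvg_right uf a0)].
  - move=> t /andP[/pos t0 _]; apply: dini_leZ; first exact: ltW.
    by apply: flow_dist_dini => //; [exact: ltW|rewrite gE].
have I2 : dini_on (fun s => fr (u s)) a b (fun s => - g s ^+ 2).
  apply: dini_on_cvg.
  - by move=> t /andP[/pos t0 _]; exact: flow_energy_cvg_left.
  - exact: flow_energy_cvg_right.
  - by move=> t /andP[/pos t0 _]; apply: (flow_energy_dini uf (ltW t0) (ef_dom uf t0)); exact: gE.
have := dini_on_nonincreasing ab (dini_onD I1 I2).
rewrite mdistxx mulr0 add0r => K.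
suff : forall t, a < t < b -> c * g t + - g t ^+ 2 <= 0 by move=> /K; lra.
move=> t tab; have := H t tab; rewrite gE ?lee_fin; last by apply: pos; case/andP: tab.
move=> cg; have : c * g t <= g t * g t by rewrite ler_wpM2r// (le_trans _ cg)// ltW.
by rewrite expr2; lra.
Qed.

Lemma flow_energy_continuous u a b : evi_flow u -> 0 <= a -> a < b -> domain phi (u a) ->
  {within `[a, b], continuous (fun s => fr (u s))}.
Proof.
move=> uf a0 ab da.
have right_c t : a <= t -> fr (u s) @[s --> t^'+] --> fr (u t).
  by move=> at_; apply: flow_energy_cvg_right => //; [exact: le_trans at_|exact: flow_domS at_].
have left_c t : a < t -> fr (u s) @[s --> t^'-] --> fr (u t).
  by move=> at_; apply: flow_energy_cvg_left => //; exact: le_lt_trans at_.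
apply/(continuous_within_itvP _ ab); split.
- move=> t; rewrite in_itv/= => /andP[at_ tb].
  by apply/left_right_continuousP; split; [exact: left_c|apply: right_c; exact: ltW].
- exact: right_c.
- exact: left_c.
Qed.

(* The curve is reparametrized by its energy, which makes it Lipschitz. *)
Lemma flow_length_dist_le u a b c : evi_flow u -> 0 <= a -> a < b -> domain phi (u a) -> 0 < c ->
  (forall t, a < t < b -> (c%:E <= gs (u t))%E) ->
  (length_dist (u a) (u b) <= ((fr (u a) - fr (u b)) / c)%:E)%E.
Proof.
move=> uf a0 ab da c0 H.
have fab : fr (u b) <= fr (u a) by apply: (flow_nonincreasing uf) => //; exact: ltW.
pose D := fr (u a) - fr (u b); have D0 : 0 <= D by rewrite subr_ge0.
(* [sigma s] is a time at which the fraction [s] of the energy drop is spent, given by the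
   intermediate value theorem and pinned at both ends. The energy may be constant on an interval, so
   the choice may fail to be monotone; the distance bound is applied in whichever order the two
   times come. *)
have /choice[sigma Hs] : forall s : R, exists r : R, 0 <= s <= 1 ->
    [/\ a <= r <= b, fr (u r) = fr (u a) - s * D, (s = 0 -> r = a) & (s = 1 -> r = b)].
  move=> s; have [->|s0] := eqVneq s 0.
    exists a => _; rewrite mul0r subr0; split => //; first by rewrite lexx ltW.
    by move/eqP; rewrite eq_sym oner_eq0.
  have [->|s1] := eqVneq s 1.
    exists b => _; rewrite mul1r; split => //; [by rewrite lexx ltW|by rewrite /D; lra|].
    by move/eqP; rewrite oner_eq0.
  case: (boolP (0 <= s <= 1)) => [/andP[s0' s1']|]; last by exists 0.
  have [|r] := @IVT _ _ a b (fr (u a) - s * D) (ltW ab) (flow_energy_continuous uf a0 ab da).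
    have h1 : 0 <= s * D by rewrite mulr_ge0.
    have h2 : s * D <= 1 * D by rewrite ler_wpM2r.
    rewrite min_r// max_l//; apply/andP; split; last lra.
    by rewrite /D in h2 *; lra.
  rewrite in_itv/= => rab fr_; exists r => _; split => //.
    by move=> sz; rewrite sz eqxx in s0.
  by move=> sz; rewrite sz eqxx in s1.
have dist r r' : a <= r -> r <= r' -> r' <= b -> mdist (u r') (u r) <= (fr (u r) - fr (u r')) / c.
  move=> ar rr' r'b; rewrite ler_pdivlMr// mulrC.
  apply: flow_dist_le_energy => //; first exact: le_trans ar.
    exact: flow_domS uf _ _ ar.
  by move=> t /andP[rt tr']; apply: H; rewrite (le_lt_trans ar rt) (lt_le_trans tr' r'b).
apply: (@lipschitz_length_dist _ _ (fun s => u (sigma s))).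
- by rewrite divr_ge0// ltW.
- move=> s t s0 st t1.
  have [|/andP[as_ sb] fs _ _] := Hs s; first by rewrite s0 (le_trans st).
  have [|/andP[at_ tb] ft _ _] := Hs t; first by rewrite t1 (le_trans s0).
  have K : D / c * (t - s) = (t * D - s * D) / c by ring.
  have tsD : s * D <= t * D by rewrite ler_wpM2r.
  have [l|/ltW l] := leP (sigma s) (sigma t).
    rewrite metric_sym; apply: le_trans (dist _ _ as_ l tb) _.
    by rewrite fs ft K; apply: ler_wpM2r; [rewrite invr_ge0 ltW|lra].
  apply: le_trans (dist _ _ at_ l sb) _.
  by rewrite fs ft K; apply: ler_wpM2r; [rewrite invr_ge0 ltW|lra].
- by have [|_ _ -> //] := Hs 0; rewrite lexx ler01.
- by have [|_ _ _ -> //] := Hs 1; rewrite lexx ler01.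
Qed.

(** If the global slope at [u t] exceeds [c], it does so for a while along the flow; the later
    points [u (t + h)] then have length distance to [u t] at most the energy drop divided by [c],
    and they tend to [u t] in that distance. *)
Lemma flow_length_slope u t : evi_flow u -> 0 <= t -> length_slope phi (u t) = gs (u t).
Proof.
move=> uf t0; apply/eqP; rewrite eq_le; apply/andP; split.
  by rewrite (global_slope_eq_slope uf t0) length_slope_le_slope.
case: (pselect (domain phi (u t))) => [dt|/(not_dom) pt]; last first.
  by rewrite /length_slope /slope_wrt pt eqxx leey.
rewrite leNgt; apply/negP => N.
have [c cl cg] : exists2 c : R, (length_slope phi (u t) < c%:E)%E & (c%:E < gs (u t))%E.
  have l0 : (0 <= length_slope phi (u t))%E by apply: slope_wrt_ge0; exact: length_dist_gt0.
  move: N l0; case: (length_slope _ _) => [r| |]//; case: (gs (u t)) => [q| |]//.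
    by rewrite lte_fin => rq _; exists ((r + q) / 2); rewrite lte_fin; lra.
  by move=> _ _; exists (r + 1); rewrite ?ltry// lte_fin ltrDl.
have c0 : 0 < c.
  have : (0 <= length_slope phi (u t))%E by apply: slope_wrt_ge0; exact: length_dist_gt0.
  by move=> /le_lt_trans/(_ cl); rewrite lte_fin.
move: cl; apply/negP; rewrite -leNgt.
have [d d0 Hd] := flow_slope_lsc uf t0 cg.
apply: slope_wrt_ge => // r r0.
(* An energy drop below this number forces a length distance below [r]. *)
have rc0 : 0 < r * c / 2 by rewrite !mulr_gt0// invr_gt0.
have /near0P[d1 d10 H1] := flow_energy_right uf t0 dt rc0.
have [h /andP[h0 hd] hd1] := exists_lt2 d0 d10.
have th : t < t + h by rewrite ltrDl.
have gc s : t < s < t + h -> (c%:E <= gs (u s))%E.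
  move=> /andP[ts sh]; apply: ltW; apply: Hd; first exact: le_trans (ltW ts).
  by rewrite gtr0_norm; lra.
have E1 := energy_drop_ge uf t0 (ltW th) dt (ltW c0) gc.
have E2 := flow_length_dist_le uf t0 th dt c0 gc.
have E3 := H1 h hd1.
rewrite addrAC subrr add0r in E1.
have c2h : 0 < c ^+ 2 * h by rewrite mulr_gt0// exprn_gt0.
have neq : u (t + h) != u t.
  by apply/eqP => E; rewrite E subrr in E1; lra.
exists (u (t + h)); split => //.
- by apply: (ef_dom uf); exact: le_lt_trans th.
- exact: length_dist_gt0.
- apply: le_lt_trans E2 _; rewrite lte_fin ltr_pdivrMr//; lra.
- apply: (@le_trans _ _ (c%:E * ((fr (u t) - fr (u (t + h))) / c)%:E)%E).
    by rewrite lee_wpmul2l// lee_fin ltW.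
  by rewrite -EFinM mulrC divfK ?gt_eqF.
Qed.

(** * Energy identities *)

Lemma gs_between (g : \bar R) c : (g < c%:E)%E -> (0 <= g)%E ->
  exists2 c', (g < c'%:E)%E & c' < c.
Proof.
case: g => [r| |]//; rewrite lte_fin => rc _.
by exists ((r + c) / 2); rewrite ?lte_fin; lra.
Qed.

(* If the speed quotients at [t] are at most [c] along h_n -> 0, contraction carries the bound
   to every later time, so that the slope at t + r is at most e^(- lam r) c; let r -> 0. *)
Lemma speed_gt u t c : evi_flow u -> 0 <= t -> (c%:E < gs (u t))%E ->
  \forall h \near 0^'+, c * h < mdist (u (t + h)) (u t).
Proof.
move=> uf t0 cg; have [c0|c0] := ltP c 0.
  apply: filterS (nbhs_right_gt 0) => h h0.
  by apply: lt_le_trans (mdist_ge0 _ _); rewrite pmulr_llt0.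
apply/near0P; apply: contrapT => N.
have slow e : 0 < e -> exists2 h, 0 < h < e & mdist (u (t + h)) (u t) <= c * h.
  move=> e0; apply: contrapT => M; apply: N; exists e => // h he.
  by rewrite ltNge; apply/negP => L; apply: M; exists h.
have [c2 cc2 c2g] : exists2 c2, c < c2 & (c2%:E < gs (u t))%E.
  move: cg; case: (gs (u t)) => [q| |]//.
    by rewrite lte_fin => cq; exists ((c + q) / 2); rewrite ?lte_fin; lra.
  by exists (c + 1); rewrite ?ltry ?ltrDl.
(* As [c] may be 0, a positive number in between is used for the ratio that bounds the
   exponential. *)
pose c1 := (c + c2) / 2.
have c10 : 0 < c1 by rewrite /c1; lra.
have c12 : 1 < c2 / c1 by rewrite ltr_pdivlMr// mul1r /c1; lra.
have [d d0 Hd] := flow_slope_lsc uf t0 c2g.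
have [d' d'0 Hd'] := near_expR_lt (`|lam|) c12.
have [r /andP[r0 rd] /andP[_ rd']] := exists_lt2 d0 d'0.
have tr0 : 0 <= t + r by rewrite addr_ge0// ltW.
have : (gs (u (t + r)%R) <= (expR (- lam * r) * c)%:E)%E.
  apply: global_slope_le_speed => //; first by apply: (ef_dom uf); exact: ltr_wpDl.
    by rewrite mulr_ge0 ?expR_ge0.
  move=> e /slow[h he hs]; exists h => //; have h0 : 0 < h by case/andP: he.
  have tr : t <= t + r by rewrite lerDl ltW.
  have := flow_contraction (evi_flow_shift (ltW h0) uf) uf t0 tr.
  rewrite addrAC subrr add0r (addrC h (t + r)) (addrC h t) => /le_trans; apply.
  by rewrite -mulrA ler_pM2l// expR_gt0.
move=> /(lt_le_trans (Hd _ tr0 _)); rewrite addrAC subrr add0r gtr0_norm// lte_fin => /(_ rd).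
apply/negP; rewrite -leNgt; apply: (@le_trans _ _ (expR (`|lam| * d') * c1)).
  apply: ler_pM => //; [|by rewrite /c1; lra].
  by rewrite (le_trans (expR_abs_ub _ (ltW r0)))// normrN ler_expR ler_wpM2l// ltW.
by rewrite -ler_pdivlMr// ltW.
Qed.

Lemma speed_right_cvg u t : evi_flow u -> 0 <= t -> speed_right_quot u t @ (0 : R)^'+ --> gs (u t).
Proof.
move=> uf t0; apply: cvge_of_bounds => c cg.
  apply: filterS2 (nbhs_right_gt 0) (speed_gt uf t0 cg) => h h0 H.
  by rewrite /speed_right_quot lte_fin ltr_pdivlMr.
have [c' gc' c'c] := gs_between cg (global_slope_ge0 (u t)).
have : (slope phi (u t) < c'%:E)%E by rewrite -(global_slope_eq_slope uf t0).
move=> /(slope_speed uf t0) H.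
apply: filterS2 (nbhs_right_gt 0) H => h h0 [H _].
rewrite /speed_right_quot lte_fin; apply: le_lt_trans c'c.
by rewrite ler_pdivrMr.
Qed.

Lemma energy_quot (x y : X) h : 0 < h -> domain phi x -> domain phi y ->
  ((phi x - phi y) / h%:E)%E = ((fr x - fr y) / h)%:E.
Proof. by move=> h0 dx dy; rewrite (domK dx) (domK dy) -EFinB inve_fin// -EFinM. Qed.

Lemma sqr_lt_between (g c : R) : 0 <= g -> g ^+ 2 < c -> exists2 c', g < c' & c' ^+ 2 < c.
Proof.
move=> g0 gc; have c0 : 0 <= c by apply: le_trans (ltW gc); exact: sqr_ge0.
have gs : g < Num.sqrt c by rewrite -(@ltr_pXn2r _ 2) ?nnegrE ?sqrtr_ge0// sqr_sqrtr.
exists ((g + Num.sqrt c) / 2); first lra.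
rewrite -[ltRHS](sqr_sqrtr c0) ltr_pXn2r ?nnegrE ?sqrtr_ge0//; last lra.
by have := sqrtr_ge0 c; lra.
Qed.

Lemma sqr_gt_between (g : \bar R) c : (0 <= g)%E -> 0 <= c -> (c%:E < g ^+ 2)%E ->
  exists c', [/\ 0 <= c', (c'%:E < g)%E & c < c' ^+ 2].
Proof.
case: g => [g| |]// g0 c0.
- rewrite -EFin_expe lte_fin => cg; rewrite lee_fin in g0.
  have gs : Num.sqrt c < g by rewrite -(@ltr_pXn2r _ 2) ?nnegrE ?sqrtr_ge0// sqr_sqrtr.
  have s0 := sqrtr_ge0 c.
  exists ((g + Num.sqrt c) / 2); split; [lra|rewrite lte_fin; lra|].
  by rewrite -[ltLHS](sqr_sqrtr c0) ltr_pXn2r ?nnegrE//; lra.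
- move=> _; exists (c + 1); split; [lra|exact: ltry|].
  by have := mulr_ge0 c0 c0; rewrite expr2; lra.
Qed.

Lemma energy_right_cvg u t : evi_flow u -> 0 <= t ->
  energy_right_quot phi u t @ (0 : R)^'+ --> (- (gs (u t) ^+ 2))%E.
Proof.
move=> uf t0; case: (pselect (domain phi (u t))) => [dt|ndt]; last first.
  (* With infinite energy at [t] the quotients are equal to [-oo] for every positive [h]. *)
  have gE : gs (u t) = +oo%E by rewrite /global_slope (not_dom ndt) eqxx.
  rewrite gE; apply: cvge_of_bounds => // c _.
  apply: filterS (nbhs_right_gt 0) => h h0.
  have dth : domain phi (u (t + h)) by apply: (ef_dom uf); exact: ltr_wpDl.
  rewrite /energy_right_quot (not_dom ndt) (domK dth)/= inve_fin//.
  by rewrite gt0_mulNye ?lte_fin ?invr_gt0// ltNyr.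
have dth h : 0 < h -> domain phi (u (t + h)).
  by move=> h0; apply: (ef_dom uf); exact: ltr_wpDl.
apply: cvge_of_bounds.
- move=> c; have := global_slope_ge0 (u t).
  case E : (gs (u t)) => [g| |]//; rewrite lee_fin => g0.
  rewrite -EFin_expe -EFinN lte_fin => cg.
  have [|c' gc' c'c] := @sqr_lt_between g (- c) g0; first lra.
  have : (slope phi (u t) < c'%:E)%E.
    by rewrite -(global_slope_eq_slope uf t0) E lte_fin.
  move=> /(slope_speed uf t0) H.
  apply: filterS2 (nbhs_right_gt 0) H => h h0 [_ H].
  rewrite /energy_right_quot energy_quot//; last exact: dth.
  rewrite lte_fin ltr_pdivlMr//.
  have : c * h < - c' ^+ 2 * h by rewrite ltr_pM2r//; lra.
  lra.
- move=> c; rewrite lteNl -EFinN => cg.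
  have [c0|c0] := ltP 0 c.
    apply: filterS (nbhs_right_gt 0) => h h0.
    rewrite /energy_right_quot energy_quot//; last exact: dth.
    rewrite lte_fin (@le_lt_trans _ _ 0)// pmulr_lle0 ?invr_gt0// subr_le0.
    by apply: (flow_nonincreasing uf) => //; rewrite lerDl ltW.
  have [|c' [c'0 c'g cc']] := sqr_gt_between (global_slope_ge0 (u t)) _ cg.
    by rewrite oppr_ge0.
  have H := energy_right_gt uf t0 dt c'0 c'g.
  apply: filterS2 (nbhs_right_gt 0) H => h h0 H.
  rewrite /energy_right_quot energy_quot//; last exact: dth.
  rewrite lte_fin ltr_pdivrMr//.
  have : - c' ^+ 2 * h < c * h by rewrite ltr_pM2r//; lra.
  lra.
Qed.

Lemma right_speedE u t : evi_flow u -> 0 <= t -> right_speed u t = gs (u t).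
Proof.
by move=> uf t0; apply/cvg_lim; [exact: ereal_hausdorff|exact: speed_right_cvg].
Qed.

Lemma right_energy_derivativeE u t : evi_flow u -> 0 <= t ->
  right_energy_derivative phi u t = (- (gs (u t) ^+ 2))%E.
Proof.
by move=> uf t0; apply/cvg_lim; [exact: ereal_hausdorff|exact: energy_right_cvg].
Qed.

Lemma sqre_cvg T (F : set_system T) (FF : Filter F) (f : T -> \bar R) (g : R) :
  f @ F --> g%:E -> (- (f x ^+ 2))%E @[x --> F] --> (- (g%:E ^+ 2))%E.
Proof.
move=> fg; apply: cvgeN; rewrite -/(g%:E ^+ 2)%E.
have -> : (fun z => f z ^+ 2)%E = (fun z => f z * f z)%E by apply/funext => z; rewrite expe2.
by rewrite expe2; apply: cvgeM.
Qed.

Lemma right_energy_identity_flow u t : evi_flow u -> 0 <= t -> (gs (u t) < +oo)%E ->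
  [/\ right_energy_identity lam phi u t,
      right_speed u s @[s --> t^'+] --> right_speed u t &
      right_energy_derivative phi u s @[s --> t^'+] --> right_energy_derivative phi u t].
Proof.
move=> uf t0 gfin; have gE : gs (u t) = (fine (gs (u t)))%:E.
  by rewrite fineK// fin_real// gfin andbT (lt_le_trans _ (global_slope_ge0 _))// ltNyr.
have speedE s : t < s -> right_speed u s = gs (u s).
  by move=> ts; apply: right_speedE => //; exact: le_trans (ltW ts).
have energyE s : t < s -> right_energy_derivative phi u s = (- (gs (u s) ^+ 2))%E.
  by move=> ts; apply: right_energy_derivativeE => //; exact: le_trans (ltW ts).
have gc := flow_slope_right_cvg uf t0.
split.
- rewrite /right_energy_identity (right_speedE uf t0) (right_energy_derivativeE uf t0).
  rewrite (flow_length_slope uf t0) -(global_slope_eq_slope uf t0).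
  split; [split|split|split] => //.
  + by apply/cvg_ex; exists (gs (u t)); exact: speed_right_cvg.
  + by rewrite gE.
  + by apply/cvg_ex; exists (- (gs (u t) ^+ 2))%E; exact: energy_right_cvg.
  + by rewrite gE -EFin_expe -EFinN.
- rewrite (right_speedE uf t0); apply: cvg_trans gc; apply: near_eq_cvg.
  by apply: filterS (nbhs_right_gt t) => s /speedE.
- rewrite (right_energy_derivativeE uf t0) gE.
  apply: (@cvg_trans _ ((- (gs (u s) ^+ 2))%E @[s --> t^'+])).
    by apply: near_eq_cvg; apply: filterS (nbhs_right_gt t) => s /energyE.
  by apply: sqre_cvg; rewrite -gE.
Qed.

Lemma right_energy_identity_irregular u : evi_flow u -> ~ domain (slope phi) (u 0) ->
  [/\ cvg (speed_right_quot u 0 @ (0 : R)^'+),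
      cvg (energy_right_quot phi u 0 @ (0 : R)^'+) &
      [/\ right_energy_derivative phi u 0 = -oo,
          - (right_speed u 0 ^+ 2) = -oo,
          - (slope phi (u 0%R) ^+ 2) = -oo,
          - (length_slope phi (u 0%R) ^+ 2) = -oo &
          - (gs (u 0%R) ^+ 2) = -oo]]%E.
Proof.
move=> uf nd; have gE : gs (u 0) = +oo%E.
  apply/eqP; rewrite -leye_eq leNgt; apply/negP => H; apply: nd.
  by rewrite /domain/= -(global_slope_eq_slope uf (lexx 0)).
have y2 : (- (+oo ^+ 2) = -oo :> \bar R)%E by rewrite expe2 mulyy.
rewrite (right_speedE uf (lexx 0)) (right_energy_derivativeE uf (lexx 0)).
rewrite (flow_length_slope uf (lexx 0)) -(global_slope_eq_slope uf (lexx 0)).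
rewrite gE y2; split => //.
  by apply/cvg_ex; exists (gs (u 0)); exact: speed_right_cvg.
by apply/cvg_ex; exists (- (gs (u 0%R) ^+ 2))%E; exact: energy_right_cvg.
Qed.

Lemma cvg_left_shift (T : topologicalType) (f : R -> T) t (l : T) :
  f s @[s --> t^'-] --> l -> f (t - h) @[h --> (0 : R)^'+] --> l.
Proof.
move=> fl A /fl; rewrite /nbhs/= => /near_leftP[d d0 H].
apply/near0P; exists d => // h /andP[h0 hd]; apply: H; apply/andP; split; lra.
Qed.

Lemma cvge_fin_bounds T (F : set_system T) {FF : Filter F} (f : T -> \bar R) (l : R) :
  f @ F --> l%:E -> (forall c, c < l -> \forall z \near F, (c%:E < f z)%E) /\
                    (forall c, l < c -> \forall z \near F, (f z < c%:E)%E).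
Proof.
move=> /fine_cvgP[ffin /cvgrPdist_lt fl]; split=> c cl.
- apply: filterS2 ffin (fl (l - c) _) => [z zf|]; last by rewrite subr_gt0.
  by rewrite /= ltr_norml => /andP[? ?]; rewrite -[f z]fineK// lte_fin; lra.
- apply: filterS2 ffin (fl (c - l) _) => [z zf|]; last by rewrite subr_gt0.
  by rewrite /= ltr_norml => /andP[? ?]; rewrite -[f z]fineK// lte_fin; lra.
Qed.

(** * Left derivatives in terms of the left limit of the slope *)

Section left_limits.
Variables (u : R -> X) (t L : R).
Hypotheses (uf : evi_flow u) (t0 : 0 < t) (L0 : 0 <= L).
Hypothesis gL : gs (u s) @[s --> t^'-] --> L%:E.

Let slope_lt c : L < c -> exists2 d, 0 < d <= t & forall s, t - d < s < t -> (gs (u s) <= c%:E)%E.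
Proof.
move=> Lc; have : \forall s \near t^'-, (gs (u s) < c%:E)%E.
  by have [_ H] := cvge_fin_bounds gL; exact: H.
move=> /near_leftP[d d0 H]; exists (Num.min d t); first by rewrite lt_min d0 t0 ge_min lexx orbT.
move=> s /andP[s1 s2]; apply/ltW/H; rewrite s2 andbT.
have : Num.min d t <= d by rewrite ge_min lexx.
lra.
Qed.

Let slope_gt c : c < L -> exists2 d, 0 < d <= t & forall s, t - d < s < t -> (c%:E <= gs (u s))%E.
Proof.
move=> Lc; have : \forall s \near t^'-, (c%:E < gs (u s))%E.
  by have [H _] := cvge_fin_bounds gL; exact: H.
move=> /near_leftP[d d0 H]; exists (Num.min d t); first by rewrite lt_min d0 t0 ge_min lexx orbT.
move=> s /andP[s1 s2]; apply/ltW/H; rewrite s2 andbT.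
have : Num.min d t <= d by rewrite ge_min lexx.
lra.
Qed.

Lemma left_bounds_lt c : L < c -> \forall h \near (0 : R)^'+,
  mdist (u (t - h)) (u t) <= c * h /\ fr (u (t - h)) - fr (u t) <= c ^+ 2 * h.
Proof.
move=> Lc; have [d /andP[d0 dt] H] := slope_lt Lc.
apply/near0P; exists d => // h /andP[h0 hd].
have th0 : 0 < t - h by lra.
have tht : t - h <= t by lra.
have Hs s : t - h < s < t -> (gs (u s) <= c%:E)%E.
  by move=> /andP[s1 s2]; apply: H; rewrite s2 andbT; lra.
have E : t - (t - h) = h by ring.
have := flow_dist_le uf (ltW th0) tht Hs.
have := energy_drop_le uf (ltW th0) tht (ef_dom uf th0) Hs.
by rewrite E metric_sym.
Qed.

Lemma left_energy_gt c : 0 <= c -> c < L -> \forall h \near (0 : R)^'+,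
  c ^+ 2 * h <= fr (u (t - h)) - fr (u t).
Proof.
move=> c0 Lc; have [d /andP[d0 dt] H] := slope_gt Lc.
apply/near0P; exists d => // h /andP[h0 hd].
have th0 : 0 < t - h by lra.
have tht : t - h <= t by lra.
have Hs s : t - h < s < t -> (c%:E <= gs (u s))%E.
  by move=> /andP[s1 s2]; apply: H; rewrite s2 andbT; lra.
have := energy_drop_ge uf (ltW th0) tht (ef_dom uf th0) c0 Hs.
by rewrite (_ : t - (t - h) = h)//; ring.
Qed.

(** The energy drop from [t - h] to [t] is at least [(L - eta)^2 h], while the global slope at
    [u (t - h)] bounds it by [(L + 2 eta)] times the distance; a distance of at most [c * h] would
    contradict the choice of [eta]. *)
Lemma left_speed_gt c : c < L -> \forall h \near (0 : R)^'+, c * h < mdist (u (t - h)) (u t).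
Proof.
move=> cL; have [c0|c0] := ltP c 0.
  apply: filterS (nbhs_right_gt 0) => h h0.
  by apply: lt_le_trans (mdist_ge0 _ _); rewrite pmulr_llt0.
have L_gt0 : 0 < L by exact: le_lt_trans cL.
(* eta is chosen so that (L - eta)^2 >= c (L + 2 eta) with some room *)
pose eta := L * (L - c) / (4 * (L + c)).
have Lc0 : 0 < L + c by lra.
have eta0 : 0 < eta by rewrite divr_gt0 ?mulr_gt0 ?subr_gt0.
have etaL : eta < L.
  rewrite /eta ltr_pdivrMr ?mulr_gt0// ltr_pM2l//; lra.
have etaE : 4 * (L + c) * eta = L * (L - c).
  by rewrite /eta; field; rewrite gt_eqF.
have k : c * (L + 2 * eta) < (L - eta) ^+ 2.
  have : 0 < L * (L - c) by rewrite mulr_gt0 ?subr_gt0.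
  have := sqr_ge0 eta.
  have := mulr_ge0 L0 (ltW eta0).
  rewrite sqrrB; move: etaE; rewrite !expr2; lra.
have h1 : 0 <= L - eta by rewrite subr_ge0 ltW.
have h2 : L - eta < L by lra.
have h3 : L < L + eta by lra.
have [d /andP[d0 dt] Hd] := slope_lt h3.
(* The second bound on [h] makes the quadratic term of [energy_le_slope] at most [eta] times the
   distance. *)
have m0 : 0 < Num.min d (eta / ((`|lam| / 2 + 1) * (L + eta))).
  by rewrite lt_min d0 divr_gt0// mulr_gt0// ?addr_gt0// ltr_wpDl// divr_ge0.
apply: filterS3 (left_energy_gt h1 h2) (left_bounds_lt h3) (filterI (nbhs_right_gt 0) (nbhs_right_lt m0)).
move=> h E1 [E2 _] [/= h0]; rewrite lt_min => /andP[hd hk].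
have th0 : 0 < t - h by lra.
have gc : (gs (u (t - h)) <= (L + eta)%:E)%E.
  have [d2 /andP[d20 d2t] Hd2] := slope_lt h3.
  by apply: Hd; apply/andP; split; lra.
have E3 := energy_le_slope gc (ef_dom uf t0).
rewrite ltNge; apply/negP => N.
set D := mdist _ _ in N E2 E3.
have D0 : 0 <= D by exact: mdist_ge0.
have l2 : 0 <= `|lam| / 2 by rewrite divr_ge0.
have K : `|lam| / 2 * D <= eta.
  apply: (@le_trans _ _ ((`|lam| / 2 + 1) * ((L + eta) * h))).
    by apply: ler_pM => //; lra.
  rewrite mulrA mulrC -ler_pdivlMr; first exact: ltW.
  by rewrite mulr_gt0//; lra.
have K1 : `|lam| / 2 * D ^+ 2 <= eta * D by rewrite expr2 mulrA ler_wpM2r.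
have K2 : (L + 2 * eta) * D <= (L + 2 * eta) * (c * h).
  by rewrite ler_wpM2l// addr_ge0// mulr_ge0// ltW.
have K3 : c * (L + 2 * eta) * h < (L - eta) ^+ 2 * h by rewrite ltr_pM2r.
lra.
Qed.

Lemma speed_left_cvg : speed_left_quot u t @ (0 : R)^'+ --> L%:E.
Proof.
apply: cvge_of_bounds => c; rewrite lte_fin => cL.
  apply: filterS2 (nbhs_right_gt 0) (left_speed_gt cL) => h h0 H.
  by rewrite /speed_left_quot lte_fin ltr_pdivlMr.
have H := @left_bounds_lt ((L + c) / 2) (ltac:(lra)).
apply: filterS2 (nbhs_right_gt 0) H => h h0 [H _].
rewrite /speed_left_quot lte_fin ltr_pdivrMr//; apply: le_lt_trans H _.
by rewrite ltr_pM2r//; lra.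
Qed.

Lemma energy_left_cvg : energy_left_quot phi u t @ (0 : R)^'+ --> (- (L%:E ^+ 2))%E.
Proof.
have dt := ef_dom uf t0.
have near_pos : \forall h \near (0 : R)^'+, 0 < h /\ 0 < t - h.
  by apply/near0P; exists t => // h /andP[h0 ht]; split; lra.
have L0' : (0 <= L%:E)%E by rewrite lee_fin.
apply: cvge_of_bounds => c.
- rewrite -EFin_expe -EFinN lte_fin => cg.
  have [|c' gc' c'c] := @sqr_lt_between L (- c) L0; first lra.
  apply: filterS2 near_pos (left_bounds_lt gc') => h [h0 th0] [_ H].
  rewrite /energy_left_quot energy_quot//; last exact: ef_dom uf _ th0.
  rewrite lte_fin ltr_pdivlMr//.
  have : c * h < - c' ^+ 2 * h by rewrite ltr_pM2r//; lra.
  lra.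
- rewrite lteNl -EFinN => cg.
  have [c0|c0] := ltP 0 c.
    apply: filterS near_pos => h [h0 th0].
    rewrite /energy_left_quot energy_quot//; last exact: ef_dom uf _ th0.
    rewrite lte_fin (@le_lt_trans _ _ 0)// pmulr_lle0 ?invr_gt0// subr_le0.
    by apply: (flow_nonincreasing uf); [exact: ltW|exact: ef_dom uf _ th0|lra].
  have [|c' [c'0 c'g cc']] := sqr_gt_between L0' _ cg; first by rewrite oppr_ge0.
  rewrite lte_fin in c'g.
  apply: filterS2 near_pos (left_energy_gt c'0 c'g) => h [h0 th0] H.
  rewrite /energy_left_quot energy_quot//; last exact: ef_dom uf _ th0.
  rewrite lte_fin ltr_pdivrMr//.
  have : - c' ^+ 2 * h < c * h by rewrite ltr_pM2r//; lra.
  lra.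
Qed.

Lemma left_energy_identity_flow : left_energy_identity phi u t L%:E L%:E L%:E.
Proof.
have sE : left_speed u t = L%:E by apply/cvg_lim; [exact: ereal_hausdorff|exact: speed_left_cvg].
have eE : left_energy_derivative phi u t = (- (L%:E ^+ 2))%E.
  by apply/cvg_lim; [exact: ereal_hausdorff|exact: energy_left_cvg].
rewrite /left_energy_identity sE eE; split; [split|split|split] => //.
- by apply/cvg_ex; exists L%:E; exact: speed_left_cvg.
- by apply/cvg_ex; exists (- (L%:E ^+ 2))%E; exact: energy_left_cvg.
Qed.

End left_limits.

(** * A priori estimates and asymptotic expansions *)

Lemma flow_slope_decay u s t gs_ gt_ : evi_flow u -> 0 <= s -> s <= t ->
  gs (u s) = gs_%:E -> gs (u t) = gt_%:E -> gt_ <= expR (- lam * (t - s)) * gs_.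
Proof.
move=> uf s0 st Es Et; rewrite -lee_fin -Et.
by apply: (global_slope_decay uf s0 st); rewrite Es.
Qed.

(** The left-hand side is the value at [r = t] of a sum that does not increase in [r]. In its
    derivative the energy gaps cancel, and the decay of the slope between [r] and [t] lets the
    dissipation absorb the derivative of the last term. *)
Lemma flow_a_priori u v t g : evi_flow u -> domain phi v -> 0 < t -> gs (u t) = g%:E ->
  expR (lam * t) / 2 * mdist (u t) v ^+ 2 + Efun lam t * (fr (u t) - fr v)
    + Efun lam t ^+ 2 / 2 * g ^+ 2 <= 2^-1 * mdist (u 0) v ^+ 2.
Proof.
move=> uf dv t0 gE.
have g0 : 0 <= g by rewrite -lee_fin -gE global_slope_ge0.
(* By [EfunN], [z3 t] is then the slope term of the statement. *)
pose k := (expR (lam * t) * g) ^+ 2 / 2.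
pose z1 r := expR (lam * r) * mdist (u r) v ^+ 2.
pose z2 r := Efun lam r * (fr (u r) - fr v).
pose z3 r := k * Efun (- lam) r ^+ 2.
have D3 r : is_derive r (1 : R) z3 (k * (2 * (Efun (- lam) r * expR (- lam * r)))).
  have H := is_deriveZ k (is_deriveX 2 (is_derive_Efun (- lam) r)).
  by apply: is_derive_eq; rewrite /GRing.scale/= expr1; ring.
(* The energy may be infinite at time 0, where [z2] is 0 thanks to [Efun0]; the integrated
   inequality supplies the right semicontinuity there. *)
have ub r : 0 <= r -> 2^-1 * z1 r + z2 r <= 2^-1 * mdist (u 0) v ^+ 2.
  move=> r0; have := ef_evi uf (lexx 0) r0 dv; rewrite subr0 /z1 /z2; lra.
have : 2^-1 * z1 t + z2 t + z3 t <= 2^-1 * z1 0 + z2 0 + z3 0.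
  apply: (@dini_le_nonincreasing _ (fun r => 2^-1 * z1 r + z2 r + z3 r)); first exact: ltW.
  - move=> r /andP[r0 rt]; apply: left_lscD; last exact: is_derive_left_lsc (D3 r).
    apply: left_lscD.
      move=> e e0; have e20 : 0 < 2 * e by rewrite mulr_gt0.
      by apply: filterS (curve0_weighted_left v lam (ef_cont uf) r0 e20) => s; rewrite /z1; lra.
    apply: cvg_left_lsc; apply: cvgM; first by apply: cvg_at_left_filter; exact: continuous_Efun.
    by apply: cvgB; [exact: flow_energy_cvg_left|exact: cvg_cst].
  - apply: right_uscD; last exact: is_derive_right_usc (D3 0).
    move=> e e0; apply: filterS (nbhs_right_gt 0) => r r0.
    apply: le_trans (ub r (ltW r0)) _; rewrite /z2 Efun0 mul0r /z1 mulr0 expR0; lra.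
  - move=> r /andP[r0 rt].
    have [gr gr0 grE] := flow_slope_fine uf r0.
    have dr := ef_dom uf r0.
    have Z1 : dini_le (fun s => 2^-1 * z1 s) r (expR (lam * r) * (fr v - fr (u r))).
      have h2 : 0 < cst (2^-1 : R) r by rewrite /cst invr_gt0.
      have := dini_leM (is_derive_cst (2^-1 : R) r (1 : R)) h2
        (flow_dini_weighted uf (ltW r0) dr dv).
      by rewrite /cst mul0r addr0 => /dini_leW; apply; lra.
    have Z2 : dini_le z2 r (Efun lam r * - gr ^+ 2 + expR (lam * r) * (fr (u r) - fr v)).
      apply: (dini_leM (is_derive_Efun lam r) (Efun_gt0 _ r0)).
      have := dini_leD (flow_energy_dini uf (ltW r0) dr grE)
        (is_derive_dini_le (is_derive_cst (- fr v) r (1 : R))).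
      by rewrite addr0.
    apply: dini_leW (dini_leD (dini_leD Z1 Z2) (is_derive_dini_le (D3 r))).
    have dec := flow_slope_decay uf (ltW r0) (ltW rt) grE gE.
    have K : expR (lam * t) * g <= expR (lam * r) * gr.
      have -> : expR (lam * r) = expR (lam * t) * expR (- lam * (t - r)).
        by rewrite -expRD; congr expR; ring.
      by rewrite -mulrA ler_pM2l ?expR_gt0.
    have K2 : (expR (lam * t) * g) ^+ 2 <= (expR (lam * r) * gr) ^+ 2.
      by rewrite lerXn2r ?nnegrE ?mulr_ge0 ?expR_ge0.
    have Em : Efun (- lam) r * expR (- lam * r) * expR (lam * r) ^+ 2 = Efun lam r.
      rewrite EfunN; have := expRlN lam r; set e1 := expR (lam * r); set e2 := expR (- lam * r) => E.
      have -> : e2 * Efun lam r * e2 * e1 ^+ 2 = (e1 * e2) ^+ 2 * Efun lam r by ring.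
      by rewrite E expr1n mul1r.
    have K3 : Efun (- lam) r * expR (- lam * r) * (expR (lam * t) * g) ^+ 2 <= Efun lam r * gr ^+ 2.
      rewrite -[in leRHS]Em -[in leRHS]mulrA -exprMn ler_wpM2l// mulr_ge0 ?expR_ge0//.
      by rewrite Efun_ge0// ltW.
    rewrite /k; lra.
rewrite {2}/z1 {2}/z2 {2}/z3 !Efun0 mulr0 expR0 expr0n/= mulr0 mul0r mul1r !addr0 => H.
apply: le_trans H; rewrite /z1 /z2 /z3 /k EfunN.
have -> : (expR (lam * t) * g) ^+ 2 / 2 * (expR (- lam * t) * Efun lam t) ^+ 2 =
  (expR (lam * t) * expR (- lam * t)) ^+ 2 * (Efun lam t ^+ 2 / 2 * g ^+ 2) by ring.
rewrite expRlN expr1n mul1r; lra.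
Qed.

(** The global slope at [v], tested at [u t], bounds the energy gap in [flow_a_priori]. The
    quadratic terms combine to [q / 2] times the squared distance, since
    [q = expR (lam * t) + lam * E], and Young's inequality with weight [q] absorbs the linear
    term. *)
Lemma flow_a_priori_slope u v t g l : evi_flow u -> 0 < t -> gs (u t) = g%:E -> gs v = l%:E ->
  0 < 2 * expR (lam * t) - 1 ->
  g ^+ 2 <= (2 * expR (lam * t) - 1)^-1 * l ^+ 2 + (Efun lam t ^+ 2)^-1 * mdist (u 0) v ^+ 2.
Proof.
move=> uf t0 gE lE; set q := 2 * _ - 1 => q0.
have dv : domain phi v by apply: global_slope_dom; rewrite lE ltry.
have l0 : 0 <= l by rewrite -lee_fin -lE global_slope_ge0.
have A := flow_a_priori uf dv t0 gE.
have := (global_slope_leP dv l0).1 _ (u t) (ef_dom uf t0).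
rewrite lE lexx => /(_ isT); rewrite (metric_sym v).
set D := mdist (u t) v in A *; set D0 := mdist (u 0) v in A * => B.
set E := Efun lam t in A *.
have E0 : 0 < E by exact: Efun_gt0.
have lE' : lam * E = expR (lam * t) - 1 by exact: mulEfun.
have B1 : E * (fr v - fr (u t) + lam / 2 * D ^+ 2) <= E * (l * D) by rewrite ler_pM2l.
have C : E * (l * D) <= q / 2 * D ^+ 2 + E ^+ 2 * l ^+ 2 / (2 * q).
  have : 0 <= (q * D - E * l) ^+ 2 / (2 * q) by rewrite divr_ge0 ?sqr_ge0// mulr_ge0// ltW.
  have -> : (q * D - E * l) ^+ 2 / (2 * q) = q / 2 * D ^+ 2 + E ^+ 2 * l ^+ 2 / (2 * q) - E * (l * D).
    by field; rewrite gt_eqF.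
  lra.
have E2 : 0 < E ^+ 2 by rewrite exprn_gt0.
rewrite -(ler_pM2l E2).
have -> : E ^+ 2 * (q^-1 * l ^+ 2 + (E ^+ 2)^-1 * D0 ^+ 2) = 2 * (E ^+ 2 * l ^+ 2 / (2 * q)) + D0 ^+ 2.
  by field; rewrite (gt_eqF q0) gt_eqF.
have qE : q = expR (lam * t) + lam * E by rewrite lE' /q; ring.
have : q / 2 * D ^+ 2 = expR (lam * t) / 2 * D ^+ 2 + E * (lam / 2 * D ^+ 2) by rewrite qE; field.
lra.
Qed.

(** The weight with exponent [2 * lam] is chosen because the energy lost up to [r] is at most
    [g^2 r] times [expR (- 2 * lam * r)]: the exponentials cancel, and integration leaves [t^2 / 2].
    The surplus quadratic term has the good sign because [lam <= 0]. *)
Lemma flow_expansion_slope u v t g : evi_flow u -> lam <= 0 -> gs (u 0) = g%:E -> domain phi v ->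
  0 <= t ->
  expR (2 * lam * t) / 2 * mdist (u t) v ^+ 2 - 2^-1 * mdist (u 0) v ^+ 2 <=
  Efun (2 * lam) t * (fr v - fr (u 0)) + t ^+ 2 / 2 * g ^+ 2.
Proof.
move=> uf l0 gE dv t0.
have g0 : 0 <= g by rewrite -lee_fin -gE global_slope_ge0.
have d0 : domain phi (u 0) by apply: global_slope_dom; rewrite gE ltry.
pose z1 r := expR (2 * lam * r) * mdist (u r) v ^+ 2.
pose B r := (- 2 * (fr v - fr (u 0))) * Efun (2 * lam) r + (- g ^+ 2) * r ^+ 2.
have DB r : is_derive r (1 : R) B
    ((- 2 * (fr v - fr (u 0))) * expR (2 * lam * r) + (- g ^+ 2) * (2 * r)).
  exact: (is_deriveD (is_derive_EfunZ _ _ _) (is_derive_sqrZ _ _)).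
suff : z1 t + B t <= z1 0 + B 0.
  rewrite /z1 /B Efun0 !mulr0 expr0n/= mulr0 expR0 mul1r !addr0; lra.
apply: (@dini_le_nonincreasing _ (z1 \+ B)) => //.
- move=> r /andP[r0 rt]; apply: left_lscD; last exact: is_derive_left_lsc (DB r).
  by apply: curve0_weighted_left; first exact: ef_cont uf.
- apply: right_uscD; last exact: is_derive_right_usc (DB 0).
  by apply: curve0_weighted_right; first exact: ef_cont uf.
move=> r /andP[r0 rt]; have dr := ef_dom uf r0.
have := dini_leM (is_derive_expRl (2 * lam) r) (expR_gt0 _)
  (flow_dini uf (ltW r0) dr dv).
move=> /dini_leD/(_ (is_derive_dini_le (DB r))); apply: dini_leW.
have e0 := expR_gt0 (2 * lam * r).
have K1 : expR (2 * lam * r) * (lam * mdist (u r) v ^+ 2) <= 0.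
  by rewrite pmulr_rle0// mulr_le0_ge0// sqr_ge0.
have K2 : fr (u 0) - fr (u r) <= (expR (- lam * r) * g) ^+ 2 * (r - 0).
  apply: (energy_drop_le uf (lexx 0) (ltW r0) d0) => s /andP[s0 sr].
  have [gr gr0 grE] := flow_slope_fine uf s0; rewrite grE lee_fin.
  have := flow_slope_decay uf (lexx 0) (ltW s0) gE grE; rewrite subr0 => /le_trans; apply.
  by rewrite ler_wpM2r// ler_expR ler_wpM2l ?oppr_ge0// ltW.
have K3 : expR (2 * lam * r) * (fr (u 0) - fr (u r)) <=
    expR (2 * lam * r) * ((expR (- lam * r) * g) ^+ 2 * (r - 0)) by rewrite ler_pM2l.
have K4 : expR (2 * lam * r) * ((expR (- lam * r) * g) ^+ 2 * (r - 0)) = g ^+ 2 * r.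
  have -> : 2 * lam * r = lam * r + lam * r by ring.
  have := expRlN lam r; rewrite expRD subr0; set e1 := expR (lam * r); set e2 := expR (- lam * r) => E.
  have -> : e1 * e1 * ((e2 * g) ^+ 2 * r) = (e1 * e2) ^+ 2 * (g ^+ 2 * r) by ring.
  by rewrite E expr1n mul1r.
lra.
Qed.

(** The global slope at [p] gives a lower bound with a quadratic term centred at [p]; moving the
    centre to [o] changes that term by an affine function of the distance to [p]. *)
Lemma linearly_bounded_below_slope p g o : gs p = g%:E ->
  linearly_bounded_below (fun x => phi x - (lam / 2 * mdist x o ^+ 2)%:E)%E.
Proof.
move=> gE; have dp : domain phi p by apply: global_slope_dom; rewrite gE ltry.
have g0 : 0 <= g by rewrite -lee_fin -gE global_slope_ge0.
set D := mdist p o; have D0 : 0 <= D by exact: mdist_ge0.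
exists p, (fr p - `|lam| / 2 * D ^+ 2), (g + `|lam| * D) => x.
case: (pselect (domain phi x)) => [dx|/not_dom ->]; last first.
  by rewrite -EFinN !addye// leey.
rewrite (domK dx) -EFinB -EFinD lee_fin.
have := (global_slope_leP dp g0).1 _ x dx; rewrite gE lexx => /(_ isT).
rewrite (metric_sym p).
have a0 := mdist_ge0 x p; have b0 := mdist_ge0 x o.
have := metric_triangle x p o; have := metric_triangle x o p.
rewrite (metric_sym o) -/D; set a := mdist x p in a0 *; set b := mdist x o in b0 * => t1 t2.
have K : `|b ^+ 2 - a ^+ 2| <= D * (2 * a + D).
  rewrite subr_sqr normrM (ger0_norm (addr_ge0 b0 a0)).
  by apply: ler_pM => //; [rewrite addr_ge0|rewrite ler_norml; apply/andP; split; lra|lra].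
have : lam / 2 * (b ^+ 2 - a ^+ 2) <= `|lam| / 2 * (D * (2 * a + D)).
  apply: le_trans (ler_norm _) _; rewrite normrM.
  by apply: ler_pM => //; rewrite normrM (@ger0_norm _ 2^-1) ?invr_ge0.
lra.
Qed.

Lemma energy_max0_continuous u : evi_flow u -> domain phi (u 0) ->
  continuous (fun s => fr (u (Num.max s 0))).
Proof.
move=> uf d0 t; apply/left_right_continuousP; split.
- have [t0|t0] := ltP 0 t.
    apply: cvg_trans (flow_energy_cvg_left uf t0).
    by apply: near_eq_cvg; apply: filterS (nbhs_left_gt t0) => s s0; rewrite max_l// ltW.
  apply: cvg_near_cst; apply: filterS (nbhs_left_lt t) => s st.
  by rewrite max_r// (le_trans (ltW st)).
- have [t0|t0] := leP 0 t.
    apply: cvg_trans (flow_energy_cvg_right uf t0 (flow_domS uf (lexx 0) d0 t0)).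
    apply: near_eq_cvg; apply: filterS (nbhs_right_gt t) => s st.
    by rewrite max_l// (le_trans t0)// ltW.
  apply: cvg_near_cst; apply: filterS (nbhs_right_lt t0) => s s0.
  by rewrite max_r// ltW.
Qed.

(** * The expansion through the Moreau-Yosida regularization *)

Section primitive_of_energy_drop.
Variables (u : R -> X) (W : R -> R).
Hypotheses (uf : evi_flow u) (d0 : domain phi (u 0)) (W0 : W 0 = 0).
Hypothesis W' : forall t, 0 <= t ->
  is_derive t (1 : R) W (expR (lam * t) * (fr (u 0) - fr (u t))).

(* d(u_t, u_0) is at most the integral of the slope g, and 2 th g <= th^2 e^(- lam r) + e^(lam r) g^2
   for every th; the right-hand side integrates exactly. *)
Lemma dist_le_primitive t : 0 < t -> mdist (u t) (u 0) ^+ 2 <=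
  Efun (- lam) t * (expR (lam * t) * (fr (u 0) - fr (u t)) - lam * W t).
Proof.
move=> t0; set K := _ - lam * W t.
have E0 : 0 < Efun (- lam) t by exact: Efun_gt0.
suff H th : 0 <= th -> 2 * th * mdist (u t) (u 0) <= th ^+ 2 * Efun (- lam) t + K.
  have D0 := mdist_ge0 (u t) (u 0).
  have := H (mdist (u t) (u 0) / Efun (- lam) t) (divr_ge0 D0 (ltW E0)).
  set D := mdist _ _ in D0 *; set E := Efun _ _ in E0 * => H1.
  have : E * (2 * (D / E) * D) <= E * ((D / E) ^+ 2 * E + K) by rewrite ler_pM2l.
  have -> : E * (2 * (D / E) * D) = 2 * D ^+ 2 by field; rewrite gt_eqF.
  have -> : E * ((D / E) ^+ 2 * E + K) = D ^+ 2 + E * K by field; rewrite gt_eqF.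
  lra.
move=> th0.
pose z1 s := 2 * th * mdist (u s) (u 0).
pose z2 s := expR (lam * s) * (fr (u s) - fr (u 0)).
pose z3 s := lam * W s + (- th ^+ 2) * Efun (- lam) s.
have D3 s : 0 <= s -> is_derive s (1 : R) z3
    (lam * (expR (lam * s) * (fr (u 0) - fr (u s))) + (- th ^+ 2) * expR (- lam * s)).
  by move=> s0; exact: (is_deriveD (is_deriveZ lam (W' s0)) (is_derive_EfunZ _ _ _)).
pose g s := fine (gs (u s)).
have gE s : 0 < s -> gs (u s) = (g s)%:E.
  by move=> /(flow_slope_fine uf)[r _ rE]; rewrite /g rE.
have I1 : dini_on z1 0 t (fun s => 2 * th * g s).
  apply: dini_on_cvg.
  - by move=> s /andP[s0 st]; apply: cvgM; [exact: cvg_cst|exact: flow_dist_cvg_left].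
  - by apply: cvgM; [exact: cvg_cst|exact: flow_dist_cvg_right].
  - move=> s /andP[s0 st]; apply: dini_leZ; first by rewrite mulr_ge0.
    by apply: flow_dist_dini => //; [exact: ltW|by rewrite gE].
have I2 : dini_on z2 0 t (fun s => expR (lam * s) * - g s ^+ 2 +
    lam * expR (lam * s) * (fr (u s) - fr (u 0))).
  apply: dini_on_cvgM (ltW t0) _ _ _ _ _.
  - by move=> s _; exact: is_derive_expRl.
  - by move=> s _; exact: expR_gt0.
  - move=> s /andP[s0 _]; apply: cvgB; last exact: cvg_cst.
    exact: (flow_energy_cvg_left uf s0).
  - by apply: cvgB; [exact: (flow_energy_cvg_right uf (lexx 0) d0)|exact: cvg_cst].
  - move=> s /andP[s0 st].
    have := dini_leD (flow_energy_dini uf (ltW s0) (ef_dom uf s0) (gE s s0))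
        (is_derive_dini_le (is_derive_cst (- fr (u 0)) s (1 : R))).
    by rewrite addr0.
have I3 := is_derive_dini_on (ltW t0) (fun s (H : 0 <= s <= t) => D3 s (elimTF andP H).1).
have := dini_on_nonincreasing (ltW t0) (dini_onD (dini_onD I1 I2) I3).
rewrite /z1 /z2 /z3 /= mdistxx subrr Efun0 W0 !mulr0 !addr0 /K => H.
suff : forall s, 0 < s < t -> 2 * th * g s + (expR (lam * s) * - g s ^+ 2 +
    lam * expR (lam * s) * (fr (u s) - fr (u 0))) +
    (lam * (expR (lam * s) * (fr (u 0) - fr (u s))) + - th ^+ 2 * expR (- lam * s)) <= 0.
  by move=> /H; lra.
move=> s _; have e0 := expR_gt0 (lam * s).
rewrite -(pmulr_rle0 _ e0).
have := sqr_ge0 (th - expR (lam * s) * g s).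
have := expRlN lam s; set e1 := expR (lam * s); set e2 := expR (- lam * s) => E.
have -> : e1 * (2 * th * g s + (e1 * - g s ^+ 2 + lam * e1 * (fr (u s) - fr (u 0))) +
 (lam * (e1 * (fr (u 0) - fr (u s))) + - th ^+ 2 * e2)) =
  2 * th * (e1 * g s) - (e1 * g s) ^+ 2 - th ^+ 2 * (e1 * e2) by ring.
by rewrite E sqrrB; lra.
Qed.

(** The infimum is tested at [u t], with [dist_le_primitive] for the distance; by [EfunN] the
    quotient of the two [Efun] factors is an exponential. *)
Lemma moreau_yosida_ge t : 0 < t ->
  (((fr (u 0) - fr (u t) + lam * expR (- lam * t) * W t) / 2)%:E <=
   phi (u 0%R) - moreau_yosida phi (Efun lam t) (u 0%R))%E.
Proof.
move=> t0; have E0 := Efun_gt0 lam t0.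
have D := dist_le_primitive t0.
have MY : (moreau_yosida phi (Efun lam t) (u 0%R) <=
   phi (u t) + ((2 * Efun lam t)^-1 * mdist (u t) (u 0%R) ^+ 2)%:E)%E.
  by apply: ereal_inf_lbound; exists (u t).
apply: le_trans (leeB (lexx _) MY).
set c := _ * mdist _ _ ^+ 2.
have -> : (phi (u 0%R) - (phi (u t) + c%:E))%E = (fr (u 0) - (fr (u t) + c))%:E.
  by rewrite EFinB EFinD -!domK//; exact: (ef_dom uf t0).
rewrite lee_fin {}/c.
have : (2 * Efun lam t)^-1 * mdist (u t) (u 0) ^+ 2 <= (2 * Efun lam t)^-1 *
   (Efun (- lam) t * (expR (lam * t) * (fr (u 0) - fr (u t)) - lam * W t)).
  by rewrite ler_pM2l// invr_gt0 mulr_gt0.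
rewrite EfunN; have := expRlN lam t; set e1 := expR (lam * t); set e2 := expR (- lam * t) => E.
set w := fr (u 0) - _.
have -> : (2 * Efun lam t)^-1 * (e2 * Efun lam t * (e1 * w - lam * W t)) =
  (e1 * e2 * w - lam * e2 * W t) / 2 by field; rewrite gt_eqF.
by rewrite E /w; lra.
Qed.

(** Multiplied by [expR (2 * lam * s)], the lower bound of [moreau_yosida_ge] is exactly the
    derivative of half of [expR (lam * s) * W s]. Integrating it and solving for [W t] produces the
    factor [2 * expR (- (lam * t))]. *)
Lemma primitive_le_integral t : 0 <= t ->
  ((W t)%:E <= (2 * expR (- (lam * t)))%:E * \int[mu]_(s in `]0%R, t[)
    ((expR (2 * lam * s))%:E * (phi (u 0%R) - moreau_yosida phi (Eint lam s) (u 0%R))))%E.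
Proof.
move=> t0.
pose h s := expR (lam * s) * (fr (u 0) - fr (u (Num.max s 0))).
have hE s : 0 <= s -> h s = expR (lam * s) * (fr (u 0) - fr (u s)).
  by move=> s0; rewrite /h max_l.
have hc : continuous h.
  move=> s; apply: cvgM; first exact: continuous_expRl.
  by apply: cvgB; [exact: cvg_cst|exact: energy_max0_continuous].
pose q s := 2^-1 * (expR (lam * s) * h s + lam * expR (lam * s) * W s).
pose Y s := 2^-1 * (expR (lam * s) * W s).
have Y' s : 0 <= s -> is_derive s (1 : R) Y (q s).
  move=> s0; have := is_deriveZ (2^-1 : R) (is_deriveM (is_derive_expRl lam s) (W' s0)).
  by rewrite -hE// => H; apply: is_derive_eq; rewrite /q /GRing.scale/=; ring.
have qc s : 0 <= s -> {for s, continuous q}.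
  move=> s0; apply: cvgM; first exact: cvg_cst.
  apply: cvgD; first by apply: cvgM; [exact: continuous_expRl|exact: hc].
  apply: cvgM; last exact: is_derive_continuous (W' s0).
  by apply: cvgM; [exact: cvg_cst|exact: continuous_expRl].
have qpos : measurable_fun `]0, t[ (fun s => (q s)%:E).
  apply/measurable_EFinP; apply: subspace_continuous_measurable_fun => //.
  by apply: continuous_in_subspaceT => s; rewrite inE/= in_itv/= => /andP[/ltW s0 _]; exact: qc.
have Yint : ((Y t)%:E <= \int[mu]_(s in `]0%R, t[) ((expR (2 * lam * s))%:E *
    (phi (u 0%R) - moreau_yosida phi (Eint lam s) (u 0%R))))%E.
  have := FTC2_is_derive t0 qc Y'; rewrite {2}/Y W0 !mulr0 subr0 => <-.
  (* The sign of [q] is unknown; its positive part is still below the target integrand, which is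
     nonnegative because the regularization never exceeds the energy. *)
  rewrite integral_itv_bndoo// integralE.
  apply: (@le_trans _ _ (\int[mu]_(s in `]0%R, t[) (fun s => (q s)%:E)^\+ s)%E).
    by rewrite -[leRHS]sube0; apply: leeB => //; exact: integral_ge0.
  apply: ge0_le_integral_nomeas => [s _|s]; first exact: funepos_ge0.
  rewrite /= in_itv/= => /andP[s0 st].
  have MY := moreau_yosida_ge s0; rewrite EintE ?(ltW s0)//.
  have MY0 : (0 <= phi (u 0%R) - moreau_yosida phi (Efun lam s) (u 0%R))%E.
    have fin0 : phi (u 0) \is a fin_num by rewrite (domK d0).
    rewrite sube_ge0 ?fin0 ?orbT//; apply: ereal_inf_lbound; exists (u 0) => //.
    by rewrite mdistxx expr0n/= mulr0 adde0.
  have e0 : (0 <= (expR (2 * lam * s))%:E)%E by rewrite lee_fin expR_ge0.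
  rewrite funeposE ge_max mule_ge0// andbT.
  apply: le_trans (lee_wpmul2l e0 MY); rewrite -EFinM lee_fin.
  rewrite le_eqVlt; apply/orP; left; apply/eqP; rewrite /q hE ?(ltW s0)//.
  have -> : 2 * lam * s = lam * s + lam * s by ring.
  have := expRlN lam s; rewrite expRD; set e1 := expR (lam * s); set e2 := expR (- lam * s) => E.
  set w := fr (u 0) - _.
  have -> : e1 * e1 * ((w + lam * e2 * W s) / 2) = 2^-1 * (e1 * (e1 * w) + lam * (e1 * (e1 * e2)) * W s).
    by field.
  by rewrite E; ring.
have e0 : (0 <= (2 * expR (- (lam * t)))%:E)%E by rewrite lee_fin mulr_ge0// expR_ge0.
apply: le_trans (lee_wpmul2l e0 Yint); rewrite -EFinM lee_fin /Y.
have := expRlN lam t; rewrite -mulNr; set e1 := expR (lam * t); set e2 := expR (- lam * t) => E.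
have -> : 2 * e2 * (2^-1 * (e1 * W t)) = (e1 * e2) * W t by field.
by rewrite E mul1r.
Qed.

Lemma flow_dist_le_primitive v t : domain phi v -> 0 <= t ->
  expR (lam * t) / 2 * mdist (u t) v ^+ 2 - 2^-1 * mdist (u 0) v ^+ 2 <=
  Efun lam t * (fr v - fr (u 0)) + W t.
Proof.
move=> dv t0.
pose z1 s := expR (lam * s) * mdist (u s) v ^+ 2.
pose z2 s := (- 2 * (fr v - fr (u 0))) * Efun lam s + (- 2) * W s.
have D2 s : 0 <= s -> is_derive s (1 : R) z2 ((- 2 * (fr v - fr (u 0))) * expR (lam * s) +
    (- 2) * (expR (lam * s) * (fr (u 0) - fr (u s)))).
  by move=> s0; exact: (is_deriveD (is_derive_EfunZ _ _ _) (is_deriveZ (- 2) (W' s0))).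
have I1 : dini_on z1 0 t (fun s => 2 * expR (lam * s) * (fr v - fr (u s))).
  split.
  - by move=> s /andP[s0 _]; apply: curve0_weighted_left; first exact: ef_cont uf.
  - by apply: curve0_weighted_right; first exact: ef_cont uf.
  - by move=> s /andP[s0 _]; apply: flow_dini_weighted => //; [exact: ltW|exact: ef_dom uf _ s0].
have I2 := is_derive_dini_on t0 (fun s (H : 0 <= s <= t) => D2 s (elimTF andP H).1).
have := dini_on_nonincreasing t0 (dini_onD I1 I2).
rewrite /z1 /z2 Efun0 W0 !mulr0 expR0 mul1r !addr0 => H.
suff : forall s, 0 < s < t -> 2 * expR (lam * s) * (fr v - fr (u s)) +
   ((- 2 * (fr v - fr (u 0))) * expR (lam * s) +
    (- 2) * (expR (lam * s) * (fr (u 0) - fr (u s)))) <= 0.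
  by move=> /H; lra.
by move=> s _; lra.
Qed.

End primitive_of_energy_drop.

Lemma flow_expansion_moreau_yosida u v t : evi_flow u -> domain phi (u 0) -> domain phi v -> 0 <= t ->
  ((expR (lam * t) / 2 * mdist (u t) v ^+ 2)%:E - (2^-1 * mdist (u 0%R) v ^+ 2)%:E
    <= (Eint lam t)%:E * (phi v - phi (u 0%R))
      + (2 * expR (- (lam * t)))%:E * \int[mu]_(s in `]0%R, t[)
        ((expR (2 * lam * s))%:E * (phi (u 0%R) - moreau_yosida phi (Eint lam s) (u 0%R))))%E.
Proof.
move=> uf d0 dv t0.
pose h s := expR (lam * s) * (fr (u 0) - fr (u (Num.max s 0))).
have hc : continuous h.
  move=> s; apply: cvgM; first exact: continuous_expRl.
  by apply: cvgB; [exact: cvg_cst|exact: energy_max0_continuous].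
have [W [W0 hW]] := exists_primitive hc.
have W' s : 0 <= s -> is_derive s (1 : R) W (expR (lam * s) * (fr (u 0) - fr (u s))).
  by move=> s0; have := hW s s0; rewrite /h max_l.
apply: le_trans (leeD2l _ (primitive_le_integral uf d0 W0 W' t0)).
rewrite EintE// (domK dv) (domK d0) -!EFinB -EFinM -EFinD lee_fin.
exact: flow_dist_le_primitive.
Qed.

(** * Regularity in time *)

Lemma itv_cc_gt0 a b : a <= b -> `[a, b] `<=` `]0, +oo[ -> 0 < a.
Proof. by move=> ab /(_ a); rewrite /= !in_itv/= lexx ab => /(_ isT)/andP[]. Qed.

Lemma flow_locally_lipschitz u : evi_flow u -> locally_lipschitz_on `]0, +oo[ u.
Proof.
move=> uf a b ab /(itv_cc_gt0 ab) a0.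
have [c c0 H] := flow_slope_bound_itv b uf a0.
have le_c s t : a <= s -> s <= t -> t <= b -> mdist (u t) (u s) <= c * (t - s).
  move=> as_ st tb; apply: (flow_dist_le uf) => //.
    by apply: le_trans as_; exact: ltW.
  move=> r /andP[sr rt]; apply: H.
  by rewrite (le_trans as_ (ltW sr)) (le_trans (ltW rt) tb).
exists c => s t; rewrite !in_itv/= => /andP[s1 s2] /andP[t1 t2].
have [st|/ltW ts] := leP s t.
  by rewrite metric_sym distrC ger0_norm ?subr_ge0//; exact: le_c.
by rewrite ger0_norm ?subr_ge0//; exact: le_c.
Qed.

Lemma flow_slope_domain u t : evi_flow u -> 0 < t -> domain (slope phi) (u t).
Proof.
move=> uf t0; rewrite /domain/= -(global_slope_eq_slope uf (ltW t0)).
exact: (global_slope_fin uf).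
Qed.

Lemma flow_energy_nonincreasing u s t : evi_flow u -> 0 <= s -> s <= t -> (phi (u t) <= phi (u s))%E.
Proof.
move=> uf s0 st; case: (pselect (domain phi (u s))) => [ds|/not_dom ->]; last by rewrite leey.
rewrite (domK ds) (domK (flow_domS uf s0 ds st)) lee_fin.
exact: flow_nonincreasing uf _ _ _.
Qed.

(* With g = g(m): f s - f m >= q1^2 g^2 (m - s) and f m - f t <= q2^2 g^2 (t - m). *)
Lemma flow_energy_three_points u s m t q1 q2 g : evi_flow u -> 0 <= s -> s < m < t ->
  domain phi (u s) -> gs (u m) = g%:E -> 0 <= q1 ->
  (forall r, s < r < m -> q1 <= expR (lam * (m - r))) ->
  (forall r, m < r < t -> expR (- lam * (r - m)) <= q2) ->
  (t - s) * fr (u m) <= (t - m) * fr (u s) + (m - s) * fr (u t)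
    + (q2 ^+ 2 - q1 ^+ 2) * g ^+ 2 * ((m - s) * (t - m)).
Proof.
move=> uf s0 /andP[sm mt] ds gE q10 Q1 Q2.
have m0 : 0 < m by exact: le_lt_trans sm.
have g0 : 0 <= g by rewrite -lee_fin -gE global_slope_ge0.
have A1 : (q1 * g) ^+ 2 * (m - s) <= fr (u s) - fr (u m).
  apply: (energy_drop_ge uf s0 (ltW sm) ds); first by rewrite mulr_ge0.
  move=> r /andP[sr rm]; have r0 : 0 < r by exact: le_lt_trans sr.
  have [gr gr0 grE] := flow_slope_fine uf r0; rewrite grE lee_fin.
  have := flow_slope_decay uf (ltW r0) (ltW rm) grE gE.
  move=> D; apply: (@le_trans _ _ (expR (lam * (m - r)) * g)).
    by rewrite ler_wpM2r// Q1// sr.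
  by rewrite -[leRHS]mul1r -(expRlN lam (m - r)) -mulrA ler_pM2l ?expR_gt0.
have A2 : fr (u m) - fr (u t) <= (q2 * g) ^+ 2 * (t - m).
  apply: (energy_drop_le uf (ltW m0) (ltW mt) (ef_dom uf m0)).
  move=> r /andP[mr rt]; have r0 : 0 < r by exact: lt_trans mr.
  have [gr gr0 grE] := flow_slope_fine uf r0; rewrite grE lee_fin.
  apply: le_trans (flow_slope_decay uf (ltW m0) (ltW mr) gE grE) _.
  by rewrite ler_wpM2r// Q2// mr.
have B1 : (t - m) * ((q1 * g) ^+ 2 * (m - s)) <= (t - m) * (fr (u s) - fr (u m)).
  by rewrite ler_pM2l// subr_gt0.
have B2 : (m - s) * (fr (u m) - fr (u t)) <= (m - s) * ((q2 * g) ^+ 2 * (t - m)).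
  by rewrite ler_pM2l// subr_gt0.
rewrite !exprMn in B1 B2.
lra.
Qed.

(** For nonnegative [lam] the slope is nonincreasing, so [q1 = q2 = 1] and the error term
    vanishes. *)
Lemma flow_energy_convex u : evi_flow u -> 0 <= lam -> econvex_on `[0, +oo[ (phi \o u).
Proof.
move=> uf l0; apply: econvex_on_three_points => [t|s m t]; first exact: phi_gtNy.
rewrite /= !in_itv/= !andbT => s0 t0 /andP[sm mt] ds dt.
have m0 : 0 < m by exact: le_lt_trans sm.
split; first exact: (ef_dom uf).
have [g g0 gE] := flow_slope_fine uf m0.
have smt : s < m < t by rewrite sm.
have := @flow_energy_three_points u s m t 1 1 g uf s0 smt ds gE ler01.
rewrite subrr !mul0r addr0; apply => r /andP[h1 h2].
- by rewrite leNgt expR_lt1 -leNgt mulr_ge0// subr_ge0 ltW.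
- by rewrite expR_le1 mulNr oppr_le0 mulr_ge0// subr_ge0 ltW.
Qed.

(** The error term is at most [M c^2 (t - s) (m - s) (t - m)], and [(t - s) (m - s) (t - m)] is
    precisely the convexity gap of the square function, which explains the added multiple of
    [t ^+ 2]. *)
Lemma flow_energy_semiconvex u : evi_flow u -> lam < 0 ->
  locally_semiconvex_on `]0, +oo[ (phi \o u).
Proof.
move=> uf l0 a b ab /(itv_cc_gt0 ab) a0.
have [c c0 Hc] := flow_slope_bound_itv b uf a0.
(* A bound for the growth rate of the exponentials that appear as [q1] and [q2] below, over the
   whole of [[a, b]]. *)
pose M := - 2 * lam * expR (- 2 * lam * (b - a)).
have M0 : 0 <= M by rewrite mulr_ge0 ?expR_ge0//; lra.
exists (M * c ^+ 2); apply: econvex_on_three_points => [t|s m t].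
  have := phi_gtNy (u t); rewrite /=; case: (phi (u t)) => // r _.
    by rewrite -EFinD ltNyr.
rewrite /= !in_itv/= => /andP[as_ sb] /andP[at_ tb] /andP[sm mt] _ _.
have s0 : 0 < s by exact: lt_le_trans as_.
have m0 : 0 < m by exact: lt_trans sm.
have t0 : 0 < t by exact: lt_trans mt.
have dm := ef_dom uf m0; have ds := ef_dom uf s0; have dt := ef_dom uf t0.
split; first by rewrite (domK dm) -EFinD ltry.
have [g g0 gE] := flow_slope_fine uf m0.
have smt : s < m < t by rewrite sm.
have gc : g <= c by rewrite -lee_fin -gE; apply: Hc; apply/andP; split; lra.
have g2c : g ^+ 2 <= c ^+ 2 by rewrite lerXn2r ?nnegrE// ltW.
have := @flow_energy_three_points u s m t (expR (lam * (m - s))) (expR (- lam * (t - m))) g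
  uf (ltW s0) smt ds gE (expR_ge0 _).
have Q1 r : s < r < m -> expR (lam * (m - s)) <= expR (lam * (m - r)).
  by move=> /andP[h1 h2]; rewrite ler_expR ler_wnM2l//; lra.
have Q2 r : m < r < t -> expR (- lam * (r - m)) <= expR (- lam * (t - m)).
  by move=> /andP[h1 h2]; rewrite ler_expR ler_wpM2l//; lra.
move=> /(_ Q1 Q2).
rewrite !expr2 -!expRD -!expr2.
set P := (m - s) * (t - m).
have P0 : 0 <= P by rewrite mulr_ge0// subr_ge0 ltW.
set q2 := expR _; set q1 := expR _ => K.
have q21 : q2 - q1 <= M * (t - s).
  clear -l0 as_ tb sm mt q1 q2 M.
  have e1 := expR_ge1Dx (lam * (m - s) + lam * (m - s)).
  have e2 : q2 - 1 <= - 2 * lam * (t - m) * q2.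
    have := expR_ge1Dx (- (- lam * (t - m) + - lam * (t - m))).
    rewrite -(ler_pM2l (expR_gt0 (- lam * (t - m) + - lam * (t - m)))) -/q2.
    by rewrite -expRD subrr expR0; lra.
  have e3 : q2 <= expR (- 2 * lam * (b - a)).
    rewrite ler_expR; have : - lam * (t - m) <= - lam * (b - a) by rewrite ler_wpM2l//; lra.
    lra.
  have e4 : - 2 * lam * (t - m) * q2 <= - 2 * lam * (t - m) * expR (- 2 * lam * (b - a)).
    by rewrite ler_wpM2l// mulr_ge0//; lra.
  have e5 : 1 <= expR (- 2 * lam * (b - a)).
    by rewrite leNgt expR_lt1 -leNgt mulr_ge0//; lra.
  have e6 : (- 2 * lam * (m - s)) * 1 <= (- 2 * lam * (m - s)) * expR (- 2 * lam * (b - a)).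
    by rewrite ler_wpM2l// mulr_ge0//; lra.
  rewrite /M -/q1 in e1 *; lra.
have K2 : (q2 - q1) * g ^+ 2 <= M * (t - s) * c ^+ 2.
  apply: (@le_trans _ _ (M * (t - s) * g ^+ 2)); first by rewrite ler_wpM2r ?sqr_ge0.
  by rewrite ler_wpM2l// mulr_ge0//; lra.
have K3 : (q2 - q1) * g ^+ 2 * P <= M * (t - s) * c ^+ 2 * P by rewrite ler_wpM2r.
rewrite (domK dm) (domK ds) (domK dt) /= /P in K K3 *; lra.
Qed.

Lemma flow_slope_weighted_nonincreasing u s t : evi_flow u -> 0 <= s -> s <= t ->
  ((expR (lam * t))%:E * slope phi (u t) <= (expR (lam * s))%:E * slope phi (u s))%E.
Proof.
move=> uf s0 st; have t0 : 0 <= t by exact: le_trans st.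
rewrite -!(global_slope_eq_slope uf)//.
have := global_slope_ge0 (u s); case E : (gs (u s)) => [g| |]// g0; last first.
  by rewrite (@gt0_muley _ (expR (lam * s))%:E) ?leey// lte_fin expR_gt0.
have := global_slope_decay uf s0 st (c := g); rewrite E lexx => /(_ isT) K.
have e0 : (0 <= (expR (lam * t))%:E)%E by rewrite lee_fin expR_ge0.
apply: le_trans (lee_wpmul2l e0 K) _.
rewrite -!EFinM lee_fin mulrA -expRD le_eqVlt; apply/orP; left; apply/eqP.
by congr (expR _ * _); ring.
Qed.

Lemma flow_slope_weighted_right_cvg u t : evi_flow u -> 0 <= t ->
  ((expR (lam * s))%:E * slope phi (u s))%E @[s --> t^'+]
    --> ((expR (lam * t))%:E * slope phi (u t))%E.
Proof.
move=> uf t0; rewrite -(global_slope_eq_slope uf t0).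
apply: (@cvg_trans _ (((expR (lam * s))%:E * gs (u s))%E @[s --> t^'+])).
  apply: near_eq_cvg; apply: filterS (nbhs_right_gt t) => s ts.
  by rewrite (global_slope_eq_slope uf)// (le_trans t0)// ltW.
apply: cvgeM; last exact: (flow_slope_right_cvg uf t0).
  by case: (gs (u t)) => [r| |]; rewrite /mule_def/= ?gt_eqF ?expR_gt0.
by apply: cvg_EFin; [exact: nearW|apply: cvg_at_right_filter; exact: continuous_expRl].
Qed.

(** * Large times *)

Lemma flow_dist_le_slope u t g : evi_flow u -> 0 <= t -> gs (u 0) = g%:E ->
  mdist (u t) (u 0) <= Efun (- lam) t * g.
Proof.
move=> uf t0 gE.
pose z s := mdist (u s) (u 0).
pose k s := - g * Efun (- lam) s.
have I1 : dini_on z 0 t (fun s => expR (- lam * s) * g).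
  apply: dini_on_cvg.
  - by move=> s /andP[s0 st]; exact: (flow_dist_cvg_left uf s0).
  - exact: (flow_dist_cvg_right uf (lexx 0)).
  - move=> s /andP[s0 st].
    have [gs_ gs0 gsE] := flow_slope_fine uf s0.
    have gsle : (gs (u s) <= gs_%:E)%E by rewrite gsE.
    apply: dini_leW (flow_dist_dini _ uf (ltW s0) gsle).
    by have := flow_slope_decay uf (lexx 0) (ltW s0) gE gsE; rewrite subr0.
have I2 := is_derive_dini_on t0 (fun s (_ : 0 <= s <= t) => is_derive_EfunZ (- g) (- lam) s).
have := dini_on_nonincreasing t0 (dini_onD I1 I2).
rewrite /z mdistxx Efun0 mulr0 addr0 => H.
suff : forall s, 0 < s < t -> expR (- lam * s) * g + - g * expR (- lam * s) <= 0.
  by move=> /H; lra.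
by move=> s _; lra.
Qed.

(** Zero global slope is a minimum property with quadratic gain; it serves as common notion of rest
    point for positive and for zero [lam]. *)
Lemma global_slope0P x : gs x = 0%E <->
  domain phi x /\ forall y, domain phi y -> fr x + lam / 2 * mdist x y ^+ 2 <= fr y.
Proof.
split=> [gx|[dx H]].
  have dx : domain phi x by apply: global_slope_dom; rewrite gx ltry.
  split=> // y dy; have := (global_slope_leP dx (lexx 0)).1 _ y dy.
  by rewrite gx lexx mul0r => /(_ isT); lra.
apply/eqP; rewrite eq_le global_slope_ge0 andbT.
apply/(global_slope_leP dx (lexx 0)) => y dy.
by have := H y dy; rewrite mul0r; lra.
Qed.

Lemma minimum_global_slope0 x : (exists y, domain phi y) -> lam <= 0 ->
  is_minimum_point phi x -> gs x = 0%E.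
Proof.
move=> [y0 dy0] l0 mx.
have dx : domain phi x by exact: le_lt_trans (mx y0) dy0.
apply/global_slope0P; split=> // y dy.
have := mx y; rewrite (domK dx) (domK dy) lee_fin => H.
have : lam * mdist x y ^+ 2 <= 0 by rewrite mulr_le0_ge0// sqr_ge0.
lra.
Qed.

Lemma global_slope0_minimum x : 0 <= lam -> gs x = 0%E -> is_minimum_point phi x.
Proof.
move=> l0 /global_slope0P[dx H] y.
case: (pselect (domain phi y)) => [dy|/not_dom ->]; last by rewrite leey.
rewrite (domK dx) (domK dy) lee_fin.
have : 0 <= lam * mdist x y ^+ 2 by rewrite mulr_ge0// sqr_ge0.
by have := H y dy; lra.
Qed.

(** Makes convergence to a rest point an instance of contraction between two flows. *)
Lemma constant_flow x : gs x = 0%E -> evi_flow (fun=> x).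
Proof.
move=> /global_slope0P[dx H]; split => //.
  by move=> t _ e e0; exists 1 => // s _ _; rewrite mdistxx.
move=> s t v s0 st dv.
have E0 : 0 <= Efun lam (t - s) by rewrite Efun_ge0// subr_ge0.
have := mulEfun lam (t - s); set E := Efun lam _ in E0 * => EE.
have : E * (fr x + lam / 2 * mdist x v ^+ 2) <= E * fr v by rewrite ler_wpM2l// H.
have -> : expR (lam * (t - s)) = 1 + lam * E by rewrite EE; ring.
lra.
Qed.

Section rest_point.
Variables (u : R -> X) (x : X).
Hypotheses (uf : evi_flow u) (gx : gs x = 0%E).

Lemma dist_rest_point s t : 0 <= s -> s <= t ->
  mdist (u t) x <= mdist (u s) x * expR (- lam * (t - s)).
Proof.
move=> s0 st; rewrite mulrC.
exact: (flow_contraction uf (constant_flow gx)).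
Qed.

Lemma energy_rest_point s t : 0 <= s -> s < t ->
  (phi (u t) - phi x <= ((2 * Efun lam (t - s))^-1 * mdist (u s) x ^+ 2)%:E)%E.
Proof.
move=> s0 st; have t0 : 0 < t by exact: le_lt_trans st.
have [dx _] := (global_slope0P x).1 gx; have dt := ef_dom uf t0.
have E0 : 0 < Efun lam (t - s) by rewrite Efun_gt0// subr_gt0.
rewrite (domK dx) (domK dt) -EFinB lee_fin mulrC ler_pdivlMr ?mulr_gt0//.
have := ef_evi uf s0 (ltW st) dx.
have : 0 <= expR (lam * (t - s)) * mdist (u t) x ^+ 2 by rewrite mulr_ge0 ?expR_ge0 ?sqr_ge0.
lra.
Qed.

Lemma slope_rest_point s t : 0 <= lam -> 0 <= s -> s < t ->
  (slope phi (u t) <= ((Efun lam (t - s))^-1 * mdist (u s) x)%:E)%E.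
Proof.
move=> l0 s0 st; have t0 : 0 < t by exact: le_lt_trans st.
have ts : 0 < t - s by rewrite subr_gt0.
rewrite -(global_slope_eq_slope uf (ltW t0)).
have [g g0 gE] := flow_slope_fine uf t0.
have [dx _] := (global_slope0P x).1 gx; have dt := ef_dom uf t0.
have := @flow_a_priori _ x (t - s) g (evi_flow_shift s0 uf) dx ts.
rewrite subrKC addr0 => /(_ gE).
have E0 : 0 < Efun lam (t - s) by rewrite Efun_gt0.
have F1 : 0 <= Efun lam (t - s) * (fr (u t) - fr x).
  rewrite mulr_ge0 ?(ltW E0)// subr_ge0.
  by have := global_slope0_minimum l0 gx (u t); rewrite (domK dx) (domK dt) lee_fin.
have F2 : 0 <= expR (lam * (t - s)) / 2 * mdist (u t) x ^+ 2.
  by rewrite mulr_ge0 ?sqr_ge0// divr_ge0// expR_ge0.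
move=> K; rewrite gE lee_fin mulrC ler_pdivlMr//.
apply: sqr_le_of_le; [by rewrite mulr_ge0// ltW| |exact: mdist_ge0].
by rewrite exprMn; lra.
Qed.

Lemma energy_gap_ge t : 0 < t -> ((lam / 2 * mdist (u t) x ^+ 2)%:E <= phi (u t) - phi x)%E.
Proof.
move=> t0; have [dx H] := (global_slope0P x).1 gx; have dt := ef_dom uf t0.
rewrite (domK dx) (domK dt) -EFinB lee_fin metric_sym.
by have := H _ dt; lra.
Qed.

(** The global slope at [u t], tested at [x], bounds the gap by [g D - lam D^2 / 2], whose maximum
    over [D] is the right-hand side. *)
Lemma energy_gap_le_real t g : 0 < lam -> 0 < t -> gs (u t) = g%:E ->
  fr (u t) - fr x <= (2 * lam)^-1 * g ^+ 2.
Proof.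
move=> l0 t0 gE; have [dx _] := (global_slope0P x).1 gx; have dt := ef_dom uf t0.
have g0 : 0 <= g by rewrite -lee_fin -gE global_slope_ge0.
have := (global_slope_leP dt g0).1 _ x dx; rewrite gE lexx => /(_ isT).
set D := mdist _ _ => K.
have : 0 <= (lam * D - g) ^+ 2 / (2 * lam) by rewrite divr_ge0 ?sqr_ge0// mulr_ge0// ltW.
have -> : (lam * D - g) ^+ 2 / (2 * lam) = lam / 2 * D ^+ 2 - g * D + (2 * lam)^-1 * g ^+ 2.
  by field; rewrite gt_eqF.
lra.
Qed.

Lemma energy_gap_le t : 0 < lam -> 0 < t ->
  (phi (u t) - phi x <= ((2 * lam)^-1)%:E * slope phi (u t) ^+ 2)%E.
Proof.
move=> l0 t0; have [dx _] := (global_slope0P x).1 gx; have dt := ef_dom uf t0.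
rewrite -(global_slope_eq_slope uf (ltW t0)).
have [g g0 gE] := flow_slope_fine uf t0.
rewrite gE (domK dx) (domK dt) -EFin_expe -EFinB -EFinM lee_fin.
exact: energy_gap_le_real.
Qed.

(** The gap falls at rate at least [g ^+ 2], which by [energy_gap_le_real] is at least [2 * lam]
    times the gap; the exponential weight integrates this. *)
Lemma energy_gap_decay s t : 0 < lam -> 0 <= s -> s < t ->
  (phi (u t) - phi x <= (phi (u s) - phi x) * (expR (- (2 * lam) * (t - s)))%:E)%E.
Proof.
move=> l0 s0 st; have t0 : 0 < t by exact: le_lt_trans st.
have [dx _] := (global_slope0P x).1 gx; have dt := ef_dom uf t0.
case: (pselect (domain phi (u s))) => [ds|/not_dom ->]; last first.
  by rewrite (domK dx) -EFinN addye// gt0_mulye ?leey// lte_fin expR_gt0.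
rewrite (domK dx) (domK dt) (domK ds) -!EFinB -EFinM lee_fin.
pose B r := expR (2 * lam * r).
pose z r := fr (u r) - fr x.
pose g r := fine (gs (u r)).
have gE r : 0 < r -> gs (u r) = (g r)%:E.
  by move=> /(flow_slope_fine uf)[q _ qE]; rewrite /g qE.
have I : dini_on (fun r => B r * z r) s t (fun r => B r * - g r ^+ 2 + 2 * lam * B r * z r).
  apply: (dini_on_cvgM (dB := fun r => 2 * lam * B r)) (ltW st) _ _ _ _ _.
  - by move=> r _; exact: is_derive_expRl.
  - by move=> r _; exact: expR_gt0.
  - move=> r /andP[sr _]; apply: cvgB; last exact: cvg_cst.
    exact: (flow_energy_cvg_left uf (le_lt_trans s0 sr)).
  - by apply: cvgB; [exact: (flow_energy_cvg_right uf s0 ds)|exact: cvg_cst].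
  - move=> r /andP[sr _]; have r0 := le_lt_trans s0 sr.
    have := dini_leD (flow_energy_dini uf (ltW r0) (ef_dom uf r0) (gE r r0))
        (is_derive_dini_le (is_derive_cst (- fr x) r (1 : R))).
    by rewrite addr0.
have := dini_on_nonincreasing (ltW st) I => /(_ _)/wrap[r /andP[sr _]|].
  have r0 := le_lt_trans s0 sr; have B0 : 0 < B r by exact: expR_gt0.
  have K := energy_gap_le_real l0 r0 (gE r r0).
  have : B r * (2 * lam * z r) <= B r * g r ^+ 2.
    rewrite ler_pM2l//; have : 2 * lam * z r <= 2 * lam * ((2 * lam)^-1 * g r ^+ 2).
      by rewrite ler_pM2l// mulr_gt0.
    by rewrite mulrA mulfV ?mul1r// gt_eqF// mulr_gt0.
  lra.
rewrite -/(z s) -/(z t) => K.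
rewrite -(ler_pM2l (expR_gt0 (2 * lam * t))) -/(B t); apply: le_trans K _.
rewrite mulrCA -expRD /B mulrC le_eqVlt; apply/orP; left; apply/eqP.
by congr (_ * expR _); ring.
Qed.

End rest_point.

Lemma flow_slope_decay_slope u s t : evi_flow u -> 0 <= s -> s <= t ->
  (slope phi (u t) <= slope phi (u s) * (expR (- lam * (t - s)))%:E)%E.
Proof.
move=> uf s0 st; have t0 : 0 <= t by exact: le_trans st.
rewrite -!(global_slope_eq_slope uf)//.
have := global_slope_ge0 (u s); case E : (gs (u s)) => [g| |]// g0; last first.
  by rewrite gt0_mulye ?leey// lte_fin expR_gt0.
have := global_slope_decay uf s0 st (c := g); rewrite E lexx => /(_ isT).
by rewrite -EFinM mulrC.
Qed.

(** Along integer times the slope decays geometrically and bounds the distance still to be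
    travelled, so the points form a Cauchy sequence within a sublevel; at the limit, lower
    semicontinuity makes the global slope 0. *)
Lemma complete_rest_point u : 0 < lam -> (forall c, complete_set (sublevel phi c)) -> evi_flow u ->
  exists x, gs x = 0%E.
Proof.
move=> l0 compl uf.
have [g g0 gE] := flow_slope_fine uf ltr01.
(* Times are counted from 1, where the slope is known to be finite. *)
pose k n : R := expR (- lam * n%:R) * g.
have gk (n : nat) t : n%:R <= t -> (gs (u (1 + t)%R) <= (k n)%:E)%E.
  move=> nt; have t0 : 0 <= t by exact: le_trans (ler0n _ n) nt.
  have t1 : 1 <= 1 + t by rewrite lerDl.
  have := global_slope_decay uf ler01 t1 (c := g); rewrite gE lexx => /(_ isT).
  rewrite addrAC subrr add0r => /le_trans; apply; rewrite lee_fin ler_wpM2r// ler_expR.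
  by rewrite ler_nM2l// oppr_lt0.
have dk (n m : nat) : (n <= m)%N -> mdist (u (1 + m%:R)) (u (1 + n%:R)) <= lam^-1 * k n.
  move=> nm; have n0 : 0 <= 1 + n%:R :> R by rewrite addr_ge0.
  have n0' : 0 < 1 + n%:R :> R by rewrite ltr_pwDl.
  have [gn gn0 gnE] := flow_slope_fine uf n0'.
  have mn0 : 0 <= m%:R - n%:R :> R by rewrite subr_ge0 ler_nat.
  have := flow_dist_le_slope (evi_flow_shift n0 uf) mn0 (g := gn).
  rewrite addr0 -addrA subrKC => /(_ gnE)/le_trans; apply.
  apply: ler_pM => //; first exact: Efun_ge0.
    have := mulEfun (- lam) (m%:R - n%:R); set E := Efun _ _ => EE.
    rewrite -(ler_pM2l l0) mulfV ?gt_eqF//.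
    by have := expR_ge0 (- lam * (m%:R - n%:R)); lra.
  by rewrite -lee_fin -gnE; exact: gk.
have k_cvg : k n @[n --> \oo] --> 0.
  rewrite -[X in _ --> X](mul0r g); apply: cvgM; last exact: cvg_cst.
  have -> : (fun n : nat => expR (- lam * n%:R)) = (fun n => expR (- lam) ^+ n).
    by apply/funext => n; rewrite mulrC expRM_natl.
  by apply: cvg_expr; rewrite ger0_norm ?expR_ge0// expR_lt1 oppr_lt0.
have k_small e : 0 < e -> exists N, forall n, (N <= n)%N -> k n < e.
  move=> e0; move/cvgrPdist_lt : k_cvg => /(_ e e0)[N _ HN]; exists N => n Nn.
  by have := HN n Nn; rewrite /= sub0r normrN; apply: le_lt_trans; exact: ler_norm.
pose w n := u (1 + n%:R).
have wS n : sublevel phi (fr (u 1)) (w n).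
  rewrite /sublevel/= -(domK (ef_dom uf ltr01)).
  by apply: (flow_energy_nonincreasing uf); rewrite // lerDl.
have [|x Sx wx] := compl _ w wS.
  apply/cauchy_exP => e e0; have le0 : 0 < lam * e by rewrite mulr_gt0.
  have [N HN] := k_small _ le0; exists (w N), N => // n /= Nn.
  rewrite ballEmdist/= metric_sym; apply: le_lt_trans (dk _ _ Nn) _.
  by rewrite mulrC ltr_pdivrMr// mulrC HN.
exists x; apply/eqP; rewrite eq_le global_slope_ge0 andbT leNgt; apply/negP => gx.
have [c c0 cg] : exists2 c, 0 < c & (c%:E < gs x)%E.
  move: gx; case: (gs x) => [r| |]//; last by exists 1; rewrite ?ltry.
  by rewrite lte_fin => r0; exists (r / 2); rewrite ?lte_fin; lra.
have [r r0 Hr] := global_slope_lsc (flow_proper uf) cg.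
have [N HN] := k_small c c0.
have /metricType_numDomainType.cvgr_dist_lt/(_ r r0)[M _ HM] := wx.
pose n := maxn N M.
have : (c%:E < gs (w n))%E by apply: Hr; rewrite metric_sym; apply: HM; exact: leq_maxr.
have : (gs (w n) <= (k n)%:E)%E by exact: gk.
move=> /[swap] /lt_le_trans/[apply]; rewrite lte_fin.
by have := HN n (leq_maxl _ _); lra.
Qed.

(** Compactness gives a cluster point [x]. A positive global slope at [x] would, by monotonicity,
    bound the slope below at all times from 1 up to arbitrarily late ones and exhaust the energy. As
    the distance to a rest point is nonincreasing, clustering becomes convergence. *)
Lemma compact_rest_point u : lam = 0 -> (forall c, compact (sublevel phi c)) -> evi_flow u ->
  exists2 x, gs x = 0%E & u t @[t --> +oo] --> x.
Proof.
move=> l0 comp uf.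
have d1 := ef_dom uf ltr01.
have uS : (u @ +oo) (sublevel phi (fr (u 1))).
  exists 1; split; first exact: num_real.
  move=> t /ltW t1; rewrite /sublevel/= -(domK d1).
  exact: (flow_energy_nonincreasing uf).
have [x [Sx clx]] := comp _ (u @ +oo) _ uS.
have freq d T : 0 < d -> exists2 t, T < t & mdist (u t) x < d.
  move=> d0; have [||y [[t Tt <-] xt]] := clx (u @` [set t | T < t]) (ball x d).
  - by exists T; split; [exact: num_real|move=> t Tt; exists t].
  - exact: nbhsx_ballx.
  - by exists t => //; move: xt; rewrite ballEmdist/= metric_sym.
have dx : domain phi x by rewrite /domain/=; apply: le_lt_trans Sx _; exact: ltry.
have fx t : 0 < t -> fr x - 1 <= fr (u t).
  move=> t0; have [|d d0 H] := lsc_fine dx (a := fr x - 1); first lra.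
  have [s ts sx] := freq d t d0.
  have dt := ef_dom uf t0.
  apply: (@le_trans _ _ (fr (u s))); last exact: (flow_nonincreasing uf (ltW t0) dt (ltW ts)).
  by apply/ltW/H => //; apply: (ef_dom uf); exact: lt_trans ts.
have gx : gs x = 0%E.
  apply/eqP; rewrite eq_le global_slope_ge0 andbT leNgt; apply/negP => gx.
  have [c c0 cg] : exists2 c, 0 < c & (c%:E < gs x)%E.
    move: gx; case: (gs x) => [r| |]//; last by exists 1; rewrite ?ltry.
    by rewrite lte_fin => r0; exists (r / 2); rewrite ?lte_fin; lra.
  have [r r0 Hr] := global_slope_lsc (flow_proper uf) cg.
  have c20 : 0 < c ^+ 2 by rewrite exprn_gt0.
  pose D := fr (u 1) - fr x + 1.
  have D0 : 0 <= D by have := fx 1 ltr01; rewrite /D; have := lexx (fr x);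
    move: Sx; rewrite /sublevel/= (domK dx) lee_fin; lra.
  (* So late that the energy lost since time 1 would exceed [D], the most that can be lost. *)
  have [t Tt tx] := freq r (2 + D / c ^+ 2) r0.
  have q0 : 0 <= D / c ^+ 2 by rewrite divr_ge0// ltW.
  have t1 : 1 <= t by lra.
  have t0 : 0 < t by lra.
  have := @energy_drop_ge u 1 t c uf ler01 t1 d1 (ltW c0).
  move=> /(_ _)/wrap[s /andP[s1 st]|].
    have s0 : 0 < s by lra.
    have [q _ qE] := flow_slope_fine uf s0.
    have [q' _ q'E] := flow_slope_fine uf t0.
    have qq : q' <= q.
      have := flow_slope_decay uf (ltW s0) (ltW st) qE q'E.
      by rewrite l0 oppr0 mul0r expR0 mul1r.
    by have := Hr _ tx; rewrite q'E qE lte_fin lee_fin; lra.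
  have := fx t t0.
  have : c ^+ 2 * (1 + D / c ^+ 2) < c ^+ 2 * (t - 1) by rewrite ltr_pM2l//; lra.
  by rewrite mulrDr mulr1 mulrCA mulfV ?gt_eqF// mulr1 /D; lra.
exists x => // A /metricType_numDomainType.nbhs_mdistP[r /= r0 Hr].
have [t /= t0 tx] := freq r 0 r0.
exists t; split; first exact: num_real.
move=> s /ltW ts; apply: Hr; rewrite /= metric_sym; apply: le_lt_trans tx.
by have := dist_rest_point uf gx (ltW t0) ts; rewrite l0 oppr0 mul0r expR0 mulr1.
Qed.

(** * Jumps of the slope and stability *)

Lemma slopes_left_shift u t (l : \bar R) : evi_flow u -> 0 < t -> gs (u s) @[s --> t^'-] --> l ->
  [/\ gs (u (t - h)) @[h --> (0 : R)^'+] --> l,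
      slope phi (u (t - h)) @[h --> (0 : R)^'+] --> l &
      length_slope phi (u (t - h)) @[h --> (0 : R)^'+] --> l].
Proof.
move=> uf t0 /cvg_left_shift gl; split => //; apply: cvg_trans gl; apply: near_eq_cvg;
  apply: filterS (nbhs_right_lt t0) => h ht; have th0 : 0 <= t - h by rewrite subr_ge0 ltW.
- exact: (global_slope_eq_slope uf th0).
- by rewrite (flow_length_slope uf th0).
Qed.

Lemma slope_left_lim u t L : evi_flow u -> 0 < t -> gs (u s) @[s --> t^'-] --> L%:E ->
  lim (slope phi (u (t - h)) @[h --> (0 : R)^'+]) = L%:E.
Proof.
move=> uf t0 gl; have [_ H _] := slopes_left_shift uf t0 gl.
by apply/cvg_lim; [exact: ereal_hausdorff|].
Qed.

Lemma left_energy_identities_jump_set u : evi_flow u ->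
  left_energy_identities lam phi u (slope_jump_set phi u).
Proof.
move=> uf; split=> t.
- move=> t0 /not_andP[//|/contrapT jump].
  have [L [L0 _ gL]] := flow_slope_left_cvg uf t0.
  move: jump; rewrite (slope_left_lim uf t0 gL) => sE.
  have gsE : gs (u t) = slope phi (u t).
    exact: (global_slope_eq_slope uf (ltW t0)).
  rewrite (flow_length_slope uf (ltW t0)) gsE -sE.
  exact: (left_energy_identity_flow uf t0 L0 gL).
- move=> [t0 _].
  have [L [L0 _ gL]] := flow_slope_left_cvg uf t0.
  have [H1 H2 H3] := slopes_left_shift uf t0 gL.
  split; [by apply/cvg_ex; exists L%:E|by apply/cvg_ex; exists L%:E|
          by apply/cvg_ex; exists L%:E|].
  rewrite (cvg_lim (@ereal_hausdorff R) H1) (cvg_lim (@ereal_hausdorff R) H2).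
  rewrite (cvg_lim (@ereal_hausdorff R) H3).
  exact: (left_energy_identity_flow uf t0 L0 gL).
Qed.

Lemma slope_left_lim_le u s t g L : evi_flow u -> 0 <= s -> s < t -> gs (u s) = g%:E ->
  gs (u r) @[r --> t^'-] --> L%:E -> expR (lam * t) * L <= expR (lam * s) * g.
Proof.
move=> uf s0 st gE gL; rewrite leNgt; apply/negP => N.
have NL : expR (lam * s) * g * expR (- lam * t) < L.
  rewrite mulrC -(ltr_pM2l (expR_gt0 (lam * t))) mulrA expRlN mul1r; exact: N.
have Kc : expR (lam * s) * g * expR (- lam * r) @[r --> t^'-]
    --> expR (lam * s) * g * expR (- lam * t).
  apply: cvgM; first exact: cvg_cst.
  by apply: cvg_at_left_filter; exact: continuous_expRl.
set K := _ * g in NL Kc.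
pose c := (K * expR (- lam * t) + L) / 2.
have c1 : K * expR (- lam * t) < c by rewrite /c; lra.
have c2 : c < L by rewrite /c; lra.
have [/(_ c c2) G1 _] := cvge_fin_bounds gL.
have G2 : \forall r \near t^'-, K * expR (- lam * r) < c.
  have := cvgr_lt _ Kc; exact.
have [r [Gr [Kr sr]]] := @filter_ex _ _ (at_left_proper_filter t) _
  (filterI G1 (filterI G2 (nbhs_left_gt st))).
have := global_slope_decay uf s0 (ltW sr) (c := g).
rewrite gE lexx => /(_ isT)/(lt_le_trans Gr); rewrite lte_fin => /(lt_trans Kr).
have -> : expR (- lam * (r - s)) * g = K * expR (- lam * r).
  by rewrite /K mulrAC -expRD; congr (expR _ * _); ring.
by rewrite ltxx.
Qed.

(** The weighted slope is nonincreasing, so a rational can be placed in each of its jumps, and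
    different jumps receive different rationals. *)
Lemma countable_slope_jump_set u : evi_flow u -> countable (slope_jump_set phi u).
Proof.
move=> uf; pose P t := expR (lam * t) * fine (gs (u t)).
have /choice[q Hq] : forall t, exists q : rat, slope_jump_set phi u t ->
    P t < ratr q /\ forall s, 0 < s < t -> ratr q < P s.
  move=> t; case: (pselect (slope_jump_set phi u t)) => [[t0 jump]|]; last by exists 0.
  have [L [L0 gtL gL]] := flow_slope_left_cvg uf t0.
  have [g g0 gE] := flow_slope_fine uf t0.
  have gL' : g < L.
    rewrite lt_neqAle -lee_fin -gE gtL andbT; apply/eqP => gLE; apply: jump.
    rewrite (slope_left_lim uf t0 gL) -(global_slope_eq_slope uf (ltW t0)).
    by rewrite gE gLE.
  have [q] := @rat_in_itvoo R (expR (lam * t) * g) (expR (lam * t) * L)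
    (ltac:(by rewrite ltr_pM2l ?expR_gt0)).
  rewrite in_itv/= => /andP[q1 q2]; exists q => _; rewrite /P gE; split => // s /andP[s0 st].
  have [g' _ g'E] := flow_slope_fine uf s0.
  by rewrite g'E; apply: lt_le_trans q2 (slope_left_lim_le uf (ltW s0) st g'E gL).
apply/countable_injP; exists (fun t => pickle (q t)) => s t; rewrite !inE => Js Jt.
move=> /(pcan_inj pickleK) qst.
have [s1 s2] := Hq s Js; have [t1 t2] := Hq t Jt.
have [st|ts|//] := ltgtP s t.
- by have := t2 s; rewrite (proj1 Js) st -qst => /(_ isT)/(lt_trans s1); rewrite ltxx.
- by have := s2 t; rewrite (proj1 Jt) ts qst => /(_ isT)/(lt_trans t1); rewrite ltxx.
Qed.

Lemma flow_slope_le_near u t (L : R) c : evi_flow u -> 0 < t ->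
  gs (u s) @[s --> t^'-] --> L%:E -> (gs (u t) <= L%:E)%E -> L < c ->
  exists2 d, 0 < d & forall s, t - d < s < t + d -> (gs (u s) <= c%:E)%E.
Proof.
move=> uf t0 gL gtL Lc.
have [_ /(_ c Lc)/near_leftP[dl dl0 Hl]] := cvge_fin_bounds gL.
have : \forall s \near t^'+, (gs (u s) < c%:E)%E.
  have [g g0 gE] := flow_slope_fine uf t0.
  have := flow_slope_right_cvg uf (ltW t0).
  rewrite gE => /cvge_fin_bounds[_]; apply.
  by rewrite -lte_fin -gE (le_lt_trans gtL).
move=> /near_rightP[dr dr0 Hr]; exists (Num.min dl dr); first by rewrite lt_min dl0.
have [m1 m2] : Num.min dl dr <= dl /\ Num.min dl dr <= dr by rewrite !ge_min !lexx orbT.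
move=> s /andP[s1 s2]; have [st|ts|->] := ltgtP s t.
- by apply/ltW/Hl; rewrite st andbT; lra.
- by apply/ltW/Hr; rewrite ts/=; lra.
- by apply: le_trans gtL _; rewrite lee_fin ltW.
Qed.

Section stability.
Variables (un : nat -> R -> X) (u : R -> X).
Hypotheses (unf : forall n, evi_flow (un n)) (uf : evi_flow u).
Hypothesis un0 : un n 0 @[n --> \oo] --> u 0.

Lemma stability_dist b e : 0 < e ->
  \forall n \near \oo, forall s, 0 <= s <= b -> mdist (u s) (un n s) < e.
Proof.
move=> e0; pose k := expR (`|lam| * b); have k0 : 0 < k by exact: expR_gt0.
have /metricType_numDomainType.cvgr_dist_lt/(_ (e / k)) := un0.
rewrite divr_gt0// => /(_ isT); apply: filterS => n Hn s /andP[s0 sb].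
apply: le_lt_trans (flow_contraction uf (unf n) (lexx 0) s0) _.
rewrite subr0; apply: (@le_lt_trans _ _ (k * mdist (u 0) (un n 0))).
  rewrite ler_wpM2r ?mdist_ge0// (le_trans (expR_abs_ub _ s0))//.
  by rewrite normrN ler_expR ler_wpM2l.
by rewrite mulrC -ltr_pdivlMr.
Qed.

(** The a priori bound at a small fixed time [r], tested at [v = u 1], involves the flow only
    through its starting point, which converges; the decay extends the bound to later times. *)
Lemma stability_slope_bound a b : 0 < a -> exists2 c, 0 < c &
  \forall n \near \oo, forall s, a <= s <= b -> (gs (un n s) <= c%:E)%E.
Proof.
move=> a0.
(* With the exponential at most 3/2 the denominator of the a priori bound is at least 1/3, hence the
   factor 3 in [B]. *)
have [d d0 Hd] := @near_expR_lt R (`|lam|) (3 / 2) (ltac:(lra)).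
pose r := Num.min a d.
have r0 : 0 < r by rewrite lt_min a0.
have ra : r <= a by rewrite ge_min lexx.
have rd : r <= d by rewrite ge_min lexx orbT.
have e23 : 2 / 3 <= expR (lam * r).
  apply: le_trans (expR_abs_lb _ (ltW r0)).
  have h1 : expR (`|lam| * r) <= 3 / 2.
    by apply: le_trans (ltW Hd); rewrite ler_expR ler_wpM2l.
  rewrite -(ler_pM2l (expR_gt0 (`|lam| * r))) -expRD subrr expR0; lra.
have [l l0 lE] := flow_slope_fine uf ltr01.
pose B := 3 * l ^+ 2 + (Efun lam r ^+ 2)^-1 * (mdist (u 0) (u 1) + 1) ^+ 2.
have E0 : 0 < Efun lam r ^+ 2 by rewrite exprn_gt0// Efun_gt0.
have iE0 : 0 <= (Efun lam r ^+ 2)^-1 by rewrite invr_ge0 ltW.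
have B0 : 0 <= B by apply: addr_ge0; apply: mulr_ge0 => //; exact: sqr_ge0.
exists (expR (`|lam| * `|b|) * (1 + B)); first by rewrite mulr_gt0 ?expR_gt0// ltr_wpDr.
have /metricType_numDomainType.cvgr_dist_lt/(_ 1 ltr01) := un0.
apply: filterS => n Hn s /andP[as_ sb].
have [g g0 gE] := flow_slope_fine (unf n) r0.
have q0 : 1 / 3 <= 2 * expR (lam * r) - 1 by lra.
have := flow_a_priori_slope (unf n) r0 gE lE (ltac:(lra)).
set q := 2 * _ - 1 in q0 * => G.
have q3 : q^-1 <= 3.
  have qp : 0 < q by lra.
  by rewrite -(ler_pM2l qp) mulfV ?gt_eqF//; lra.
have gB : g ^+ 2 <= B.
  apply: le_trans G _; apply: lerD; first by rewrite ler_wpM2r ?sqr_ge0.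
  rewrite ler_wpM2l// lerXn2r ?nnegrE ?addr_ge0 ?mdist_ge0//.
  have := metric_triangle (un n 0) (u 0) (u 1).
  by rewrite (metric_sym (un n 0) (u 0)); lra.
(* Uses [g <= 1 + g ^+ 2]. *)
have gB1 : g <= 1 + B by have := sqr_ge0 (g - 1 / 2); rewrite sqrrB; lra.
have rs : r <= s by exact: le_trans as_.
have := global_slope_decay (unf n) (ltW r0) rs (c := g).
rewrite gE lexx => /(_ isT)/le_trans; apply; rewrite lee_fin.
have sr0 : 0 <= s - r by rewrite subr_ge0.
apply: ler_pM => //.
apply: le_trans (expR_abs_ub _ sr0) _; rewrite normrN ler_expR ler_wpM2l//.
by have := ler_norm b; lra.
Qed.

(** The slopes at [u s] and at [un n s] bound the energy difference in the two directions by the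
    distance of these points. *)
Lemma stability_energy a b e : 0 < a -> 0 < e ->
  \forall n \near \oo, forall s, a <= s <= b -> `|fr (u s) - fr (un n s)| <= e.
Proof.
move=> a0 e0.
have [c c0 Hc] := stability_slope_bound b a0.
have [c' c'0 Hc'] := flow_slope_bound_itv b uf a0.
pose k := c + c' + `|lam| / 2.
have k0 : 0 < k by rewrite ltr_pwDl ?addr_gt0// divr_ge0.
have m0 : 0 < Num.min 1 (e / k) by rewrite lt_min ltr01 divr_gt0.
apply: filterS2 Hc (stability_dist b m0) => n Gn Dn s /andP[as_ sb].
have s0 : 0 < s by exact: lt_le_trans as_.
have := Dn s; rewrite (ltW s0) sb => /(_ isT); rewrite lt_min => /andP[D1 D2].
have abs_ : a <= s <= b by rewrite as_.
have := energy_le_slope (Gn s abs_) (ef_dom uf s0).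
have := energy_le_slope (Hc' s abs_) (ef_dom (unf n) s0).
rewrite (metric_sym (un n s)); set D := mdist _ _ in D1 D2 *.
have D0 : 0 <= D by exact: mdist_ge0.
have L2 : 0 <= `|lam| / 2 by rewrite divr_ge0.
have K1 : `|lam| / 2 * D ^+ 2 <= `|lam| / 2 * D.
  by rewrite ler_wpM2l// expr2 -[leRHS]mulr1 ler_wpM2l// ltW.
have K2 : k * D <= e by rewrite mulrC -ler_pdivlMr// ltW.
have K3 : 0 <= c * D by rewrite mulr_ge0// ltW.
have K4 : 0 <= c' * D by rewrite mulr_ge0// ltW.
by move=> E1 E2; rewrite ler_norml; rewrite /k in K2; apply/andP; split; lra.
Qed.

Lemma stability_slope_gt t c : 0 <= t -> (c%:E < gs (u t))%E ->
  \forall s \near t & n \near \oo, 0 <= s -> (c%:E < gs (un n s))%E.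
Proof.
move=> t0 cg; have [r r0 Hr] := global_slope_lsc (flow_proper uf) cg.
have r20 : 0 < r / 2 by rewrite divr_gt0.
have [d d0 Hd] := ef_cont uf t0 r20.
exists (ball t (Num.min d 1), [set n | forall s, 0 <= s <= t + 1 -> mdist (u s) (un n s) < r / 2]).
  split => /=; last exact: stability_dist.
  by apply: nbhsx_ballx; rewrite lt_min d0 ltr01.
move=> [s n] [] /=; rewrite /ball/= distrC lt_min => /andP[sd s1] Hn s0.
apply: Hr; have := Hn s; rewrite s0 => /(_ _)/wrap[|].
  by rewrite ltr_norml in s1; lra.
have := Hd s s0 sd; have := metric_triangle (un n s) (u s) (u t).
by rewrite (metric_sym (un n s) (u s)); lra.
Qed.

(* The slope of [un n] on a short interval before [s] is bounded by its energy drop there, which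
   converges to the energy drop of [u]. *)
Lemma stability_slope_lt t L c : 0 < t -> gs (u s) @[s --> t^'-] --> L%:E ->
  (gs (u t) <= L%:E)%E -> L < c ->
  \forall s \near t & n \near \oo, (gs (un n s) < c%:E)%E.
Proof.
move=> t0 gL gtL Lc.
have [c0 [c1 [c00 c01 c1c Lc0]]] : exists c0 c1, [/\ 0 < c0, c0 < c1, c1 < c & L < c0].
  have L0 : 0 <= L by rewrite -lee_fin; apply: le_trans gtL; exact: global_slope_ge0.
  by exists ((2 * L + c) / 3), ((L + 2 * c) / 3); split; lra.
have [d d0 gs_le] := flow_slope_le_near uf t0 gL gtL Lc0.
have c10 : 0 < c1 by exact: lt_trans c01.
have cc1 : 1 < c / c1 by rewrite ltr_pdivlMr ?mul1r.
have [d2 d20 Hd2] := near_expR_lt (`|lam|) cc1.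
pose del := Num.min (d / 2) (Num.min d2 (t / 4)).
have del0 : 0 < del by rewrite !lt_min d20 !divr_gt0.
have [del1 del3 del4] : [/\ del <= d / 2, del <= d2 & del <= t / 4].
  by rewrite /del !ge_min !lexx !orbT.
(* Energy errors at both ends of the interval add up to the whole gap between [c0 ^+ 2 * del] and
   [c1 ^+ 2 * del]. *)
pose eps := (c1 ^+ 2 - c0 ^+ 2) * del / 2.
have eps0 : 0 < eps.
  by rewrite divr_gt0// mulr_gt0// subr_gt0 ltr_pXn2r ?nnegrE// ltW.
have t20 : 0 < t / 2 by rewrite divr_gt0.
exists (ball t del, [set n | forall s, t / 2 <= s <= 2 * t -> `|fr (u s) - fr (un n s)| <= eps]).
  by split => /=; [exact: nbhsx_ballx|exact: stability_energy].
move=> [s n] [] /=; rewrite /ball/= ltr_norml => /andP[s1 s2] Hn.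
rewrite ltNge; apply/negP => cg.
have [H1 H2] : `|fr (u s) - fr (un n s)| <= eps /\
    `|fr (u (s - del)) - fr (un n (s - del))| <= eps.
  by split; apply: Hn; clear -s1 s2 del0 del4 t0; apply/andP; split; lra.
have [sd0 sds] : 0 < s - del /\ s - del <= s by clear -s1 s2 del0 del4 t0; split; lra.
have s0 : 0 < s by exact: lt_le_trans sds.
have sdE : s - (s - del) = del by ring.
have E1 : fr (u (s - del)) - fr (u s) <= c0 ^+ 2 * del.
  rewrite -[in leRHS]sdE; apply: (energy_drop_le uf) => //; first exact: ltW.
    exact: ef_dom uf _ sd0.
  move=> r /andP[r1 r2]; apply: gs_le; clear -s1 s2 r1 r2 del0 del1.
  by apply/andP; split; lra.
(* If the slope of [un n] is at least [c] at [s], its decay makes it at least [c2] on the interval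
   before [s]; by the choice of [del] this exceeds [c1]. *)
pose c2 := expR (- `|lam| * del) * c.
have c12 : c1 < c2.
  rewrite /c2 -(ltr_pM2l (expR_gt0 (`|lam| * del))) [ltRHS]mulrA expRlN mul1r -ltr_pdivlMr//.
  by apply: le_lt_trans Hd2; rewrite ler_expR ler_wpM2l.
have E2 : c2 ^+ 2 * del <= fr (un n (s - del)) - fr (un n s).
  rewrite -[in leLHS]sdE.
  apply: (energy_drop_ge (unf n)) => //; first exact: ltW.
  - exact: ef_dom (unf n) _ sd0.
  - by apply/ltW/(lt_trans c10).
  move=> r /andP[r1 r2]; have r0 : 0 < r by exact: lt_trans r1.
  have [g g0 gE] := flow_slope_fine (unf n) r0.
  have := global_slope_decay (unf n) (ltW r0) (ltW r2) (c := g).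
  rewrite gE lexx => /(_ isT)/(le_trans cg); rewrite !lee_fin => K.
  rewrite /c2 -(ler_pM2l (expR_gt0 (`|lam| * del))) mulrA expRlN mul1r.
  apply: le_trans K _; rewrite ler_wpM2r//.
  have rs0 : 0 <= s - r by rewrite subr_ge0 ltW.
  apply: le_trans (expR_abs_ub _ rs0) _; rewrite normrN ler_expR ler_wpM2l//.
  by rewrite lerBlDl -lerBlDr ltW.
have : c1 ^+ 2 * del < c2 ^+ 2 * del.
  by rewrite ltr_pM2r// ltr_pXn2r ?nnegrE// ltW// (lt_trans c10).
rewrite /eps !ler_norml in H1 H2; case/andP: H1 => H1 H1'; case/andP: H2 => H2 H2'.
by clear -E1 E2 H1 H1' H2 H2' => ?; lra.
Qed.

End stability.

(** The curves have no prescribed value at 0, so the contraction starts from a small positive time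
    at which both are close to [x0]. *)
Lemma EVI_solution_unique (x0 : X) (w1 w2 : R -> X) :
  EVI_solution lam phi w1 -> EVI_solution lam phi w2 ->
  w1 t @[t --> 0^'+] --> x0 -> w2 t @[t --> 0^'+] --> x0 ->
  forall t : R, 0 < t -> w1 t = w2 t.
Proof.
move=> s1 s2 c1 c2 t t0; apply: mdist_positivity; apply/eqP.
rewrite eq_le mdist_ge0 andbT; apply/ler_addgt0Pr => e e0; rewrite add0r.
pose k := 2 * expR (`|lam| * t).
have k0 : 0 < k by rewrite mulr_gt0// expR_gt0.
have ek : 0 < e / k by rewrite divr_gt0.
have /metricType_numDomainType.cvgr_dist_lt/(_ _ ek) H1 := c1.
have /metricType_numDomainType.cvgr_dist_lt/(_ _ ek) H2 := c2.
have [s [[D1 D2] [s0 st]]] := @filter_ex _ _ (at_right_proper_filter 0) _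
  (filterI (filterI H1 H2) (filterI (nbhs_right_gt 0) (nbhs_right_lt t0))).
have ts0 : 0 <= t - s by rewrite subr_ge0 ltW.
have := flow_contraction (EVI_flow_shift s0 s1)
  (EVI_flow_shift s0 s2) (lexx 0) ts0.
rewrite subrKC addr0 subr0 => /le_trans; apply.
apply: (@le_trans _ _ (expR (`|lam| * t) * (2 * (e / k)))).
  apply: ler_pM; [exact: expR_ge0|exact: mdist_ge0| |].
    apply: le_trans (expR_abs_ub _ ts0) _; rewrite normrN ler_expR ler_wpM2l//.
    by rewrite gerBl ltW.
  have := metric_triangle (w1 s) x0 (w2 s); rewrite (metric_sym (w1 s) x0).
  rewrite /= in D1 D2; lra.
rewrite le_eqVlt; apply/orP; left; apply/eqP; rewrite /k; field.
by rewrite gt_eqF// expR_gt0.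
Qed.

Lemma near_pair_at (t : R) (Q : R -> nat -> Prop) :
  (\forall s \near t & n \near \oo, Q s n) -> \forall n \near \oo, Q t n.
Proof.
move=> [[A B] [/= At Bn] H]; apply: filterS Bn => n Bn; apply: (H (t, n)).
by split => //; exact: nbhs_singleton.
Qed.

(** * Convergence of curves, energies and slopes *)

Section limits.
Variables (un : nat -> R -> X) (u : R -> X).
Hypotheses (unf : forall n, evi_flow (un n)) (uf : evi_flow u).
Hypothesis un0 : un n 0 @[n --> \oo] --> u 0.

Lemma stability_curves_uniform : {family @compactly_in R `[0, +oo[, un @ \oo --> u}.
Proof.
apply: family_compactly_cvg => t; rewrite /= in_itv/= andbT => t0 e e0.
exists (ball t 1, [set n | forall s, 0 <= s <= t + 1 -> mdist (u s) (un n s) < e]).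
  by split => /=; [exact: nbhsx_ballx|exact: (stability_dist unf uf un0)].
move=> [s n] [/= ts Hn]; rewrite in_itv/= andbT ballEmdist/= => s0; apply: Hn.
by rewrite s0/=; move: ts; rewrite /ball/= ltr_norml => /andP[s1 s2]; lra.
Qed.

Lemma stability_energies_uniform : {family @compactly_in R `]0, +oo[,
  (fun n t => fr (un n t)) @ \oo --> (fun t => fr (u t))}.
Proof.
apply: family_compactly_cvg => t; rewrite /= in_itv/= andbT => t0 e e0.
have t20 : 0 < t / 2 by rewrite divr_gt0.
have e20 : 0 < e / 2 by rewrite divr_gt0.
exists (ball t (t / 2), [set n | forall s, t / 2 <= s <= 2 * t -> `|fr (u s) - fr (un n s)| <= e / 2]).
  by split => /=; [exact: nbhsx_ballx|exact: (stability_energy unf uf un0)].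
move=> [s n] [] /=; rewrite /ball/= ltr_norml => /andP[s1 s2] Hn _.
have := Hn s (ltac:(apply/andP; split; lra)).
by rewrite /ball/= => /le_lt_trans; apply; lra.
Qed.

Lemma slope_left_lim_regular t : 0 < t -> ~ slope_jump_set phi u t ->
  exists g, [/\ 0 <= g, gs (u t) = g%:E & gs (u s) @[s --> t^'-] --> g%:E].
Proof.
move=> t0 /not_andP[//|/contrapT].
have [L [L0 _ gL]] := flow_slope_left_cvg uf t0.
rewrite (slope_left_lim uf t0 gL).
rewrite -(global_slope_eq_slope uf (ltW t0)) => gE.
by exists L; rewrite -gE.
Qed.

Lemma stability_slopes_uniform : {family @compactly_in R (`]0, +oo[ `\` slope_jump_set phi u),
  (fun n t => fine (slope phi (un n t))) @ \oo --> (fun t => fine (slope phi (u t)))}.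
Proof.
apply: family_compactly_cvg => t; rewrite /= in_itv/= andbT => -[t0 jt] e e0.
have [g [g0 gE gL]] := slope_left_lim_regular t0 jt.
have e40 : 0 < e / 4 by rewrite divr_gt0.
have gtg : (gs (u t) <= g%:E)%E by rewrite gE.
have ltc : g < g + e / 4 by rewrite ltrDl.
have gec : ((g - e / 4)%:E < gs (u t))%E by rewrite gE lte_fin ltrBlDr.
(* The stability bounds for the constant sequence express the continuity of the slope of [u] at [t],
   which is needed to compare at nearby times. *)
have constf : (fun=> u) n 0 @[n --> \oo] --> u 0 by exact: cvg_cst.
have H1 := stability_slope_lt unf uf un0 t0 gL gtg ltc.
have H2 := stability_slope_lt (fun=> uf) uf constf t0 gL gtg ltc.
have H3 := stability_slope_gt unf uf un0 (ltW t0) gec.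
have H4 := stability_slope_gt (fun=> uf) uf constf (ltW t0) gec.
apply: filterS2 (filterI H1 H2) (filterI H3 H4) => -[s n] /= [K1 K2] [K3 K4].
rewrite in_itv/= andbT => -[s0 _].
have {}K3 := K3 (ltW s0); have {}K4 := K4 (ltW s0).
rewrite -(global_slope_eq_slope uf (ltW s0)).
rewrite -(global_slope_eq_slope (unf n) (ltW s0)).
have [p _ pE] := flow_slope_fine uf s0.
have [q _ qE] := flow_slope_fine (unf n) s0.
move: K1 K2 K3 K4; rewrite pE qE !lte_fin /= => K1 K2 K3 K4.
by rewrite /ball/= ltr_norml; apply/andP; split; lra.
Qed.

Lemma stability_curves t : 0 <= t -> un n t @[n --> \oo] --> u t.
Proof.
move=> t0 A /metricType_numDomainType.nbhs_mdistP[e /= e0 eA].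
apply: filterS (stability_dist unf uf un0 t e0) => n Hn.
by apply: eA; apply: Hn; rewrite t0 lexx.
Qed.

Lemma stability_energies t : 0 < t -> phi (un n t) @[n --> \oo] --> phi (u t).
Proof.
move=> t0; rewrite (domK (ef_dom uf t0)).
have -> : (fun n => phi (un n t)) = (fun n => (fr (un n t))%:E).
  by apply/funext => n; rewrite -domK//; exact: ef_dom (unf n) _ t0.
apply: cvg_EFin; first exact: nearW.
apply/cvgrPdist_le => e e0.
apply: filterS (stability_energy unf uf un0 t t0 e0) => n; apply.
by rewrite lexx.
Qed.

Lemma stability_slope_lower t (c : R) : 0 <= t -> (c%:E < slope phi (u t))%E ->
  \forall n \near \oo, (c%:E < slope phi (un n t))%E.
Proof.
move=> t0; rewrite -(global_slope_eq_slope uf t0) => cg.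
have := near_pair_at (stability_slope_gt unf uf un0 t0 cg).
by apply: filterS => n /(_ t0); rewrite (global_slope_eq_slope (unf n) t0).
Qed.

Lemma stability_slope_upper t (L c : R) : 0 < t -> gs (u s) @[s --> t^'-] --> L%:E ->
  (gs (u t) <= L%:E)%E -> L < c -> \forall n \near \oo, (slope phi (un n t) < c%:E)%E.
Proof.
move=> t0 gL gtL Lc.
have := near_pair_at (stability_slope_lt unf uf un0 t0 gL gtL Lc).
by apply: filterS => n; rewrite (global_slope_eq_slope (unf n) (ltW t0)).
Qed.

Lemma stability_slopes t : 0 < t -> ~ slope_jump_set phi u t ->
  slope phi (un n t) @[n --> \oo] --> slope phi (u t).
Proof.
move=> t0 jt; have [g [g0 gE gL]] := slope_left_lim_regular t0 jt.
apply: cvge_of_bounds => c.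
  by move=> cg; apply: stability_slope_lower => //; exact: ltW.
rewrite -(global_slope_eq_slope uf (ltW t0)) gE lte_fin.
by apply: stability_slope_upper => //; rewrite gE.
Qed.

Lemma stability_slopes_jump t : 0 < t ->
  [/\ (slope phi (u t) <= limn_einf (fun n => slope phi (un n t)))%E,
      cvg (slope phi (u s) @[s --> t^'-]) &
      (limn_esup (fun n => slope phi (un n t)) <= lim (slope phi (u s) @[s --> t^'-]))%E].
Proof.
move=> t0; have [L [L0 gtL gL]] := flow_slope_left_cvg uf t0.
have sL : slope phi (u s) @[s --> t^'-] --> L%:E.
  apply: cvg_trans gL; apply: near_eq_cvg; apply: filterS (nbhs_left_gt t0) => s s0.
  exact: (global_slope_eq_slope uf (ltW s0)).
split.
- by apply: limn_einf_ge_of_near => c; apply: stability_slope_lower; exact: ltW.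
- by apply/cvg_ex; exists L%:E.
- rewrite (cvg_lim (@ereal_hausdorff R) sL); apply: limn_esup_le_of_near => c.
  by rewrite lte_fin; exact: stability_slope_upper.
Qed.

End limits.

End flows.

Theorem theorem3p5 (R : realType) (X : metricType R) (phi : X -> \bar R)
    (lambda : R) (u u1 u2 : R -> X)
    (phi_proper : proper_functional phi)
    (phi_lsc : lower_semicontinuous phi)
    (u_sol : EVI_solution_C0 lambda phi u)
    (u1_sol : EVI_solution_C0 lambda phi u1)
    (u2_sol : EVI_solution_C0 lambda phi u2) :
  (* contraction and uniqueness *)
  ((forall s t : R, 0 <= s -> s < t ->
      mdist (u1 t) (u2 t)
        <= expR (- lambda * (t - s)) * mdist (u1 s) (u2 s)) /\
   (forall (u0 : X) (w1 w2 : R -> X), closure (domain phi) u0 ->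
      EVI_solution lambda phi w1 -> EVI_solution lambda phi w2 ->
      w1 t @[t --> 0^'+] --> u0 -> w2 t @[t --> 0^'+] --> u0 ->
      forall t : R, 0 < t -> w1 t = w2 t))
  /\
  (* regularizing effects *)
  ([/\ locally_lipschitz_on `]0, +oo[ u,
       (forall t : R, 0 < t -> domain (slope phi) (u t))
         /\ domain (slope phi) `<=` domain phi,
       (forall s t : R, 0 <= s -> s <= t -> (phi (u t) <= phi (u s))%E),
       (0 <= lambda -> econvex_on `[0, +oo[ (phi \o u))
         /\ (lambda < 0 -> locally_semiconvex_on `]0, +oo[ (phi \o u)) &
       (forall s t : R, 0 <= s -> s <= t ->
          ((expR (lambda * t))%:E * slope phi (u t)
             <= (expR (lambda * s))%:E * slope phi (u s))%E)
         /\ (forall t : R, 0 <= t ->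
          ((expR (lambda * s))%:E * slope phi (u s))%E @[s --> t^'+]
            --> ((expR (lambda * t))%:E * slope phi (u t))%E)])
  /\
  (* a priori estimates *)
  ((forall (v : X) (t : R), domain phi v -> 0 < t ->
      ((expR (lambda * t) / 2 * mdist (u t) v ^+ 2)%:E
         + (Eint lambda t)%:E * (phi (u t) - phi v)
         + (Eint lambda t ^+ 2 / 2)%:E * slope phi (u t) ^+ 2
       <= (2^-1 * mdist (u 0%R) v ^+ 2)%:E)%E) /\
   (forall (v : X) (t : R), domain (global_slope lambda phi) v -> 0 < t ->
      - (lambda * t) < ln 2 ->
      (slope phi (u t) ^+ 2
       <= ((2 * expR (lambda * t) - 1)^-1)%:E * global_slope lambda phi v ^+ 2
          + ((Eint lambda t ^+ 2)^-1 * mdist (u 0%R) v ^+ 2)%:E)%E))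
  /\
  (* asymptotic expansions as t tends to 0 *)
  ([/\ domain (slope phi) (u 0) -> lambda <= 0 ->
         forall (v : X) (t : R), domain phi v -> 0 <= t ->
         ((expR (2 * lambda * t) / 2 * mdist (u t) v ^+ 2)%:E
            - (2^-1 * mdist (u 0%R) v ^+ 2)%:E
          <= (Eint (2 * lambda) t)%:E * (phi v - phi (u 0%R))
             + (t ^+ 2 / 2)%:E * slope phi (u 0%R) ^+ 2)%E,
       forall o, domain phi o ->
         linearly_bounded_below
           (fun x => phi x - (lambda / 2 * mdist x o ^+ 2)%:E)%E &
       domain phi (u 0) ->
         forall (v : X) (t : R), domain phi v -> 0 <= t ->
         ((expR (lambda * t) / 2 * mdist (u t) v ^+ 2)%:E
            - (2^-1 * mdist (u 0%R) v ^+ 2)%:E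
          <= (Eint lambda t)%:E * (phi v - phi (u 0%R))
             + (2 * expR (- (lambda * t)))%:E
               * \int[lebesgue_measure]_(s in `]0%R, t[)
                   ((expR (2 * lambda * s))%:E
                    * (phi (u 0%R)
                       - moreau_yosida phi (Eint lambda s) (u 0%R))))%E])
  /\
  (* right and left limits, energy identity *)
  ([/\ forall t : R, 0 < t \/ (t = 0 /\ domain (slope phi) (u 0)) ->
         [/\ right_energy_identity lambda phi u t,
             right_speed u s @[s --> t^'+] --> right_speed u t &
             right_energy_derivative phi u s @[s --> t^'+]
               --> right_energy_derivative phi u t],
       ~ domain (slope phi) (u 0) ->
         [/\ cvg (speed_right_quot u 0 @ (0 : R)^'+),
             cvg (energy_right_quot phi u 0 @ (0 : R)^'+) &
             [/\ right_energy_derivative phi u 0 = -oo,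
                 - (right_speed u 0 ^+ 2) = -oo,
                 - (slope phi (u 0%R) ^+ 2) = -oo,
                 - (length_slope phi (u 0%R) ^+ 2) = -oo &
                 - (global_slope lambda phi (u 0%R) ^+ 2) = -oo]]%E &
       exists C : set R,
         [/\ countable C, C `<=` `]0, +oo[ &
             left_energy_identities lambda phi u C]])
  /\
  (* asymptotic behaviour as t tends to +oo *)
  ((0 < lambda -> (forall c, complete_set (sublevel phi c)) ->
      exists ubar : X,
        [/\ is_minimum_point phi ubar,
            forall x, is_minimum_point phi x -> x = ubar &
            forall t0 t : R, 0 <= t0 -> t0 < t ->
            [/\ ((lambda / 2 * mdist (u t) ubar ^+ 2)%:E
                   <= phi (u t) - phi ubar)%E
                /\ (phi (u t) - phi ubar
                   <= ((2 * lambda)^-1)%:E * slope phi (u t) ^+ 2)%E,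
                mdist (u t) ubar
                  <= mdist (u t0) ubar * expR (- lambda * (t - t0)),
                (phi (u t) - phi ubar
                  <= (phi (u t0) - phi ubar)
                     * (expR (- (2 * lambda) * (t - t0)))%:E)%E
                /\ (phi (u t) - phi ubar
                  <= ((2 * Eint lambda (t - t0))^-1
                        * mdist (u t0) ubar ^+ 2)%:E)%E &
                (slope phi (u t)
                  <= slope phi (u t0) * (expR (- lambda * (t - t0)))%:E)%E
                /\ (slope phi (u t)
                  <= ((Eint lambda (t - t0))^-1 * mdist (u t0) ubar)%:E)%E]]) /\
   (lambda = 0 ->
      (forall ubar, is_minimum_point phi ubar ->
         (forall t : R, 0 < t ->
            (slope phi (u t) <= (mdist (u 0%R) ubar / t)%:E)%E /\
            (phi (u t) - phi ubar
               <= (mdist (u 0%R) ubar ^+ 2 / (2 * t))%:E)%E) /\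
         (forall s t : R, 0 <= s -> s <= t ->
            mdist (u t) ubar <= mdist (u s) ubar)) /\
      ((forall c, compact (sublevel phi c)) ->
         exists2 ubar, is_minimum_point phi ubar &
           u t @[t --> +oo] --> ubar)))
  /\
  (* stability *)
  (forall un : nat -> R -> X,
     (forall n, EVI_solution_C0 lambda phi (un n)) ->
     un n 0 @[n --> \oo] --> u 0 ->
     let C := slope_jump_set phi u in
     [/\ countable C /\ left_energy_identities lambda phi u C,
         [/\ forall t : R, 0 <= t -> un n t @[n --> \oo] --> u t,
             forall t : R, 0 < t -> phi (un n t) @[n --> \oo] --> phi (u t) &
             forall t : R, 0 < t -> ~ C t ->
               slope phi (un n t) @[n --> \oo] --> slope phi (u t)],
         [/\ {family @compactly_in R `[0, +oo[, un @ \oo --> u},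
             {family @compactly_in R `]0, +oo[,
               (fun n t => fine (phi (un n t))) @ \oo
                 --> (fun t => fine (phi (u t)))} &
             {family @compactly_in R (`]0, +oo[ `\` C),
               (fun n t => fine (slope phi (un n t))) @ \oo
                 --> (fun t => fine (slope phi (u t)))}] &
         forall t : R, C t ->
           [/\ (slope phi (u t) <= limn_einf (fun n => slope phi (un n t)))%E,
               (limn_einf (fun n => slope phi (un n t))
                  <= limn_esup (fun n => slope phi (un n t)))%E,
               cvg (slope phi (u s) @[s --> t^'-]) &
               (limn_esup (fun n => slope phi (un n t))
                  <= lim (slope phi (u s) @[s --> t^'-]))%E]]).
Proof.
have [phi_gtNy [x0 dx0]] := phi_proper.
have uf := EVI_C0_flow phi_gtNy phi_lsc u_sol.
have u1f := EVI_C0_flow phi_gtNy phi_lsc u1_sol.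
have u2f := EVI_C0_flow phi_gtNy phi_lsc u2_sol.
have gsE t (t0 : 0 <= t) := global_slope_eq_slope phi_gtNy phi_lsc uf t0.
split; [split|split; [|split; [split|split; [|split; [|split; [split|]]]]]].
- move=> s t s0 st; exact: (flow_contraction phi_gtNy phi_lsc u1f u2f s0 (ltW st)).
- by move=> u0 w1 w2 _; exact: EVI_solution_unique.
- split.
  + exact: (flow_locally_lipschitz phi_gtNy phi_lsc uf).
  + split; first by move=> t; exact: (flow_slope_domain phi_gtNy phi_lsc uf).
    by move=> x; exact: slope_wrt_dom.
  + by move=> s t; exact: (flow_energy_nonincreasing phi_gtNy uf).
  + split; first exact: (flow_energy_convex phi_gtNy phi_lsc uf).
    exact: (flow_energy_semiconvex phi_gtNy phi_lsc uf).
  + split; first by move=> s t; exact: (flow_slope_weighted_nonincreasing phi_gtNy phi_lsc uf).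
    by move=> t; exact: (flow_slope_weighted_right_cvg phi_gtNy phi_lsc uf).
- move=> v t dv t0; rewrite -(gsE t (ltW t0)) EintE ?(ltW t0)//.
  have [g _ gE] := flow_slope_fine phi_gtNy phi_lsc uf t0.
  rewrite gE (domK phi_gtNy dv) (domK phi_gtNy (ef_dom uf t0)).
  rewrite -EFinB -EFin_expe -!EFinM -!EFinD lee_fin.
  exact: (flow_a_priori phi_gtNy phi_lsc uf dv t0 gE).
- move=> v t dv t0 lt2; rewrite -(gsE t (ltW t0)) EintE ?(ltW t0)//.
  have [g _ gE] := flow_slope_fine phi_gtNy phi_lsc uf t0.
  have [l lE] : exists l, global_slope lambda phi v = l%:E.
    have := global_slope_ge0 phi lambda v; move: dv; rewrite /domain/=.
    by case: (global_slope _ _ _) => [l| |]// _ _; exists l.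
  (* This is the condition on [lambda * t] and [ln 2], exponentiated. *)
  have q0 : 0 < 2 * expR (lambda * t) - 1.
    have : expR (- (lambda * t)) < 2 by rewrite -(@lnK _ 2) ?posrE// ltr_expR.
    rewrite -(ltr_pM2l (expR_gt0 (lambda * t))) -expRD subrr expR0; lra.
  rewrite gE lE -!EFin_expe -EFinM -EFinD lee_fin.
  exact: (flow_a_priori_slope phi_gtNy phi_lsc uf t0 gE lE q0).
- split.
  + move=> du l0 v t dv t0; rewrite -(gsE 0 (lexx 0)) EintE//.
    have [g gE] : exists g, global_slope lambda phi (u 0) = g%:E.
      have := global_slope_ge0 phi lambda (u 0); move: du; rewrite /domain/= -(gsE 0 (lexx 0)).
      by case: (global_slope _ _ _) => [g| |]// _ _; exists g.
    have d0 : domain phi (u 0) by apply: (@slope_wrt_dom _ _ _ mdiste).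
    rewrite gE (domK phi_gtNy dv) (domK phi_gtNy d0).
    rewrite -!EFinB -EFin_expe -!EFinM -!EFinD lee_fin.
    exact: (flow_expansion_slope phi_gtNy phi_lsc uf l0 gE dv t0).
  (* The point [u 1] has finite global slope; [o] enters only through the constants. *)
  + move=> o _; have [g _ gE] := flow_slope_fine phi_gtNy phi_lsc uf ltr01.
    exact: (linearly_bounded_below_slope phi_gtNy _ gE).
  + by move=> d0 v t; exact: (flow_expansion_moreau_yosida phi_gtNy phi_lsc uf d0).
- split.
  + move=> t [t0|[-> du]].
      apply: (right_energy_identity_flow phi_gtNy phi_lsc uf (ltW t0)).
      exact: (global_slope_fin phi_gtNy phi_lsc uf).
    apply: (right_energy_identity_flow phi_gtNy phi_lsc uf (lexx 0)).
    by rewrite (gsE 0 (lexx 0)).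
  + exact: (right_energy_identity_irregular phi_gtNy phi_lsc uf).
  + exists (slope_jump_set phi u); split.
    * exact: (countable_slope_jump_set phi_gtNy phi_lsc uf).
    * by move=> t [t0 _]; rewrite /= in_itv/= t0.
    * exact: (left_energy_identities_jump_set phi_gtNy phi_lsc uf).
- move=> l0 compl; have [x gx] := complete_rest_point phi_gtNy phi_lsc l0 compl uf.
  have mx := global_slope0_minimum phi_gtNy (ltW l0) gx.
  exists x; split => //.
    move=> y my; have [dx Hx] := (global_slope0P lambda phi_gtNy x).1 gx.
    have dy : domain phi y by exact: le_lt_trans (my x) dx.
    have := Hx y dy; have := my x; rewrite (domK phi_gtNy dx) (domK phi_gtNy dy) lee_fin => h1 h2.
    apply/esym/mdist2_le0; rewrite -(pmulr_rle0 _ l0); lra.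
  move=> t0 t t00 t0t; have tp : 0 < t by exact: le_lt_trans t0t.
  rewrite EintE ?subr_ge0 ?(ltW t0t)//; split.
  + split; first exact: (energy_gap_ge phi_gtNy uf gx).
    exact: (energy_gap_le phi_gtNy phi_lsc uf gx).
  + exact: (dist_rest_point phi_gtNy phi_lsc uf gx t00 (ltW t0t)).
  + split; first exact: (energy_gap_decay phi_gtNy phi_lsc uf gx l0).
    exact: (energy_rest_point phi_gtNy uf gx).
  + split; first exact: (flow_slope_decay_slope phi_gtNy phi_lsc uf t00 (ltW t0t)).
    exact: (slope_rest_point phi_gtNy phi_lsc uf gx (ltW l0)).
- move=> l0; split.
    move=> x mx; have gx : global_slope lambda phi x = 0%E.
      by apply: minimum_global_slope0 => //; [exists x0|rewrite l0].
    have E0 t : Efun lambda t = t by rewrite /Efun l0 eqxx.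
    split=> [t t0|s t s0 st].
      have := slope_rest_point phi_gtNy phi_lsc uf gx _ (lexx 0) t0.
      have := energy_rest_point phi_gtNy uf gx (lexx 0) t0.
      rewrite subr0 E0 l0 mulrC => H1 /(_ (lexx 0)); rewrite mulrC => H2.
      by split.
    have := dist_rest_point phi_gtNy phi_lsc uf gx s0 st.
    by rewrite l0 oppr0 mul0r expR0 mulr1.
  move=> comp; have [x gx ux] := compact_rest_point phi_gtNy phi_lsc l0 comp uf.
  by exists x => //; apply: (global_slope0_minimum phi_gtNy _ gx); rewrite l0.
- move=> un un_sol un0 C.
  have unf n := EVI_C0_flow phi_gtNy phi_lsc (un_sol n).
  split.
  + split; first exact: (countable_slope_jump_set phi_gtNy phi_lsc uf).
    exact: (left_energy_identities_jump_set phi_gtNy phi_lsc uf).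
  + split=> t t0.
    * exact: (stability_curves phi_gtNy phi_lsc unf uf un0).
    * exact: (stability_energies phi_gtNy phi_lsc unf uf un0).
    * exact: (stability_slopes phi_gtNy phi_lsc unf uf un0).
  + split.
    * exact: (stability_curves_uniform phi_gtNy phi_lsc unf uf un0).
    * exact: (stability_energies_uniform phi_gtNy phi_lsc unf uf un0).
    * exact: (stability_slopes_uniform phi_gtNy phi_lsc unf uf un0).
  + move=> t [t0 _].
    have [H1 H2 H3] := stability_slopes_jump phi_gtNy phi_lsc unf uf un0 t0.
    by split => //; exact: limn_einf_sup.
Qed.
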